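(* Let $(r_n)_{n\ge 1}$ be a sequence of integers with $r_n\ge 3$, let $\mathbf{w}=\mathbf{w}_n\in\mathbb{S}^{n-1}$ be an arbitrary sequence of deterministic unit vectors, let $\mathcal{G}=\mathcal{G}_n\sim\mathsf{GOTE}(r_n,n)$ (all defined on a common probability space), and let $M_n=\mathcal{G}\cdot\mathbf{w}^{\otimes(r_n-2)}$ and $\theta=\theta_n=\frac{1}{\sqrt{r_n-1}}$. Then, as $n\to\infty$, the expected empirical spectral distribution $\bar\mu_{\frac{1}{\theta\sqrt n}M_n}$ converges weakly to $\nu_{\mathsf{sc},1}$. Moreover, if $r_n\ll n^2$, then $\mu_{\frac{1}{\theta\sqrt n}M_n}$ converges weakly to $\nu_{\mathsf{sc},1}$ in probability, and if $r_n\ll \frac{n^2}{\log n}$, then this weak convergence holds almost surely.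
   Context: A symmetric tensor of order $r$ and dimension $n$ is an array $(\mathcal{T}_{i_1,\dots,i_r})_{(i_1,\dots,i_r)\in[n]^r}$ of reals invariant under permutations of its indices. $\mathcal{G}\sim\mathsf{GOTE}(r,n)$ (Gaussian Orthogonal Tensor Ensemble) means that $\mathcal{G}$ is a random symmetric tensor of order $r$ and dimension $n$ with density proportional to $\exp\big(-\frac{1}{2r}\|\mathcal{G}\|_F^2\big)$ with respect to Lebesgue measure on the space of symmetric tensors, where $\|\mathcal{G}\|_F^2=\sum_{(i_1,\dots,i_r)\in[n]^r}\mathcal{G}_{i_1\cdots i_r}^2$. Equivalently, the entries indexed by distinct multisets $\{i_1,\dots,i_r\}$ are independent, with $\mathcal{G}_{i_1\cdots i_r}\sim\mathcal{N}(0,r/\#\mathrm{Perm}(i_1,\dots,i_r))$, where $\#\mathrm{Perm}(i_1,\dots,i_r)$ is the number of distinct rearrangements of $(i_1,\dots,i_r)$. $\mathbb{S}^{n-1}$ is the unit sphere of $\mathbb{R}^n$. The contraction $\mathcal{G}\cdot\mathbf{w}^{\otimes(r-2)}$ is the $n\times n$ symmetric matrix with $(i,j)$ entry $\sum_{i_3,\dots,i_r}\mathcal{G}_{iji_3\cdots i_r}w_{i_3}\cdots w_{i_r}$. For an $n\times n$ symmetric random matrix $A$ with eigenvalues $\lambda_1\ge\dots\ge\lambda_n$, $\mu_A=\frac1n\sum_i\delta_{\lambda_i}$ is its empirical spectral distribution, and $\bar\mu_A$, defined by $\int f\,d\bar\mu_A=\mathbb{E}\int f\,d\mu_A$ for bounded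 measurable $f$, is its expected empirical spectral distribution. $\nu_{\mathsf{sc},\sigma^2}$ is the semicircle law with density $\frac{1}{2\pi\sigma^2}\sqrt{4\sigma^2-x^2}$ on $[-2\sigma,2\sigma]$. $f(n)\ll g(n)$ means $f(n)/g(n)\to 0$. *)

(* Defs.v *)
From HB Require Import structures.
From mathcomp Require Import all_boot all_order all_algebra.
From mathcomp Require Import all_classical all_reals all_analysis.
From mathcomp Require Import measurable_realfun.

Set Implicit Arguments.
Unset Strict Implicit.
Unset Printing Implicit Defensive.

Import Order.TTheory GRing.Theory Num.Theory.
Import numFieldNormedType.Exports.

Local Open Scope classical_set_scope.
Local Open Scope ring_scope.

(* The number of distinct rearrangements of the multi-index t. *)
Definition nperm (r n : nat) (t : r.-tuple 'I_n) : nat :=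
  #|[pred u : r.-tuple 'I_n | perm_eq u t]|.

Definition mutually_independent d (T : measurableType d) (R : realType)
    (P : probability T R) (I : finType) (D : {pred I})
    (X : I -> {RV P >-> R}) : Prop :=
  forall (J : {set I}) (B : I -> set R),
    J \subset D -> (forall i, measurable (B i)) ->
    P (\bigcap_(i in [set` J]) X i @^-1` B i) =
    (\prod_(i in J) P (X i @^-1` B i))%E.

(* The Gaussian orthogonal tensor ensemble GOTE(r, n). A tensor is a family
   indexed by multi-indices t = (i_1, ..., i_r); each multiset of indices is
   represented by its nondecreasing arrangement. The second argument of
   normal_prob is the standard deviation, here for the variance r / #Perm(t). *)
Definition GOTE d (T : measurableType d) (R : realType) (P : probability T R)
    (r n : nat) (G : r.-tuple 'I_n -> {RV P >-> R}) : Prop :=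
  [/\ forall (t u : r.-tuple 'I_n) (x : T), perm_eq t u -> G t x = G u x,
      forall (t : r.-tuple 'I_n) (B : set R), measurable B ->
        distribution P (G t) B =
        normal_prob 0 (Num.sqrt (r%:R / (nperm t)%:R)) B &
      mutually_independent
        [pred t : r.-tuple 'I_n | sorted leq (map val t)] G].

Section spectral_distributions.
Context {R : realType}.

(* The matrix G . w^{(x)(r-2)} (for r >= 2): its (i, j) entry sums over the
   multi-indices t = (i, j, i_3, ..., i_r). *)
Definition tensor_contraction (r n : nat) (G : r.-tuple 'I_n -> R) (w : 'rV[R]_n) :
    'M[R]_n :=
  \matrix_(i, j) \sum_(t : r.-tuple 'I_n | take 2 t == [:: i; j])
    G t * \prod_(k <- drop 2 t) w 0 k.

(* Eigenvalues in nonincreasing order, with multiplicity; meaningful when the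
   characteristic polynomial splits over R, e.g. when A is symmetric. *)
Definition eigenvalues (n : nat) (A : 'M[R]_n) : n.-tuple R :=
  xget [tuple 0 | i < n] [set s : n.-tuple R |
    sorted >=%R s /\ char_poly A = \prod_(x <- s) ('X - x%:P)].

Definition esd (n : nat) (A : 'M[R]_n) : {measure set R -> \bar R} :=
  mscale (n%:R^-1)%:nng (msum (fun i => \d_((eigenvalues A)`_i)) n).

(* Expected empirical spectral distribution of the random matrix A: the
   probability measure characterized by int f dmu = E int f d(esd A) for
   bounded measurable f. *)
Definition expected_esd d (T : measurableType d) (P : probability T R)
    (n : nat) (A : T -> 'M[R]_n) : probability R R :=
  get [set mu : probability R R |
    forall f : R -> R, measurable_fun setT f -> bounded_fun f ->
      (\int[mu]_x (f x)%:E = 'E_P[fun t => (\int[esd (A t)]_x f x)%R])%E].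

Definition semicircle_pdf (sigma x : R) : R :=
  (2 * pi * sigma ^+ 2)^-1 * Num.sqrt (4 * sigma ^+ 2 - x ^+ 2) *
  \1_`[- (2 * sigma), 2 * sigma] x.

(* The semicircle law of variance sigma ^+ 2. *)
Definition semicircle (sigma : R) : set R -> \bar R :=
  fun B => (\int[lebesgue_measure]_(x in B) (semicircle_pdf sigma x)%:E)%E.

Lemma measurable_semicircle_pdf (sigma : R) :
  measurable_fun setT (semicircle_pdf sigma).
Proof.
apply: measurable_funM; last exact: measurable_indic.
apply: measurable_funM => //.
apply: (measurableT_comp (f := @Num.sqrt R)).
  by apply: continuous_measurable_fun; exact: sqrt_continuous.
by apply: measurable_funB => //; exact: measurable_funX.
Qed.

Lemma semicircle_pdf_ge0 (sigma x : R) : 0 <= semicircle_pdf sigma x.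
Proof.
apply: mulr_ge0; last by rewrite indicE.
apply: mulr_ge0; last exact: sqrtr_ge0.
rewrite invr_ge0; apply: mulr_ge0; last exact: sqr_ge0.
by apply: mulr_ge0 => //; exact: pi_ge0.
Qed.

Section semicircle_measure.
Variable sigma : R.

Let semicircle0 : semicircle sigma set0 = 0%E.
Proof. by rewrite /semicircle integral_set0. Qed.

Let semicircle_ge0 B : (0 <= semicircle sigma B)%E.
Proof. by apply: integral_ge0 => x _; rewrite lee_fin semicircle_pdf_ge0. Qed.

Let semicircle_sigma_additive : semi_sigma_additive (semicircle sigma).
Proof.
move=> /= F mF tF mUF; rewrite /semicircle ge0_integral_bigcup//=.
- apply: is_cvg_ereal_nneg_natsum_cond => n _ _.
  by apply: integral_ge0 => x _; rewrite lee_fin semicircle_pdf_ge0.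
- apply/measurable_EFinP/measurable_funTS; exact: measurable_semicircle_pdf.
- by move=> x _; rewrite lee_fin semicircle_pdf_ge0.
Qed.

HB.instance Definition _ := isMeasure.Build _ _ _ (semicircle sigma)
  semicircle0 semicircle_ge0 semicircle_sigma_additive.

End semicircle_measure.

Definition weak_cvg (mu : nat -> {measure set R -> \bar R})
    (nu : {measure set R -> \bar R}) : Prop :=
  forall f : R -> R, continuous f -> bounded_fun f ->
    \int[mu n]_x f x @[n --> \oo] --> \int[nu]_x f x.

(* Weak convergence in probability of a sequence of random measures to a
   deterministic measure. *)
Definition weak_cvg_in_prob d (T : measurableType d) (P : probability T R)
    (mu : nat -> T -> {measure set R -> \bar R})
    (nu : {measure set R -> \bar R}) : Prop :=
  forall f : R -> R, continuous f -> bounded_fun f ->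
    forall e : R, 0 < e ->
      P [set t | e <= `|\int[mu n t]_x f x - \int[nu]_x f x|]
        @[n --> \oo] --> 0%E.

Definition much_less (f g : nat -> R) : Prop :=
  f n / g n @[n --> \oo] --> 0.

End spectral_distributions.

(* Main.v *)
From HB Require Import structures.
Require Import Defs.
From mathcomp Require Import all_boot all_order all_algebra.
From mathcomp Require Import all_fingroup.
From mathcomp Require Import complex.
From mathcomp Require Import all_classical all_reals all_analysis.
From mathcomp Require Import measurable_realfun.
From mathcomp Require Import ring lra zify.

Set Implicit Arguments.
Unset Strict Implicit.
Unset Printing Implicit Defensive.

Import Order.TTheory GRing.Theory Num.Theory.
Import numFieldNormedType.Exports.

Local Open Scope classical_set_scope.
Local Open Scope ring_scope.

(** Let [n >= 1] and [r = r_n >= 3], and let [A] be the rescaled contraction, a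
    symmetric Gaussian matrix whose law depends on the unit vector [w]. The
    dependence on [w] is confined to a perturbation of rank two. Indeed let [Pm]
    be the projection on the hyperplane orthogonal to [w], and [B = Pm A Pm]. The
    covariance of two rank-one contractions of the tensor is a permanent of scalar
    products of their factors ([contraction_covariance]); when the first two
    factors are orthogonal to [w] this permanent is that of a two-by-two block,
    and the entries of [B] have the covariance
    [(Pm_ip Pm_js + Pm_is Pm_jp) / n] ([compressed_covariance]). So [B] is a
    Gaussian orthogonal ensemble on the hyperplane, for every [r], and [A - B]
    has rank at most two ([compression_rank]), so that the ordered spectra of [A]
    and [B] interlace with a shift of two ([rank_interlacing]).

    The spectrum of [B] is handled by moments. Let [e l] be the expectation of
    the product of the normalized traces of the powers of [B] listed in [l].
    Gaussian integration by parts of one entry of the first trace expresses it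
    through lists of smaller weight, up to explicit terms of order [1 / n] and
    [1 / n ^ 2] ([matrix_loop_equations]). By induction on the weight, [e l]
    tends to the product of the solutions of the recursion of Segner
    ([loop_leading_order]), which are the moments of the semicircle law
    ([semicircle_moment_rec]), and [e (l ++ l') - e l * e l'] is of order
    [1 / n ^ 2] ([loop_factorization]). The variances of the traces are thus
    summable in [n], and almost surely all the moments of the spectrum of [B]
    converge, whatever the joint law of the successive tensors
    ([ae_cvg_loop_equations]).

    What remains is deterministic ([interlaced_moments_cvg]). Weierstrass
    approximation turns convergence of moments into weak convergence for [B].
    Interlacing changes the average of a bounded monotone function, hence of a
    bounded Lipschitz function that is constant outside a segment, by terms of
    order [1 / n]. Such functions approximate a bounded continuous function on
    [[-3, 3]], and one of them bounds the fraction of the spectrum of [A] that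
    lies outside. Hence the spectrum of [A] converges weakly almost surely.

    Dominated convergence then gives convergence in probability and convergence
    of the expected distribution. The latter is defined by a choice among the
    probability measures with the right integrals; such a measure exists because
    the ordered eigenvalues are measurable ([measurable_eigenvalue],
    [expected_esdE]). *)

(** * The hierarchy of loop equations *)

Section loop_equations.
Variable R : realFieldType.

(** [e l] stands for the expectation of the product of the normalized traces
    of the powers listed in [l], for a Gaussian symmetric matrix of size [n]
    compressed to a hyperplane: the rank [n.-1] of the hyperplane gives the
    value [1 - n^-1] of the normalized trace of order 0, and integration by
    parts of one entry of the first trace gives the recursion. *)
Definition loop_equations (n : nat) (e : seq nat -> R) : Prop :=
  [/\ e [::] = 1,
      forall l, e (0%N :: l) = (1 - n%:R^-1) * e l &
      forall k l, e (k.+1 :: l) =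
        \sum_(a < k) e (val a :: (k.-1 - a)%N :: l) +
        k%:R / n%:R * e (k.-1 :: l) +
        n%:R ^- 2 * \sum_(j < size l) (2 * nth 0%N l j)%:R *
          e ((k + nth 0%N l j).-1 :: take j l ++ drop j.+1 l)].

(** A quantity depending on [n] and on a solution of the loop equations is of
    order [n^-p] uniformly in that solution. *)
Definition uniformly_O (p : nat) (q : nat -> (seq nat -> R) -> R) : Prop :=
  exists C : R, forall n e, (0 < n)%N -> loop_equations n e ->
    `|q n e| <= C / n%:R ^+ p.

Lemma eq_uniformly_O p q q' :
  (forall n e, (0 < n)%N -> loop_equations n e -> q n e = q' n e) ->
  uniformly_O p q' -> uniformly_O p q.
Proof. by move=> E [C HC]; exists C => n e n0 He; rewrite E// HC. Qed.

Lemma uniformly_O0 p : uniformly_O p (fun _ _ => 0).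
Proof. by exists 0 => n e _ _; rewrite normr0 mul0r. Qed.

Lemma uniformly_OD p q q' : uniformly_O p q -> uniformly_O p q' ->
  uniformly_O p (fun n e => q n e + q' n e).
Proof.
move=> [C HC] [C' HC']; exists (C + C') => n e n0 He.
by rewrite mulrDl (le_trans (ler_normD _ _))// lerD ?HC ?HC'.
Qed.

Lemma uniformly_O_sum p m (q : 'I_m -> nat -> (seq nat -> R) -> R) :
  (forall i, uniformly_O p (q i)) ->
  uniformly_O p (fun n e => \sum_(i < m) q i n e).
Proof.
elim: m q => [|m IH] q H.
  by apply: eq_uniformly_O (uniformly_O0 p) => n e _ _; rewrite big_ord0.
apply: (@eq_uniformly_O _ _ (fun n e => q ord0 n e +
    \sum_(i < m) q (lift ord0 i) n e)) => [n e _ _|]; first by rewrite big_ord_recl.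
by apply: uniformly_OD => //; apply: IH => i; exact: H.
Qed.

Lemma uniformly_OM p p' q q' : uniformly_O p q -> uniformly_O p' q' ->
  uniformly_O (p + p') (fun n e => q n e * q' n e).
Proof.
move=> [C HC] [C' HC']; exists (C * C') => n e n0 He.
by rewrite normrM exprD invfM mulrACA ler_pM ?HC ?HC'.
Qed.

Lemma uniformly_O_cst a : uniformly_O 0 (fun _ _ => a).
Proof. by exists `|a| => n e _ _; rewrite expr0 divr1. Qed.

Lemma uniformly_OVn p : uniformly_O p (fun n _ => n%:R ^- p).
Proof.
by exists 1 => n e n0 _; rewrite ger0_norm ?mul1r// invr_ge0 exprn_ge0.
Qed.

Lemma uniformly_OZ a p q : uniformly_O p q -> uniformly_O p (fun n e => a * q n e).
Proof. exact: (uniformly_OM (uniformly_O_cst a)). Qed.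

Lemma uniformly_O_le p p' q : (p' <= p)%N -> uniformly_O p q -> uniformly_O p' q.
Proof.
move=> pp' [C HC]; exists C => n e n0 He; apply: (le_trans (HC n e n0 He)).
have C0 : 0 <= C.
  have := le_trans (normr_ge0 _) (HC n e n0 He).
  by rewrite pmulr_lge0// invr_gt0 exprn_gt0// ltr0n.
rewrite ler_wpM2l// lef_pV2 ?posrE ?exprn_gt0 ?ltr0n//.
by rewrite ler_weXn2l// ler1n.
Qed.

(** Every term on the right-hand side of a loop equation has smaller weight:
    the recursion lowers the total order, at the price of at most one more
    trace, and the equation for the order 0 removes one trace. *)
Definition loop_weight (l : seq nat) : nat := (2 * sumn l + size l)%N.

Lemma loop_weight_split k a l : (a < k)%N ->
  (loop_weight (a :: (k.-1 - a)%N :: l) < loop_weight (k.+1 :: l))%N.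
Proof. by rewrite /loop_weight /= => ak; lia. Qed.

Lemma loop_weight_pred k l : (loop_weight (k.-1 :: l) < loop_weight (k.+1 :: l))%N.
Proof. rewrite /loop_weight /=; lia. Qed.

Lemma loop_weight_merge k l j : (j < size l)%N ->
  (loop_weight ((k + nth 0 l j).-1 :: take j l ++ drop j.+1 l) <
   loop_weight (k.+1 :: l))%N.
Proof.
move=> jl; rewrite /loop_weight /=.
have /(congr1 sumn) := cat_take_drop j l.
have /(congr1 size) := cat_take_drop j l.
by rewrite (drop_nth 0%N jl) !sumn_cat !size_cat/=; lia.
Qed.

Lemma loop_weight_cons0 l : (loop_weight l < loop_weight (0 :: l))%N.
Proof. rewrite /loop_weight /=; lia. Qed.

Lemma loop_weight_ind (P : seq nat -> Prop) : P [::] ->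
  (forall l, P l -> P (0%N :: l)) ->
  (forall k l, (forall l', (loop_weight l' < loop_weight (k.+1 :: l))%N -> P l') ->
    P (k.+1 :: l)) ->
  forall l, P l.
Proof.
move=> P0 P1 P2 l; have [N lN] := ubnP (loop_weight l).
elim: N l lN => [//|N IH] [|[|k] l] lN //.
  by apply: P1; apply: IH; rewrite (leq_trans (loop_weight_cons0 l)).
by apply: P2 => l' l'l; apply: IH; rewrite (leq_trans l'l).
Qed.

(** The remaining terms of a loop equation have bounded coefficients. *)
Lemma loop_uniformly_bounded l : uniformly_O 0 (fun _ e => e l).
Proof.
elim/loop_weight_ind: l => [|l IH|k l IH].
- by apply: eq_uniformly_O (uniformly_O_cst 1) => n e _ [].
- apply: (@eq_uniformly_O _ _ (fun n e => e l + -1 * (n%:R ^- 1 * e l))).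
    by move=> n e _ [_ -> _]; rewrite expr1; ring.
  apply: uniformly_OD => //; apply: uniformly_OZ.
  exact: uniformly_O_le (uniformly_OM (uniformly_OVn 1) IH).
- apply: eq_uniformly_O; first by move=> n e _ [_ _ ->]; reflexivity.
  apply: uniformly_OD; first apply: uniformly_OD.
  + by apply: uniformly_O_sum => a; apply: IH; apply: loop_weight_split; exact: ltn_ord.
  + apply: (@eq_uniformly_O _ _
      (fun n e => k%:R * (n%:R ^- 1 * e (k.-1 :: l)))) => [n e _ _|].
      by rewrite expr1 mulrA.
    apply: uniformly_OZ; apply: (@uniformly_O_le (1 + 0)) => //.
    apply: uniformly_OM (uniformly_OVn 1) _.
    by apply: IH; exact: loop_weight_pred.
  + apply: (@uniformly_O_le (2 + 0)) => //.
    apply: uniformly_OM (uniformly_OVn 2) _.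
    apply: uniformly_O_sum => j; apply: uniformly_OZ; apply: IH.
    apply: loop_weight_merge; exact: ltn_ord.
Qed.

(** At the leading order the merging terms disappear and the recursion
    factorizes into the one of Segner, that [c] satisfies. *)
Lemma loop_leading_order (c : nat -> R) : c 0%N = 1 ->
    (forall k, c k.+1 = \sum_(a < k) c a * c (k.-1 - a)%N) ->
  forall l, uniformly_O 1 (fun _ e => e l - \prod_(k <- l) c k).
Proof.
move=> c0 cS; elim/loop_weight_ind => [|l IH|k l IH].
- apply: eq_uniformly_O (uniformly_O0 1) => n e _ [-> _ _].
  by rewrite big_nil subrr.
- apply: (@eq_uniformly_O _ _ (fun n e =>
    e l - \prod_(k <- l) c k + -1 * (n%:R ^- 1 * e l))).
    by move=> n e _ [_ -> _]; rewrite big_cons c0 expr1; ring.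
  apply: uniformly_OD => //; apply: uniformly_OZ.
  exact: (uniformly_OM (uniformly_OVn 1) (loop_uniformly_bounded l)).
- apply: (@eq_uniformly_O _ _ (fun n e =>
    \sum_(a < k) (e (val a :: (k.-1 - a)%N :: l) -
      \prod_(i <- val a :: (k.-1 - a)%N :: l) c i) +
    k%:R * (n%:R ^- 1 * e (k.-1 :: l)) +
    n%:R ^- 2 * \sum_(j < size l) (2 * nth 0%N l j)%:R *
          e ((k + nth 0%N l j).-1 :: take j l ++ drop j.+1 l))).
    move=> n e _ [_ _ ->]; rewrite sumrB big_cons cS mulr_suml expr1.
    under [X in _ = _ - X + _ + _]eq_bigr do rewrite !big_cons mulrA.
    by ring.
  apply: uniformly_OD; first apply: uniformly_OD.
  + by apply: uniformly_O_sum => a; apply: IH; apply: loop_weight_split; exact: ltn_ord.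
  + apply: uniformly_OZ.
    exact: (uniformly_OM (uniformly_OVn 1) (loop_uniformly_bounded _)).
  + apply: (@uniformly_O_le 2) => //.
    apply: (@uniformly_OM 2 0); first exact: uniformly_OVn.
    apply: uniformly_O_sum => j; apply: uniformly_OZ.
    exact: loop_uniformly_bounded.
Qed.

(** The loop equations for [l ++ l'] and for [l], the latter multiplied by
    [e l'], differ by the merging terms between [l] and [l'] only, and these
    carry a factor [n^-2]. *)
Lemma loop_factorization l l' :
  uniformly_O 2 (fun _ e => e (l ++ l') - e l * e l').
Proof.
elim/loop_weight_ind: l => [|l IH|k l IH].
- by apply: eq_uniformly_O (uniformly_O0 2) => n e _ [-> _ _]; rewrite mul1r subrr.
- apply: (@eq_uniformly_O _ _ (fun n e => (e (l ++ l') - e l * e l') +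
    -1 * (n%:R ^- 1 * (e (l ++ l') - e l * e l')))).
    by move=> n e _ [_ E _]; rewrite cat_cons !E expr1; ring.
  apply: uniformly_OD => //; apply: uniformly_OZ.
  exact: uniformly_O_le (uniformly_OM (uniformly_OVn 1) IH).
- apply: (@eq_uniformly_O _ _ (fun n e =>
    \sum_(a < k) (e ((val a :: (k.-1 - a)%N :: l) ++ l') -
      e (val a :: (k.-1 - a)%N :: l) * e l') +
    k%:R * (n%:R ^- 1 * (e ((k.-1 :: l) ++ l') - e (k.-1 :: l) * e l')) +
    (n%:R ^- 2 * \sum_(j < size l) (2 * nth 0%N l j)%:R *
       (e (((k + nth 0%N l j).-1 :: take j l ++ drop j.+1 l) ++ l') -
        e ((k + nth 0%N l j).-1 :: take j l ++ drop j.+1 l) * e l') +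
     n%:R ^- 2 * \sum_(j < size l') (2 * nth 0%N l' j)%:R *
       e ((k + nth 0%N l' j).-1 :: l ++ take j l' ++ drop j.+1 l')))).
    move=> n e _ [_ _ E]; rewrite cat_cons !E size_cat big_split_ord/=.
    under [X in _ + _ + _ * (X + _) - _ = _]eq_bigr => j _ do
      rewrite nth_cat take_cat drop_cat ltn_ord.
    have dropE (j : 'I_(size l)) : (if (j.+1 < size l)%N
        then drop j.+1 l ++ l' else drop (j.+1 - size l) l') = drop j.+1 l ++ l'.
      case: ltnP => // lj; have -> : j.+1 = size l by have := ltn_ord j; lia.
      by rewrite subnn drop0 drop_size.
    under [X in _ + _ + _ * (X + _) - _ = _]eq_bigr => j _ do rewrite dropE.
    under [X in _ + _ + _ * (_ + X) - _ = _]eq_bigr => j _ do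
      rewrite nth_cat take_cat drop_cat ltnNge leq_addr/= -addnS ltnNge leq_addr/=
        !addKn -catA.
    rewrite sumrB -!mulr_suml.
    under [X in _ = _ + (_ * X + _)]eq_bigr => j _ do
      rewrite mulrBr mulrA -catA.
    by rewrite sumrB -mulr_suml expr1; ring.
  apply: uniformly_OD; first apply: uniformly_OD.
  + by apply: uniformly_O_sum => a; apply: IH; apply: loop_weight_split; exact: ltn_ord.
  + apply: uniformly_OZ; apply: (@uniformly_O_le 3) => //.
    apply: (@uniformly_OM 1 2); first exact: uniformly_OVn.
    by apply: IH; exact: loop_weight_pred.
  + apply: uniformly_OD.
      apply: (@uniformly_O_le 4) => //.
      apply: (@uniformly_OM 2 2); first exact: uniformly_OVn.
      apply: uniformly_O_sum => j; apply: uniformly_OZ; apply: IH.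
      apply: loop_weight_merge; exact: ltn_ord.
    apply: (@uniformly_OM 2 0); first exact: uniformly_OVn.
    apply: uniformly_O_sum => j; apply: uniformly_OZ.
    exact: loop_uniformly_bounded.
Qed.

End loop_equations.

(** * Integration against a density *)

Section density.
Import HBNNSimple.
Context d d' (T : measurableType d) (T' : measurableType d') (R : realType).
Variables (mu : {measure set T -> \bar R}) (nu : {measure set T' -> \bar R}).
Variables (phi : T -> T') (h : T -> R).
Hypotheses (mphi : measurable_fun setT phi) (mh : measurable_fun setT h).
Hypothesis h0 : forall x, 0 <= h x.
Hypothesis nuE : forall B, measurable B ->
  nu B = (\int[mu]_(x in phi @^-1` B) (h x)%:E)%E.
Local Open Scope ereal_scope.

Let mpre B : measurable B -> measurable (phi @^-1` B).
Proof. by move=> mB; rewrite -(setTI (_ @^-1` _)); exact: mphi. Qed.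

(** Pushing a density forward: the density [h] of [nu] is seen upstairs, on
    the space that [phi] maps to the space of [nu]. Both the laws given by a
    density on the line and the independence of one variable from a product of
    others take this form. *)
Lemma ge0_integral_density (g : T' -> R) : measurable_fun setT g ->
  (forall y, 0 <= g y)%R ->
  \int[nu]_y (g y)%:E = \int[mu]_x (g (phi x) * h x)%:E.
Proof.
move=> mg g0.
have mg' : measurable_fun setT (EFin \o g) by exact/measurable_EFinP.
pose f_ := nnsfun_approx measurableT mg'.
have f_cvg (y : T') : (f_ n y)%:E @[n --> \oo] --> (g y)%:E.
  by apply: (cvg_nnsfun_approx measurableT mg') => // z _; rewrite lee_fin.
transitivity (limn (fun n => \int[nu]_y (f_ n y)%:E)).
  rewrite -monotone_convergence//.
  - by apply: eq_integral => y _; apply/esym/cvg_lim.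
  - by move=> n; exact/measurable_EFinP/measurable_funP.
  - by move=> n y _; rewrite lee_fin.
  - by move=> y _ m n mn; rewrite lee_fin; exact/lefP/nd_nnsfun_approx.
rewrite [X in limn X](_ : _ =
    (fun n => \int[mu]_x (f_ n (phi x) * h x)%:E)).
  rewrite -monotone_convergence//.
  - apply: eq_integral => x _ /=; apply/cvg_lim => //.
    under eq_fun do rewrite EFinM.
    by rewrite EFinM; apply: cvgeZr.
  - move=> n; apply/measurable_EFinP; apply: measurable_funM => //.
    by apply: measurableT_comp => //; exact: measurable_funP.
  - by move=> n x _; rewrite lee_fin mulr_ge0.
  - move=> x _ m n mn; rewrite lee_fin ler_wpM2r//.
    exact/lefP/nd_nnsfun_approx.
apply/funext => n.
have mf r : measurable (f_ n @^-1` [set r]) by exact: measurable_sfunP.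
transitivity (\sum_(k \in range (f_ n))
    \int[mu]_x (k * (\1_(phi @^-1` (f_ n @^-1` [set k])) x * h x))%:E).
  under eq_integral do rewrite fimfunE -fsumEFin//.
  rewrite ge0_integral_fsum//; last 2 first.
  - by move=> y; exact/measurable_EFinP/measurable_funM.
  - by move=> y x _; rewrite nnfun_muleindic_ge0.
  apply: eq_fsbigr => r /[!inE] -[z _ <-].
  rewrite integralZl_indic_nnsfun// integral_indic//= setIT nuE//.
  under [RHS]eq_integral do rewrite EFinM.
  rewrite ge0_integralZl_EFin//; last 2 first.
  - by move=> x _; rewrite lee_fin mulr_ge0.
  - apply/measurable_EFinP; apply: measurable_funM => //.
    by apply: measurable_indic; exact: mpre.
  congr (_ * _); rewrite integral_mkcond; apply: eq_integral => x _.
  by rewrite patchE indicE; case: ifP => _; rewrite ?mul1r ?mul0r.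
rewrite -ge0_integral_fsum//; last 2 first.
- move=> r; apply/measurable_EFinP; apply: measurable_funM => //.
  by apply: measurable_funM => //; apply: measurable_indic; exact: mpre.
- move=> r x _; rewrite lee_fin.
  rewrite mulrA mulr_ge0// indicE; case: (boolP (x \in _)) => [|_]; last by rewrite mulr0.
  by rewrite inE /= mulr1 => <-.
apply: eq_integral => x _; rewrite fsumEFin// [in RHS]fimfunE mulr_fsuml.
by congr EFin; apply: eq_fsbigr => r _; rewrite mulrA.
Qed.

End density.


Section density_integrable.
Context d d' (T : measurableType d) (T' : measurableType d') (R : realType).
Variables (mu : {measure set T -> \bar R}) (nu : {measure set T' -> \bar R}).
Variables (phi : T -> T') (h : T -> R).
Hypotheses (mphi : measurable_fun setT phi) (mh : measurable_fun setT h).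
Hypothesis h0 : forall x, 0 <= h x.
Hypothesis nuE : forall B, measurable B ->
  nu B = (\int[mu]_(x in phi @^-1` B) (h x)%:E)%E.

Lemma integrable_density (g : T' -> R) : measurable_fun setT g ->
  mu.-integrable setT (fun x => (g (phi x) * h x)%:E) <->
  nu.-integrable setT (EFin \o g).
Proof.
move=> mg.
have mgh : measurable_fun setT (fun x => (g (phi x) * h x)%:E).
  apply/measurable_EFinP; apply: measurable_funM => //.
  exact: measurableT_comp.
have E : (\int[mu]_x `|(g (phi x) * h x)%:E| = \int[nu]_y `|(g y)%:E|)%E.
  rewrite (ge0_integral_density mphi mh h0 nuE (g := fun y => `|g y|))//; last first.
    exact: measurableT_comp.
  by apply: eq_integral => x _ /=; rewrite normrM (ger0_norm (h0 x)).
split=> /integrableP[_ fin]; apply/integrableP; split => //.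
- exact/measurable_EFinP.
- by move: fin; rewrite E.
- by rewrite E.
Qed.

Lemma Rintegral_density (g : T' -> R) : measurable_fun setT g ->
  nu.-integrable setT (EFin \o g) ->
  \int[nu]_y g y = \int[mu]_x (g (phi x) * h x).
Proof.
move=> mg ig.
have mp : measurable_fun setT (fun y => Num.max (g y) 0) by exact: measurable_maxr.
have mn : measurable_fun setT (fun y => Num.max (- g y) 0).
  by apply: measurable_maxr => //; exact: measurable_funN.
have ip : nu.-integrable setT (EFin \o (fun y => Num.max (g y) 0)).
  apply: le_integrable ig => //; first exact/measurable_EFinP.
  move=> y _ /=; rewrite lee_fin ger0_norm ?le_max ?lexx ?orbT//.
  by rewrite ge_max normr_ge0 ler_norm.
have im : nu.-integrable setT (EFin \o (fun y => Num.max (- g y) 0)).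
  apply: le_integrable ig => //; first exact/measurable_EFinP.
  move=> y _ /=; rewrite lee_fin ger0_norm ?le_max ?lexx ?orbT//.
  by rewrite ge_max normr_ge0 -normrN ler_norm.
have ge y : g y = Num.max (g y) 0 - Num.max (- g y) 0.
  by case: (leP 0 (g y)) => H; case: (leP 0 (- g y)) => H'; lra.
under eq_Rintegral do rewrite ge.
rewrite RintegralB//.
under [RHS]eq_Rintegral do rewrite ge mulrBl.
rewrite RintegralB//; first last.
- by apply/(integrable_density mn).
- by apply/(integrable_density mp).
by rewrite /Rintegral !(ge0_integral_density mphi mh h0 nuE)// => y;
   rewrite le_max lexx orbT.
Qed.

End density_integrable.

(** * Moments of the centred normal law *)

Section integral_of_derivative.
Variable R : realType.
Notation mu := (@lebesgue_measure R).

(** The fundamental theorem of calculus on the segments [[- n.+1, n.+1]], and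
    dominated convergence. *)
Lemma integral_derivative_eq0 (F f : R -> R) :
  (forall x : R, is_derive x (1 : R) F (f x)) -> continuous f ->
  mu.-integrable setT (EFin \o f) ->
  F n.+1%:R @[n --> \oo] --> 0 -> F (- n.+1%:R) @[n --> \oo] --> 0 ->
  \int[mu]_x f x = 0.
Proof.
move=> dF cf intf Fy FNy.
have mf : measurable_fun setT f by exact: continuous_measurable_fun.
pose I n := `[- n.+1%:R, n.+1%:R]%classic : set R.
have IE n : (\int[mu]_(x in I n) (f x)%:E = (F n.+1%:R - F (- n.+1%:R))%:E)%E.
  rewrite /I (@continuous_FTC2 _ f F)//.
  - by rewrite (lt_le_trans (y := 0))// oppr_lt0 ltr0n.
  - exact: continuous_subspaceT.
  - split => [x _||]; first by have [] := dF x.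
    + apply: cvg_at_right_filter; apply: differentiable_continuous.
      by apply/derivable1_diffP; have [] := dF (- n.+1%:R).
    + apply: cvg_at_left_filter; apply: differentiable_continuous.
      by apply/derivable1_diffP; have [] := dF n.+1%:R.
  - by move=> x _; rewrite derive1E; have [_ ->] := dF x.
have [] := @dominated_convergence _ _ _ mu setT measurableT
    (fun n => EFin \o (f \_ (I n))) (EFin \o f) (abse \o (EFin \o f)).
  - move=> n; apply/measurable_EFinP.
    have mI : measurable (I n) by exact: measurable_itv.
    exact: ((measurable_restrictT f mI).1 (measurable_funTS mf)).
  - exact/measurable_EFinP.
  - apply: aeW => x _; apply: cvg_near_cst.
    exists (Num.truncn `|x|).+1 => // n /= xn; congr EFin; rewrite patchE mem_set//.
    rewrite /I/= in_itv/= -ler_norml ltW// (lt_le_trans (truncnS_gt _))//.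
    by rewrite ler_nat ltnW.
  - exact: integrable_abse.
  - apply: aeW => x n _; rewrite /= patchE; case: ifP => // _.
    by rewrite lee_fin [point](_ : _ = 0)// normr0.
move=> _ _.
have -> : [sequence \int[mu]_x (EFin \o (f \_ (I n))) x]_n%E =
          EFin \o (fun n => F n.+1%:R - F (- n.+1%:R)).
  apply/funext => n /=; rewrite -IE [RHS]integral_mkcond.
  by apply: eq_integral => x _; rewrite !patchE; case: ifP.
move=> H; have : EFin \o (fun n => F n.+1%:R - F (- n.+1%:R)) @ \oo --> 0%:E.
  apply: cvg_EFin; first exact: nearW.
  by rewrite -[X in _ --> X](subrr 0); exact: cvgB.
by move=> /(cvg_unique _ H); rewrite /Rintegral => -> //.
Qed.

End integral_of_derivative.


Section normal_moments.
Variables (R : realType) (s : R).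
Hypothesis s0 : s != 0.
Notation mu := (@lebesgue_measure R).

(** Half of the exponent absorbs any power of [x], and what remains is the
    density of a wider normal law. *)
Lemma normal_pdf_power_bound k : exists2 C : R, 0 <= C &
  forall x, `|x| ^+ k * normal_pdf 0 s x <= C * normal_pdf 0 (2 * s) x.
Proof.
have s20 : 2 * s != 0 by rewrite mulf_neq0.
have p2 : 0 < normal_peak (2 * s) by exact: normal_peak_gt0.
have s2 : 0 < s ^+ 2 by rewrite exprn_even_gt0.
exists (k`!%:R * expR (2 / 3 * s ^+ 2) * normal_peak s / normal_peak (2 * s)).
  by rewrite !mulr_ge0 ?expR_ge0 ?invr_ge0 ?normal_peak_ge0.
move=> x; rewrite !normal_pdfE//= [leRHS]mulrA mulfVK ?gt_eqF//.
rewrite /normal_fun !subr0 mulrCA [leRHS]mulrAC [leRHS]mulrC.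
rewrite ler_wpM2l ?normal_peak_ge0//.
have xk : `|x| ^+ k <= k`!%:R * expR `|x|.
  case: k => [|k]; first by rewrite expr0 fact0 mul1r -[leLHS]expR0 ler_expR.
  rewrite mulrC -ler_pdivrMr ?ltr0n ?fact_gt0//.
  by apply: le_trans (expR_ge1Dxn k _) => //; rewrite lerDr.
apply: (le_trans (ler_wpM2r (expR_ge0 _) xk)).
rewrite -!mulrA ler_wpM2l// -!expRD ler_expR -subr_ge0.
rewrite [leRHS](_ : _ = (3 / 8 / s ^+ 2) * (`|x| - 4 / 3 * s ^+ 2) ^+ 2).
  by rewrite mulr_ge0 ?sqr_ge0// divr_ge0 ?ltW// divr_ge0.
by rewrite -[in LHS](real_normK (num_real x)); field.
Qed.

Lemma measurable_power_normal_pdf k :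
  measurable_fun setT (fun x : R => x ^+ k * normal_pdf 0 s x).
Proof.
by apply: measurable_funM; [exact: measurable_funX | exact: measurable_normal_pdf].
Qed.

Lemma integrable_power_normal_pdf k :
  mu.-integrable setT (fun x : R => (x ^+ k * normal_pdf 0 s x)%:E).
Proof.
have [C C0 HC] := normal_pdf_power_bound k.
have iC : mu.-integrable setT (fun x => C%:E * (normal_pdf 0 (2 * s) x)%:E)%E.
  apply: integrableZl => //.
  exact: integrable_normal_pdf.
apply: le_integrable iC => //.
  by apply/measurable_EFinP; exact: measurable_power_normal_pdf.
move=> x _; rewrite -EFinM/= lee_fin normrM normrX.
rewrite (ger0_norm (normal_pdf_ge0 _ _ _)) [leRHS]ger0_norm ?HC//.
by rewrite mulr_ge0 ?normal_pdf_ge0.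
Qed.

Lemma is_derive_normal_pdf (x : R) :
  is_derive x (1 : R) (normal_pdf 0 s) (- x / s ^+ 2 * normal_pdf 0 s x).
Proof.
rewrite normal_pdfE// /normal_fun.
under [X in is_derive _ _ X _]eq_fun do rewrite subr0.
apply: is_derive_eq.
by rewrite subr0 /GRing.scale/= ?scaler0; field.
Qed.

Let cvg_power_normal_pdf k (u : nat -> R) :
  (forall n, `|u n| = n.+1%:R) ->
  u n ^+ k * normal_pdf 0 s (u n) @[n --> \oo] --> 0.
Proof.
move=> uE; have [C C0 HC] := normal_pdf_power_bound k.+1.
pose M := C * normal_peak (2 * s).
have M0 : 0 <= M by rewrite mulr_ge0 ?normal_peak_ge0.
apply/cvgr0Pnorm_le => e e0.
have : M * harmonic n @[n --> \oo] --> M * 0 by apply: cvgMr; exact: cvg_harmonic.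
rewrite mulr0 => /cvgr0Pnorm_le/(_ e e0); apply: filterS => n.
apply: le_trans; rewrite /harmonic/= [leRHS]ger0_norm ?mulr_ge0 ?invr_ge0//.
rewrite ler_pdivlMr ?ltr0n//.
rewrite normrM normrX uE (ger0_norm (normal_pdf_ge0 _ _ _)) mulrC mulrA -exprS -uE.
apply: (le_trans (HC _)); rewrite ler_wpM2l// normal_pdf_ub//.
by rewrite mulf_neq0.
Qed.

(** Gaussian integration by parts, for one variable and a power of it. *)
Lemma normal_moment_rec k : \int[mu]_x (x ^+ k.+1 * normal_pdf 0 s x) =
  s ^+ 2 * k%:R * \int[mu]_x (x ^+ k.-1 * normal_pdf 0 s x).
Proof.
pose f (x : R) := k%:R * (x ^+ k.-1 * normal_pdf 0 s x) -
  (s ^+ 2)^-1 * (x ^+ k.+1 * normal_pdf 0 s x).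
have i1 := integrable_power_normal_pdf k.-1.
have i2 := integrable_power_normal_pdf k.+1.
have i1' : mu.-integrable setT
    (EFin \o (fun x => k%:R * (x ^+ k.-1 * normal_pdf 0 s x))).
  exact: (integrableZl measurableT k%:R i1).
have i2' : mu.-integrable setT
    (EFin \o (fun x => (s ^+ 2)^-1 * (x ^+ k.+1 * normal_pdf 0 s x))).
  exact: (integrableZl measurableT (s ^+ 2)^-1 i2).
have : \int[mu]_x f x = 0.
  apply: (@integral_derivative_eq0 _ (fun x => x ^+ k * normal_pdf 0 s x)).
  - move=> x; have dX := is_deriveX k (is_derive_id x (1 : R)).
    rewrite (_ : (fun y => _) = id ^+ k * normal_pdf 0 s); last first.
      by apply/funext => y; rewrite !fctE.
    apply: (is_derive_eq (is_deriveM dX (is_derive_normal_pdf x))).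
    by rewrite /f /GRing.scale/= mulr1 !fctE (exprS x); field; exact: s0.
  - have cp j : continuous (fun x : R => x ^+ j * normal_pdf 0 s x).
      move=> y; apply: cvgM; first exact: exprn_continuous.
      exact: continuous_normal_pdf.
    by move=> y; apply: cvgB; apply: cvgM; (exact: cvg_cst || exact: cp).
  - by rewrite (_ : EFin \o f = fun x => (k%:R * (x ^+ k.-1 * normal_pdf 0 s x))%:E -
      ((s ^+ 2)^-1 * (x ^+ k.+1 * normal_pdf 0 s x))%:E)%E//; exact: integrableB.
  - by apply: cvg_power_normal_pdf => n; rewrite ger0_norm.
  - by apply: cvg_power_normal_pdf => n; rewrite normrN ger0_norm.
rewrite RintegralB// !RintegralZl// => /eqP; rewrite subr_eq0 => /eqP E.
by rewrite -mulrA E mulVKf// expf_neq0.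
Qed.

End normal_moments.

(** * Expectation of a product of independent variables *)

Section independent_product.
Context d (T : measurableType d) (R : realType) (P : probability T R).
Variables (I : finType) (D : {pred I}) (X : I -> {RV P >-> R}).
Hypothesis indep : mutually_independent D X.
Variables (J : {set I}).
Hypothesis JD : J \subset D.

Let mX i : measurable_fun setT (X i). Proof. exact: measurable_funP. Qed.

Let factorizes (f : I -> R -> R) :=
  P.-integrable setT (EFin \o (fun x => \prod_(i in J) f i (X i x))) /\
  \int[P]_x (\prod_(i in J) f i (X i x)) =
  \prod_(i in J) \int[P]_x f i (X i x).

Let mprod (A : {pred I}) (f : I -> R -> R) :
  (forall i, measurable_fun setT (f i)) ->
  measurable_fun setT (fun x => \prod_(i in A) f i (X i x)).
Proof.
move=> mf; under eq_fun do rewrite -big_filter.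
by apply: measurable_prod => i _; exact: measurableT_comp.
Qed.

Let factorizes_indic (B : I -> set R) : (forall i, measurable (B i)) ->
  factorizes (fun i => \1_(B i)).
Proof.
move=> mB; have mXB i : measurable (X i @^-1` B i).
  by rewrite -(setTI (_ @^-1` _)); exact: mX.
have mcap : measurable (\bigcap_(i in [set` J]) X i @^-1` B i).
  by apply: fin_bigcap_measurable => // i _.
have prodE x : \prod_(i in J) \1_(B i) (X i x) =
    \1_(\bigcap_(i in [set` J]) X i @^-1` B i) x :> R.
  rewrite [RHS]indicE; case: (boolP (x \in _)).
    rewrite inE => xB; rewrite big1// => i iJ; rewrite indicE mem_set//.
    exact: (xB i).
  rewrite notin_setE /bigcap/= => /existsNP[i /not_implyP[iJ xB]].
  by rewrite (bigD1 i)//= indicE memNset// mul0r.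
have intE i : \int[P]_x \1_(B i) (X i x) = fine (P (X i @^-1` B i)).
  by rewrite /Rintegral -[in RHS](setIT (X i @^-1` B i)) -integral_indic.
rewrite /factorizes/=; split.
  by under eq_fun do rewrite prodE; exact: integrable_indic.
under eq_bigr do rewrite intE.
under eq_Rintegral do rewrite prodE.
rewrite /Rintegral integral_indic// setIT.
rewrite -[RHS]/(fine (\prod_(i in J) fine (P (X i @^-1` B i)))%:E) -prodEFin.
congr fine; apply: etrans (indep JD mB) _.
by apply: eq_bigr => i _; rewrite fineK// fin_num_measure.
Qed.

(** One indicator after the other is replaced by an arbitrary nonnegative
    function: both sides are integrals of that function, against measures
    which the preceding step identifies. *)
Let factorizes_ge0 (s : seq I) (f : I -> R -> R) :
  (forall i, measurable_fun setT (f i)) -> (forall i x, 0 <= f i x) ->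
  (forall i, P.-integrable setT (EFin \o (f i \o X i))) ->
  (forall i, i \notin s -> exists2 B, measurable B & f i = \1_B) ->
  factorizes f.
Proof.
elim: s f => [|k s IH] f mf f0 intf fB.
  have /choice[B BP] i : exists B : set R, measurable B /\ f i = \1_B.
    by have [B mB fBE] := fB i isT; exists B.
  have -> : f = (fun i => \1_(B i)) by apply/funext => i; have [] := BP i.
  by apply: factorizes_indic => i; have [] := BP i.
case: (boolP (k \in J)) => kJ; last first.
  have [] := IH (fun i => if i == k then \1_setT else f i).
  - by move=> i; case: ifP => // _; exact: measurable_indic.
  - by move=> i x; case: ifP => // _; rewrite indicE.
  - move=> i; case: ifP => // _.
    rewrite (_ : EFin \o _ = cst 1%E).
      exact: finite_measure_integrable_cst.
    by apply/funext => x /=; rewrite indicE in_setT.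
  - move=> i si; case: (eqVneq i k) => [_|ik]; first by exists setT.
    by apply: fB; rewrite inE negb_or ik.
  have E i : i \in J -> (i == k) = false.
    by move=> iJ; apply: contraNF kJ => /eqP <-.
  move=> H1 H2; split.
    rewrite (_ : (fun x => _) =
      (fun x => \prod_(i in J) (if i == k then \1_setT else f i) (X i x)))//.
    by apply/funext => x; apply: eq_bigr => i iJ; rewrite E.
  transitivity (\prod_(i in J) \int[P]_x (if i == k then \1_setT else f i) (X i x)).
    by rewrite -H2; apply: eq_Rintegral => x _; apply: eq_bigr => i iJ; rewrite E.
  by apply: eq_bigr => i iJ; rewrite E.
(* With an indicator at [k], the induction hypothesis says that integrating
   against [c] times the law of [X k] is integrating against the density [h],
   the product of the other factors. *)
pose g B i := if i == k then \1_B else f i : R -> R.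
have gP B : measurable B -> factorizes (g B).
  move=> mB; apply: IH => i; rewrite /g; case: (eqVneq i k) => [ik|ik] //.
  - rewrite (_ : EFin \o _ = EFin \o \1_(X i @^-1` B))//.
    apply: integrable_indic.
    by rewrite -(setTI (_ @^-1` _)); exact: mX.
  - by move=> _; exists B.
  - by move=> si; apply: fB; rewrite inE negb_or ik.
pose h x := \prod_(i in J :\ k) f i (X i x).
have mh : measurable_fun setT h by exact: mprod.
have h0 x : 0 <= h x by apply: prodr_ge0 => i _.
have hE F x : \prod_(i in J) (if i == k then F else f i) (X i x) = F (X k x) * h x.
  rewrite (big_setD1 k)//= eqxx; congr (_ * _).
  by apply: eq_bigr => i; rewrite !inE => /andP[/negbTE ->].
pose c := \prod_(i in J :\ k) \int[P]_x f i (X i x).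
have c0 : 0 <= c by apply: prodr_ge0 => i _; apply: Rintegral_ge0 => x _.
pose nu := mscale (NngNum c0) (distribution P (X k)).
have nuE B : measurable B ->
    nu B = (\int[P]_(x in X k @^-1` B) (h x)%:E)%E.
  move=> mB; have mXB : measurable (X k @^-1` B).
    by rewrite -(setTI (_ @^-1` _)); exact: mX.
  have [igB EB] := gP B mB.
  rewrite integral_mkcond.
  rewrite (_ : (fun x => (h x)%:E) \_ (X k @^-1` B) =
      EFin \o (fun x => \prod_(i in J) g B i (X i x))); last first.
    apply/funext => x /=; rewrite hE patchE indicE.
    rewrite (_ : (X k x \in B) = (x \in X k @^-1` B)).
      by case: ifP => _; rewrite ?mul1r ?mul0r.
    by apply/idP/idP; rewrite !inE.
  rewrite -[RHS]fineK; last exact: integrable_fin_num igB.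
  rewrite -[fine _]/(\int[P]_x \prod_(i in J) g B i (X i x)) EB.
  rewrite (big_setD1 k)//= /g eqxx.
  rewrite [X in _ * X](_ : _ = c); last first.
    by apply: eq_bigr => i; rewrite !inE => /andP[/negbTE ->].
  rewrite /nu /mscale/= /distribution /pushforward mulrC EFinM; congr (_ * _)%E.
  rewrite /Rintegral -[in LHS](setIT (X k @^-1` B)) -integral_indic// fineK//.
  by rewrite integral_indic// fin_num_measure//; exact: measurableI.
have fE : f = (fun i => if i == k then f k else f i).
  by apply/funext => i; case: (eqVneq i k) => [->|].
have iF : nu.-integrable setT (EFin \o f k).
  apply/integrableP; split; first exact/measurable_EFinP.
  have mfa : measurable_fun setT (fun y : R => `|(EFin \o f k) y|%E).
    by apply: measurableT_comp => //; exact/measurable_EFinP.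
  rewrite ge0_integral_mscale// ge0_integral_distribution//.
  by have /integrableP[_ /= lt] := intf k; rewrite lte_mul_pinfty.
have intE : \int[nu]_y f k y = c * \int[P]_x f k (X k x).
  have mfe : measurable_fun setT (fun y : R => (f k y)%:E) by exact/measurable_EFinP.
  have f0e (y : R) : (0 <= (f k y)%:E)%E by rewrite lee_fin.
  rewrite /Rintegral ge0_integral_mscale// ge0_integral_distribution//.
  by rewrite fineM// ; exact: integrable_fin_num (intf k).
split.
  rewrite fE (_ : (fun x => _) = (fun x => f k (X k x) * h x)); last first.
    by apply/funext => x; exact: hE.
  by apply/(integrable_density (mX k) mh h0 nuE (mf k)).
rewrite (big_setD1 k)//= mulrC -[X in X * _]/c -intE.
rewrite (Rintegral_density (mX k) mh h0 nuE (mf k) iF).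
apply: eq_Rintegral => x _; rewrite -hE; apply: eq_bigr => i _.
by case: (eqVneq i k) => [->|].
Qed.

Lemma independent_product (f : I -> R -> R) :
  (forall i, measurable_fun setT (f i)) ->
  (forall i, P.-integrable setT (EFin \o (f i \o X i))) ->
  P.-integrable setT (EFin \o (fun x => \prod_(i in J) f i (X i x))) /\
  \int[P]_x (\prod_(i in J) f i (X i x)) =
  \prod_(i in J) \int[P]_x f i (X i x).
Proof.
suff H (s : seq I) : forall f : I -> R -> R,
    (forall i, measurable_fun setT (f i)) ->
    (forall i, P.-integrable setT (EFin \o (f i \o X i))) ->
    (forall i, i \notin s -> forall x, 0 <= f i x) -> factorizes f.
  by move=> mf intf; apply: (H (enum I)) => // i; rewrite mem_enum.
(* Both sides are linear in each factor, which is the difference of its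
   positive and negative parts. *)
elim: s => {f} [|k s IH] f mf intf f0.
  apply: (@factorizes_ge0 (enum I)) => //; first by move=> i x; exact: f0.
  by move=> i; rewrite mem_enum.
pose fp (x : R) : R := Num.max (f k x) 0; pose fm (x : R) : R := Num.max (- f k x) 0.
have fpm x : f k x = fp x - fm x.
  by rewrite /fp /fm; case: (leP 0 (f k x)) => H1; case: (leP 0 (- f k x)) => H2; lra.
have mfp : measurable_fun setT fp by exact: measurable_maxr.
have mfm : measurable_fun setT fm.
  by apply: measurable_maxr => //; exact: measurable_funN.
have ifp : P.-integrable setT (EFin \o (fp \o X k)).
  apply: le_integrable (intf k) => //.
    by apply/measurable_EFinP; exact: measurableT_comp.
  move=> y _ /=; rewrite lee_fin /fp ger0_norm ?le_max ?lexx ?orbT//.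
  by rewrite ge_max normr_ge0 ler_norm.
have ifm : P.-integrable setT (EFin \o (fm \o X k)).
  apply: le_integrable (intf k) => //.
    by apply/measurable_EFinP; exact: measurableT_comp.
  move=> y _ /=; rewrite lee_fin /fm ger0_norm ?le_max ?lexx ?orbT//.
  by rewrite ge_max normr_ge0 -normrN ler_norm.
pose g F i := if i == k then F else f i : R -> R.
have gP (F : R -> R) : measurable_fun setT F -> (forall x, 0 <= F x) ->
    P.-integrable setT (EFin \o (F \o X k)) -> factorizes (g F).
  move=> mF F0 iF; apply: IH => i; rewrite /g; case: (eqVneq i k) => [ik|ik] //.
    by rewrite ik.
  move=> si x.
  by apply: f0; rewrite inE negb_or ik.
have fp0 x : 0 <= fp x by rewrite /fp le_max lexx orbT.
have fm0 x : 0 <= fm x by rewrite /fm le_max lexx orbT.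
have [ip Ep] := gP _ mfp fp0 ifp.
have [im Em] := gP _ mfm fm0 ifm.
case: (boolP (k \in J)) => kJ; last first.
  have E F i : i \in J -> g F i = f i.
    by move=> iJ; rewrite /g; case: eqVneq => // ik; rewrite -ik iJ in kJ.
  split.
    rewrite (_ : (fun x => _) = (fun x => \prod_(i in J) g fp i (X i x)))//.
    by apply/funext => x; apply: eq_bigr => i iJ; rewrite E.
  transitivity (\prod_(i in J) \int[P]_x g fp i (X i x)).
    by rewrite -Ep; apply: eq_Rintegral => x _; apply: eq_bigr => i iJ; rewrite E.
  by apply: eq_bigr => i iJ; rewrite E.
pose h x := \prod_(i in J :\ k) f i (X i x).
have gE F x : \prod_(i in J) g F i (X i x) = F (X k x) * h x.
  rewrite (big_setD1 k)//= /g eqxx; congr (_ * _).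
  by apply: eq_bigr => i; rewrite !inE => /andP[/negbTE ->].
have prodE x : \prod_(i in J) f i (X i x) =
    \prod_(i in J) g fp i (X i x) - \prod_(i in J) g fm i (X i x).
  by rewrite !gE (big_setD1 k)//= fpm mulrBl.
split.
  pose G F x : R := \prod_(i in J) g F i (X i x).
  rewrite (_ : EFin \o _ = ((EFin \o G fp) \- (EFin \o G fm))%E).
    exact: integrableB.
  by apply/funext => x /=; rewrite prodE.
under eq_Rintegral do rewrite prodE.
pose c := \prod_(i in J :\ k) \int[P]_x f i (X i x).
have E (F : R -> R) : \prod_(i in J) \int[P]_x g F i (X i x) = (\int[P]_x F (X k x)) * c.
  rewrite (big_setD1 k)//= {1}/g eqxx; congr (_ * _).
  by apply: eq_bigr => i; rewrite !inE /g => /andP[/negbTE ->].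
transitivity ((\int[P]_x f k (X k x)) * c); last by rewrite [RHS](big_setD1 k).
transitivity (\int[P]_x (\prod_(i in J) g fp i (X i x)) -
              \int[P]_x (\prod_(i in J) g fm i (X i x))).
  exact: RintegralB.
rewrite Ep Em (E fp) (E fm) -mulrBl; congr (_ * _).
transitivity (\int[P]_x (fp (X k x) - fm (X k x))); first by rewrite RintegralB.
by apply: eq_Rintegral => x _; rewrite -fpm.
Qed.

End independent_product.

(** * Gaussian integration by parts for polynomials *)

Section polynomial_derivations.
Context d (T : measurableType d) (R : realType) (P : probability T R).
Variables (I : Type) (X : I -> T -> R).

Definition monomial (l : seq I) (x : T) : R := \prod_(i <- l) X i x.

(** The derivative of a monomial along the derivation that maps the variable
    [X i] to the constant [k i]. *)
Fixpoint monomial_deriv (k : I -> R) (l : seq I) (x : T) : R :=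
  if l is i :: l' then k i * monomial l' x + X i x * monomial_deriv k l' x else 0.

(** A relation rather than a function, because the same random variable may
    be written as several polynomials in the [X i]. *)
Inductive derivation (k : I -> R) : (T -> R) -> (T -> R) -> Prop :=
| derivation_cst c : derivation k (fun _ => c) (fun _ => 0)
| derivation_var i : derivation k (X i) (fun _ => k i)
| derivation_add F F' H H' : derivation k F F' -> derivation k H H' ->
    derivation k (fun x => F x + H x) (fun x => F' x + H' x)
| derivation_mul F F' H H' : derivation k F F' -> derivation k H H' ->
    derivation k (fun x => F x * H x) (fun x => F' x * H x + F x * H' x).

Lemma derivation_eq k F F' H H' : F =1 H -> F' =1 H' ->
  derivation k F F' -> derivation k H H'.
Proof. by move=> /funext -> /funext ->. Qed.

Lemma derivation_scale k c F F' : derivation k F F' ->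
  derivation k (fun x => c * F x) (fun x => c * F' x).
Proof.
move=> dF; apply: derivation_eq (derivation_mul (derivation_cst k c) dF) => x //.
by rewrite mul0r add0r.
Qed.

Lemma derivation_sum k (J : Type) (s : seq J) (Q : pred J) F F' :
  (forall j, Q j -> derivation k (F j) (F' j)) ->
  derivation k (fun x => \sum_(j <- s | Q j) F j x)
               (fun x => \sum_(j <- s | Q j) F' j x).
Proof.
move=> dF; elim: s => [|j s IH].
  by apply: derivation_eq (derivation_cst k 0) => x; rewrite big_nil.
case: (boolP (Q j)) => Qj.
  by apply: derivation_eq (derivation_add (dF _ Qj) IH) => x; rewrite big_cons Qj.
by apply: derivation_eq IH => x; rewrite big_cons (negbTE Qj).
Qed.

(** Integrability and integration by parts pass from the monomials to their
    linear combinations, and every polynomial is one of these. *)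
Inductive monomial_span (k : I -> R) : (T -> R) -> (T -> R) -> Prop :=
| monomial_span0 : monomial_span k (fun _ => 0) (fun _ => 0)
| monomial_span_cons c l H H' : monomial_span k H H' ->
    monomial_span k (fun x => c * monomial l x + H x)
                    (fun x => c * monomial_deriv k l x + H' x).

Lemma monomial_span_eq k F F' H H' : F =1 H -> F' =1 H' ->
  monomial_span k F F' -> monomial_span k H H'.
Proof. by move=> /funext -> /funext ->. Qed.

Lemma monomial_span_add k F F' H H' :
  monomial_span k F F' -> monomial_span k H H' ->
  monomial_span k (fun x => F x + H x) (fun x => F' x + H' x).
Proof.
move=> sF sH; elim: sF => [|c l F1 F1' _ IH].
  by apply: monomial_span_eq sH => x; rewrite add0r.
by apply: monomial_span_eq (monomial_span_cons c l IH) => x; rewrite addrA.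
Qed.

Lemma monomial_span_scale k a F F' : monomial_span k F F' ->
  monomial_span k (fun x => a * F x) (fun x => a * F' x).
Proof.
elim=> [|c l F1 F1' _ IH].
  by apply: monomial_span_eq (monomial_span0 k) => x; rewrite mulr0.
apply: monomial_span_eq (monomial_span_cons (a * c) l IH) => x;
  by rewrite mulrDr mulrA.
Qed.

Lemma monomial_span_mul_var k i F F' : monomial_span k F F' ->
  monomial_span k (fun x => X i x * F x) (fun x => k i * F x + X i x * F' x).
Proof.
elim=> [|c l F1 F1' _ IH].
  by apply: monomial_span_eq (monomial_span0 k) => x; rewrite !mulr0 ?addr0.
apply: monomial_span_eq (monomial_span_cons c (i :: l) IH) => x.
  by rewrite /monomial big_cons; ring.
by rewrite /=; ring.
Qed.

(** Multiplication by a polynomial preserves the span, by induction on the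
    polynomial and for all elements of the span at once; applied to the
    constant 1 it gives the expansion into monomials. *)
Lemma derivation_monomial_span k F F' : derivation k F F' -> monomial_span k F F'.
Proof.
move=> dF; suff H G G' : monomial_span k G G' ->
    monomial_span k (fun x => F x * G x) (fun x => F' x * G x + F x * G' x).
  have := H _ _ (monomial_span_cons 1 [::] (monomial_span0 k)).
  by apply: monomial_span_eq => x; rewrite /monomial /= big_nil; ring.
elim: dF G G' => {F F'} [c|i|F F' H H' _ IHF _ IHH|F F' H H' _ IHF _ IHH] G G' sG.
- apply: monomial_span_eq (monomial_span_scale c sG) => x //.
  by rewrite mul0r add0r.
- exact: monomial_span_mul_var.
- apply: monomial_span_eq (monomial_span_add (IHF _ _ sG) (IHH _ _ sG)) => x; ring.
- by apply: monomial_span_eq (IHF _ _ (IHH _ _ sG)) => x; ring.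
Qed.

Hypothesis int_monomial : forall l, P.-integrable setT (EFin \o monomial l).

Let int0 : P.-integrable setT (EFin \o (fun _ : T => 0 : R)).
Proof. exact: integrable0. Qed.

Let int_comb c (F H : T -> R) : P.-integrable setT (EFin \o F) ->
  P.-integrable setT (EFin \o H) ->
  P.-integrable setT (EFin \o (fun x => c * F x + H x)).
Proof.
by move=> iF; exact: (integrableD measurableT (integrableZl measurableT c iF)).
Qed.

Lemma integrable_monomial_deriv k l : P.-integrable setT (EFin \o monomial_deriv k l).
Proof.
(* The prefix [m] collects the variables that the recursion has passed. *)
suff H m : P.-integrable setT
    (EFin \o (fun x => monomial m x * monomial_deriv k l x)).
  rewrite (_ : EFin \o _ =
      EFin \o (fun x => monomial [::] x * monomial_deriv k l x)) //.
  by apply/funext => x /=; rewrite /monomial big_nil mul1r.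
elim: l m => [|i l IH] m /=.
  by under eq_fun do rewrite mulr0; exact: int0.
rewrite (_ : EFin \o _ = EFin \o (fun x => k i * monomial (m ++ l) x +
    monomial (i :: m) x * monomial_deriv k l x)); first exact: int_comb.
apply/funext => x /=; rewrite /monomial big_cat big_cons/=.
by congr EFin; ring.
Qed.

Lemma integrable_derivation k F F' : derivation k F F' ->
  P.-integrable setT (EFin \o F) /\ P.-integrable setT (EFin \o F').
Proof.
move=> /derivation_monomial_span; elim=> [|c l G G' _ [IH IH']].
  by split; exact: int0.
split; apply: int_comb => //; exact: integrable_monomial_deriv.
Qed.

Variables (k : I -> R) (L : T -> R).
Hypothesis int_LM : forall l, P.-integrable setT (EFin \o (fun x => L x * monomial l x)).
Hypothesis wick : forall l,
  \int[P]_x (L x * monomial l x) = \int[P]_x monomial_deriv k l x.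

Lemma integration_by_parts_derivation F F' : derivation k F F' ->
  P.-integrable setT (EFin \o (fun x => L x * F x)) /\
  \int[P]_x (L x * F x) = \int[P]_x F' x.
Proof.
move=> /derivation_monomial_span; elim=> [|c l G G' sG [IH IHE]].
  split; first by under eq_fun do rewrite mulr0; exact: int0.
  by apply: eq_Rintegral => x _; rewrite mulr0.
have iG' : P.-integrable setT (EFin \o G').
  elim: sG {IH IHE} => [|c1 l1 G1 G1' _ IH]; first exact: int0.
  by apply: int_comb => //; exact: integrable_monomial_deriv.
have i1 : P.-integrable setT (EFin \o (fun x => c * (L x * monomial l x))).
  exact: (integrableZl measurableT c (int_LM l)).
have i2 : P.-integrable setT (EFin \o (fun x => c * monomial_deriv k l x)).
  exact: (integrableZl measurableT c (integrable_monomial_deriv k l)).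
split.
  rewrite (_ : EFin \o _ = EFin \o (fun x => c * (L x * monomial l x) + L x * G x)).
    exact: int_comb.
  by apply/funext => x /=; rewrite mulrDr mulrCA.
rewrite RintegralD// RintegralZl//; last exact: integrable_monomial_deriv.
rewrite -wick -IHE -RintegralZl// -RintegralD//.
by apply: eq_Rintegral => x _; rewrite mulrDr mulrCA.
Qed.

End polynomial_derivations.

Section gaussian_wick.
Context d (T : measurableType d) (R : realType) (P : probability T R).
Variables (I : finType) (D : {pred I}) (X : I -> {RV P >-> R}) (s : I -> R).
Hypothesis indep : mutually_independent D X.
Hypothesis s0 : forall i, i \in D -> s i != 0.
Hypothesis gauss : forall i, i \in D -> forall B : set R, measurable B ->
  distribution P (X i) B = normal_prob 0 (s i) B.

Let mXn i k : measurable_fun setT (fun x => X i x ^+ k).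
Proof. by apply: measurable_funX; exact: measurable_funP. Qed.

Let mpow k : measurable_fun setT (fun y : R => y ^+ k).
Proof. exact: measurable_funX. Qed.

Let mid : measurable_fun setT (idfun : measurableTypeR R -> R).
Proof. by move=> _ B mB; rewrite setTI. Qed.

Let mpdf i : measurable_fun setT (normal_pdf 0 (s i) : measurableTypeR R -> R).
Proof. exact: measurable_normal_pdf. Qed.

Let law i B : i \in D -> measurable B -> distribution P (X i) B =
  (\int[lebesgue_measure]_(x in idfun @^-1` B) (normal_pdf 0 (s i) x)%:E)%E.
Proof. by move=> iD mB; rewrite gauss. Qed.

Let integrable_law_power i k : i \in D ->
  (distribution P (X i)).-integrable setT (EFin \o (fun y => y ^+ k)).
Proof.
move=> iD; have [] := integrable_density mid (mpdf i) (@normal_pdf_ge0 _ 0 (s i))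
  (fun B => law iD) (mpow k).
by move=> + _; apply; exact: integrable_power_normal_pdf (s0 iD) k.
Qed.

Lemma integrable_gaussian_power i k : i \in D ->
  P.-integrable setT (EFin \o (fun x => X i x ^+ k)).
Proof.
move=> iD; have /integrableP[_ lt] := integrable_law_power k iD.
apply/integrableP; split; first by apply/measurable_EFinP; exact: mXn.
move: lt; rewrite ge0_integral_distribution//.
by apply: measurableT_comp => //; apply/measurable_EFinP; exact: mpow.
Qed.

Lemma gaussian_moment i k : i \in D -> \int[P]_x (X i x ^+ k) =
  \int[lebesgue_measure]_y (y ^+ k * normal_pdf 0 (s i) y).
Proof.
move=> iD; have mk : measurable_fun setT (fun y : R => (y ^+ k)%:E).
  by apply/measurable_EFinP; exact: mpow.
rewrite -(Rintegral_density mid (mpdf i) (@normal_pdf_ge0 _ 0 (s i))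
  (fun B => law iD) (mpow k) (integrable_law_power k iD)).
rewrite /Rintegral; congr fine.
by rewrite (integral_distribution mk)//; exact: integrable_gaussian_power.
Qed.

Let J : {set I} := [set i | i \in D].

Let JD : J \subset D. Proof. by apply/fintype.subsetP => i; rewrite inE. Qed.

Let power_product (e : I -> nat) :
  P.-integrable setT (EFin \o (fun x => \prod_(i in J) X i x ^+ e i)) /\
  \int[P]_x (\prod_(i in J) X i x ^+ e i) =
  \prod_(i in J) \int[P]_x (X i x ^+ e i).
Proof.
pose f i : R -> R := if i \in J then (fun y => y ^+ e i) else cst 0.
have mf i : measurable_fun setT (f i).
  by rewrite /f; case: ifP => _ //; exact: mpow.
have intf i : P.-integrable setT (EFin \o (f i \o X i)).
  rewrite /f; case: ifP => [|_]; last first.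
    exact: integrable0.
  by rewrite inE => iD; exact: integrable_gaussian_power.
have [H1 H2] := independent_product indep JD mf intf.
have E x : \prod_(i in J) f i (X i x) = \prod_(i in J) X i x ^+ e i.
  by apply: eq_bigr => i iJ; rewrite /f iJ.
have E' : \prod_(i in J) \int[P]_x f i (X i x) =
          \prod_(i in J) \int[P]_x (X i x ^+ e i).
  by apply: eq_bigr => i iJ; rewrite /f iJ.
split; first by rewrite -(funext E).
by rewrite -E' -H2; apply: eq_Rintegral => x _; rewrite E.
Qed.

Let monomialE l x : all [in D] l ->
  monomial X l x = \prod_(i in J) X i x ^+ count_mem i l.
Proof.
elim: l => [_|j l IH /= /andP[jD lD]].
  by rewrite /monomial big_nil big1// => i _; rewrite expr0.
have jJ : j \in J by rewrite inE.
rewrite /monomial big_cons -/(monomial X l x) IH// !(bigD1 j jJ)/= eqxx.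
rewrite mulrA -exprS; congr (_ * _); apply: eq_bigr => i /andP[_ ij].
by rewrite eq_sym (negbTE ij).
Qed.

Let monomial_derivE i l x : i \in D -> all [in D] l ->
  monomial_deriv X (fun j => if j == i then s i ^+ 2 else 0) l x =
  s i ^+ 2 * (count_mem i l)%:R *
    (X i x ^+ (count_mem i l).-1 * \prod_(j in J | j != i) X j x ^+ count_mem j l).
Proof.
move=> iD; have iJ : i \in J by rewrite inE.
elim: l => [_|j l IH /= /andP[jD lD]]; first by rewrite /= mulr0 mul0r.
rewrite IH// monomialE// (bigD1 i iJ)/=.
case: (eqVneq j i) => [->|ji]; rewrite ?eqxx.
  have -> : \prod_(j0 in J | j0 != i) X j0 x ^+ ((i == j0) + count_mem j0 l)%N =
            \prod_(j0 in J | j0 != i) X j0 x ^+ count_mem j0 l.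
    by apply: eq_bigr => k /andP[_ ki]; rewrite eq_sym (negbTE ki).
  set Q := \prod_(_ in _ | _) _; rewrite add1n /=.
  case: (count_mem i l) => [|c]; first by rewrite !expr0; ring.
  by rewrite /= (exprS (X i x)) -[c.+2%:R]natr1; ring.
have jJ : j \in J by rewrite inE.
rewrite mul0r add0r add0n.
rewrite !(bigD1 j (_ : (j \in J) && (j != i)))/= ?jJ ?ji// eqxx add1n (exprS (X j x)).
have -> : \prod_(k | (k \in J) && (k != i) && (k != j))
    X k x ^+ ((j == k) + count_mem k l)%N =
  \prod_(k | (k \in J) && (k != i) && (k != j)) X k x ^+ count_mem k l.
  by apply: eq_bigr => k /andP[_ kj]; rewrite eq_sym (negbTE kj).
by ring.
Qed.

Lemma integrable_gaussian_monomial l : all [in D] l ->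
  P.-integrable setT (EFin \o monomial X l).
Proof.
move=> lD; have [+ _] := power_product (fun i => count_mem i l).
congr integrable; apply/funext => x /=; congr EFin.
by apply/esym; exact: monomialE.
Qed.

(** Independence reduces the expectation of a monomial to the moments of each
    variable, where integration by parts lowers one exponent. *)
Lemma gaussian_wick i l : i \in D -> all [in D] l ->
  \int[P]_x (X i x * monomial X l x) =
  \int[P]_x monomial_deriv X (fun j => if j == i then s i ^+ 2 else 0) l x.
Proof.
move=> iD lD; have iJ : i \in J by rewrite inE.
transitivity (\int[P]_x (monomial X (i :: l) x)).
  by apply: eq_Rintegral => x _; rewrite /monomial big_cons.
under eq_Rintegral do rewrite monomialE/= ?iD//.
have [_ ->] := power_product (fun j => count_mem j (i :: l)).
rewrite (bigD1 i iJ)/= eqxx add1n gaussian_moment// normal_moment_rec ?s0//.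
under [RHS]eq_Rintegral do rewrite monomial_derivE//.
pose e j := if j == i then (count_mem i l).-1 else count_mem j l.
have eE x : \prod_(j in J) X j x ^+ e j = X i x ^+ (count_mem i l).-1 *
    \prod_(j in J | j != i) X j x ^+ count_mem j l.
  rewrite (bigD1 i iJ)/= /e eqxx; congr (_ * _).
  by apply: eq_bigr => j /andP[_ /negbTE ->].
have [ie Ee] := power_product e.
under [RHS]eq_Rintegral do rewrite -eE.
rewrite RintegralZl// Ee (bigD1 i iJ)/= /e eqxx gaussian_moment// -!mulrA.
congr (_ * (_ * (_ * (_ * _)))); apply: eq_bigr => j /andP[_ ji].
by rewrite (negbTE ji) eq_sym (negbTE ji).
Qed.

End gaussian_wick.

(** * Compressed matrix powers *)

Section compressed_powers.
Variables (R : comNzRingType) (n : nat) (Pm B : 'M[R]_n.+1).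
Hypotheses (PmT : Pm^T = Pm) (PmPm : Pm * Pm = Pm).
Hypotheses (BT : B^T = B) (PmB : Pm * B = B).

(** The power of order 0 is the projection and not the identity, so that all
    the powers live on the range of the projection. *)
Definition compressed_power k : 'M[R]_n.+1 := Pm * B ^+ k.
Local Notation Q := compressed_power.

Lemma compressed_mulr : B * Pm = B.
Proof. by rewrite -{1}BT -PmT -[_ * _]trmx_mul -[X in trmx X]/(Pm * B) PmB BT. Qed.

Lemma comm_compressed k : GRing.comm Pm (B ^+ k).
Proof. by apply: commrX; rewrite /GRing.comm PmB compressed_mulr. Qed.

Lemma compressed_powerD a b : Q a * Q b = Q (a + b).
Proof.
rewrite /Q -mulrA (mulrA (B ^+ a)) -comm_compressed -(mulrA Pm (B ^+ a)).
by rewrite -exprD mulrA PmPm.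
Qed.

Lemma compressed_powerS k : Q k.+1 = Q k * B.
Proof. by rewrite /Q exprSr mulrA. Qed.

Lemma compressed_power0 : Q 0 = Pm. Proof. by rewrite /Q expr0 mulr1. Qed.

Lemma mul_compressed_power k : Pm * Q k = Q k.
Proof. by rewrite /Q mulrA PmPm. Qed.

Lemma compressed_power_mul k : Q k * Pm = Q k.
Proof. by rewrite {1}/Q -mulrA -comm_compressed mulrA PmPm. Qed.

Lemma trmx_compressed_power k : (Q k)^T = Q k.
Proof.
elim: k => [|k IH]; first by rewrite compressed_power0.
rewrite compressed_powerS; transitivity (B^T * (Q k)^T); first exact: trmx_mul.
by rewrite IH BT /Q mulrA compressed_mulr -[RHS]mulrA -exprSr exprS mulrA PmB.
Qed.

Lemma compressed_power_sym k i j : Q k i j = Q k j i.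
Proof. by rewrite -[in LHS]trmx_compressed_power mxE. Qed.

Lemma trace_mul_delta (A : 'M[R]_n.+1) i j : \tr (A * delta_mx i j) = A j i.
Proof.
rewrite /mxtrace (bigD1 j)//= mxE (bigD1 i)//= !mxE !eqxx mulr1 !big1 ?addr0//.
  by move=> k kj; rewrite mxE big1// => l _; rewrite mxE (negbTE kj) andbF mulr0.
by move=> k ki; rewrite mxE (negbTE ki) mulr0.
Qed.

Lemma mul_delta_mul (A C : 'M[R]_n.+1) i j p q :
  (A * delta_mx i j * C) p q = A p i * C j q.
Proof.
rewrite mxE (bigD1 j)//= big1 ?addr0.
  rewrite mxE (bigD1 i)//= mxE !eqxx mulr1 big1 ?addr0//.
  by move=> k ki; rewrite mxE (negbTE ki) mulr0.
move=> k kj; rewrite mxE big1 ?mul0r// => l _.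
by rewrite mxE (negbTE kj) andbF mulr0.
Qed.

(** The covariance of the entry [(i, j)] with the whole matrix [B], up to the
    normalization. *)
Definition entry_covariance i j : 'M[R]_n.+1 :=
  Pm * (delta_mx i j + delta_mx j i) * Pm.

Lemma entry_covarianceE i j p q :
  entry_covariance i j p q = Pm i p * Pm j q + Pm i q * Pm j p.
Proof.
have Psym a b : Pm a b = Pm b a by rewrite -[in LHS]PmT mxE.
rewrite /entry_covariance mulrDr mulrDl mxE !mul_delta_mul.
by rewrite (Psym p i) (Psym p j) [X in _ + X]mulrC.
Qed.

Lemma trace_compressed_entry k i j :
  \tr (Q k * entry_covariance i j) = 2 * Q k i j.
Proof.
rewrite /entry_covariance mulrA.
transitivity (\tr (Pm * (Q k * (Pm * (delta_mx i j + delta_mx j i))))).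
  exact: mxtrace_mulC.
rewrite (mulrA (Q k) Pm) compressed_power_mul mulrA mul_compressed_power.
rewrite mulrDr mxtraceD.
by rewrite !trace_mul_delta (compressed_power_sym k j i) mulr_natl mulr2n.
Qed.

Lemma sum_compressed_entries a b :
  \sum_i \sum_j Q a j i * Q b j i = \tr (Q (a + b)).
Proof.
rewrite -compressed_powerD /mxtrace.
under [RHS]eq_bigr => i _ do rewrite mxE.
by apply: eq_bigr => i _; apply: eq_bigr => j _; rewrite (compressed_power_sym a j i).
Qed.

(** The deterministic part of the loop equations: the sum over all entries of
    the derivative of a power splits the trace in two pieces, or leaves it
    whole with the index reversed. *)
Lemma sum_deriv_power k :
  \sum_i \sum_j (\sum_(a < k) Q a * entry_covariance i j * B ^+ (k.-1 - a)) j i =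
  k%:R * \tr (Q k.-1) + \sum_(a < k) \tr (Q a) * \tr (Q (k.-1 - a)).
Proof.
have E a b i j : (Q a * entry_covariance i j * B ^+ b) j i =
    Q a j i * Q b j i + Q a j j * Q b i i.
  rewrite /entry_covariance !mulrA compressed_power_mul -mulrA -/(Q b).
  by rewrite mulrDr mulrDl mxE !mul_delta_mul.
transitivity (\sum_(a < k) \sum_i \sum_j
    (Q a j i * Q (k.-1 - a) j i + Q a j j * Q (k.-1 - a) i i)).
  rewrite [RHS]exchange_big; apply: eq_bigr => i _; rewrite [RHS]exchange_big/=.
  by apply: eq_bigr => j _; rewrite summxE; apply: eq_bigr => a _; rewrite E.
transitivity (\sum_(a < k) (\tr (Q k.-1) + \tr (Q a) * \tr (Q (k.-1 - a)))).
  apply: eq_bigr => a _; under eq_bigr do rewrite big_split/=.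
  rewrite big_split/= sum_compressed_entries; congr (_ + _).
    by rewrite subnKC//; have := ltn_ord a; lia.
  rewrite exchange_big /mxtrace mulr_suml; apply: eq_bigr => j _.
  by rewrite mulr_sumr.
by rewrite big_split/= sumr_const card_ord mulr_natl.
Qed.

End compressed_powers.

(** * Loop equations of a compressed Gaussian matrix *)

Section Rintegral_sum.
Context d (T : measurableType d) (R : realType) (mu : {measure set T -> \bar R}).

Lemma integrable_Rsum (J : Type) (s : seq J) (F : J -> T -> R) :
  (forall j, mu.-integrable setT (EFin \o F j)) ->
  mu.-integrable setT (EFin \o (fun x => \sum_(j <- s) F j x)).
Proof.
move=> iF; rewrite (_ : EFin \o _ = fun x => (\sum_(j <- s) (F j x)%:E)%E).
  by apply: integrable_sum => // j _; exact: iF.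
by apply/funext => x /=; rewrite sumEFin.
Qed.

Lemma Rintegral_sum (J : Type) (s : seq J) (F : J -> T -> R) :
  (forall j, mu.-integrable setT (EFin \o F j)) ->
  \int[mu]_x (\sum_(j <- s) F j x) = \sum_(j <- s) \int[mu]_x F j x.
Proof.
move=> iF; elim: s => [|j s IH].
  rewrite big_nil; under eq_Rintegral do rewrite big_nil.
  by rewrite /Rintegral integral0.
rewrite big_cons -IH -RintegralD//; last exact: integrable_Rsum.
by apply: eq_Rintegral => x _; rewrite big_cons.
Qed.

End Rintegral_sum.

Section matrix_loop_equations.
Context d (T : measurableType d) (R : realType) (P : probability T R).
Variables (I : Type) (X : I -> T -> R).
Hypothesis int_monomial : forall l, P.-integrable setT (EFin \o monomial X l).
Variables (n : nat) (Pm : 'M[R]_n.+1) (B : T -> 'M[R]_n.+1).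
Hypotheses (PmT : Pm^T = Pm) (PmPm : Pm * Pm = Pm) (trPm : \tr Pm = n%:R).
Hypotheses (BT : forall x, (B x)^T = B x) (PmB : forall x, Pm * B x = B x).
Local Notation N := (n.+1%:R : R).
(** Gaussian integration by parts for the entries of [B], whose covariances are
    those of the Gaussian orthogonal ensemble compressed by [Pm]. *)
Hypothesis ibp : forall i j, exists k : I -> R,
  (forall F F', derivation X k F F' ->
     P.-integrable setT (EFin \o (fun x => B x i j * F x)) /\
     \int[P]_x (B x i j * F x) = \int[P]_x F' x) /\
  (forall p q, derivation X k (fun x => B x p q)
     (fun _ => N^-1 * entry_covariance Pm i j p q)).

Local Notation Q x := (compressed_power Pm (B x)).

Definition normalized_trace k x : R := N^-1 * \tr (Q x k).

Definition trace_product (l : seq nat) x : R := \prod_(k <- l) normalized_trace k x.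

Section derivatives.
Variables (k : I -> R) (i j : 'I_n.+1).
Hypothesis dB : forall p q, derivation X k (fun x => B x p q)
  (fun _ => N^-1 * entry_covariance Pm i j p q).

Let mderivation (A A' : T -> 'M[R]_n.+1) :=
  forall p q, derivation X k (fun x => A x p q) (fun x => A' x p q).

Let mderivation_cst A : mderivation (fun _ => A) (fun _ => 0).
Proof.
by move=> p q; apply: derivation_eq (derivation_cst X k (A p q)) => x; rewrite ?mxE.
Qed.

Let mderivation_mul A A' C C' : mderivation A A' -> mderivation C C' ->
  mderivation (fun x => A x * C x) (fun x => A' x * C x + A x * C' x).
Proof.
move=> dA dC p q; apply: (derivation_eq _ _ (derivation_sum (index_enum 'I_n.+1)
  (fun l _ => derivation_mul (dA p l) (dC l q)) (Q := xpredT))) => x.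
  by rewrite mxE.
by rewrite !mxE -big_split.
Qed.

Let S x m := \sum_(a < m)
  B x ^+ a * (N^-1 *: entry_covariance Pm i j) * B x ^+ (m.-1 - a).

Let mderivation_exp m : mderivation (fun x => B x ^+ m) (fun x => S x m).
Proof.
elim: m => [|m IH].
  move=> p q; apply: derivation_eq (mderivation_cst 1 p q) => x.
    by rewrite expr0.
  by rewrite /S big_ord0.
have dB' : mderivation B (fun _ => N^-1 *: entry_covariance Pm i j).
  by move=> p q; apply: derivation_eq (dB p q) => x; rewrite ?mxE.
move=> p q; apply: derivation_eq (mderivation_mul dB' IH p q) => x.
  by rewrite exprS.
congr fun_of_matrix; rewrite /S big_ord_recl expr0 mul1r subn0; congr (_ + _).
rewrite mulr_sumr; apply: eq_bigr => a _; rewrite !mulrA -exprS lift0/=.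
by congr (_ * B x ^+ _); have := ltn_ord a; lia.
Qed.

Let dQ m p q : derivation X k (fun x => Q x m p q)
  (fun x => N^-1 * (\sum_(a < m) Q x a * entry_covariance Pm i j *
                      B x ^+ (m.-1 - a)) p q).
Proof.
apply: derivation_eq (mderivation_mul (mderivation_cst Pm) (mderivation_exp m) p q).
  by [].
move=> x; rewrite mul0r add0r /S.
transitivity ((N^-1 *: \sum_(a < m) Q x a * entry_covariance Pm i j *
  B x ^+ (m.-1 - a)) p q); last by rewrite mxE.
congr fun_of_matrix; rewrite mulr_sumr scaler_sumr; apply: eq_bigr => a _.
by rewrite -scalerAr -scalerAl -scalerAr !mulrA.
Qed.

Let dT m : derivation X k (normalized_trace m)
  (fun x => N ^- 2 * (2 * m)%:R * Q x m.-1 i j).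
Proof.
apply: derivation_eq (derivation_scale N^-1 (derivation_sum (index_enum 'I_n.+1)
  (fun p _ => dQ m p p) (Q := xpredT))) => // x.
rewrite -mulr_sumr mulrA -invfM -expr2 -mulrA; congr (_ * _).
transitivity (\tr (\sum_(a < m) Q x a * entry_covariance Pm i j * B x ^+ (m.-1 - a))).
  by [].
rewrite raddf_sum/=.
transitivity (\sum_(a < m) 2 * Q x m.-1 i j); last first.
  by rewrite sumr_const card_ord -mulr_natl natrM; ring.
apply: eq_bigr => a _; rewrite -trace_compressed_entry//.
rewrite [LHS]mxtrace_mulC -[X in \tr X]/(_ * _) mulrA; congr (\tr (_ * _)).
rewrite /compressed_power mulrA.
rewrite -comm_compressed//.
by rewrite -mulrA -exprD subnK//; have := ltn_ord a; lia.
Qed.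

Lemma derivation_trace_product l : derivation X k (trace_product l)
  (fun x => \sum_(m < size l) N ^- 2 * (2 * nth 0 l m)%:R *
     Q x (nth 0 l m).-1 i j * trace_product (take m l ++ drop m.+1 l) x).
Proof.
elim: l => [|m l IH].
  apply: derivation_eq (derivation_cst X k 1) => x.
    by rewrite /trace_product big_nil.
  by rewrite big_ord0.
apply: derivation_eq (derivation_mul (dT m) IH) => x.
  by rewrite /trace_product big_cons.
rewrite big_ord_recl/= drop0; congr (_ + _); rewrite mulr_sumr.
apply: eq_bigr => a _; rewrite [in RHS]/trace_product big_cons.
by rewrite mulrCA.
Qed.

Lemma derivation_entry_trace_product m l :
  derivation X k (fun x => Q x m j i * trace_product l x)
  (fun x => N^-1 * (\sum_(a < m) Q x a * entry_covariance Pm i j *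
                      B x ^+ (m.-1 - a)) j i * trace_product l x +
     Q x m j i * \sum_(p < size l) N ^- 2 * (2 * nth 0 l p)%:R *
     Q x (nth 0 l p).-1 i j * trace_product (take p l ++ drop p.+1 l) x).
Proof. exact: derivation_mul (dQ m j i) (derivation_trace_product l). Qed.

End derivatives.

Lemma integrable_trace_product l : P.-integrable setT (EFin \o trace_product l).
Proof.
have [k [_ dB]] := ibp ord0 ord0.
by have [] := integrable_derivation int_monomial (derivation_trace_product dB l).
Qed.

Let trace_entries m l x : trace_product (m.+1 :: l) x =
  \sum_i \sum_j N^-1 * (B x i j * (Q x m j i * trace_product l x)).
Proof.
rewrite /trace_product big_cons /normalized_trace compressed_powerS /mxtrace.
rewrite exchange_big/= mulr_sumr mulr_suml; apply: eq_bigr => j _.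
rewrite mxE mulr_sumr mulr_suml; apply: eq_bigr => i _.
by rewrite /trace_product; ring.
Qed.

(** The derivative of the power expands as in [sum_deriv_power]; that of another
    trace merges it with the power. *)
Let sum_derivatives m l x :
  \sum_i \sum_j N^-1 * (N^-1 * (\sum_(a < m) Q x a * entry_covariance Pm i j *
                      B x ^+ (m.-1 - a)) j i * trace_product l x +
     Q x m j i * \sum_(p < size l) N ^- 2 * (2 * nth 0 l p)%:R *
     Q x (nth 0 l p).-1 i j * trace_product (take p l ++ drop p.+1 l) x) =
  \sum_(a < m) trace_product (val a :: (m.-1 - a)%N :: l) x +
  m%:R / N * trace_product (m.-1 :: l) x +
  \sum_(j < size l) (N ^- 2 * (2 * nth 0%N l j)%:R) *
    trace_product ((m + nth 0%N l j).-1 :: take j l ++ drop j.+1 l) x.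
Proof.
have E1 : \sum_i \sum_j N^-1 * (N^-1 * (\sum_(a < m) Q x a *
    entry_covariance Pm i j * B x ^+ (m.-1 - a)) j i * trace_product l x) =
    \sum_(a < m) trace_product (val a :: (m.-1 - a)%N :: l) x +
    m%:R / N * trace_product (m.-1 :: l) x.
  transitivity (N^-1 * (N^-1 * (m%:R * \tr (Q x m.-1) +
      \sum_(a < m) \tr (Q x a) * \tr (Q x (m.-1 - a))) * trace_product l x)).
    rewrite -sum_deriv_power//.
    rewrite [in RHS]mulr_sumr mulr_suml mulr_sumr; apply: eq_bigr => i _.
    by rewrite [in RHS]mulr_sumr mulr_suml mulr_sumr.
  rewrite mulrDr mulrDl mulrDr addrC; congr (_ + _); last first.
    by rewrite /trace_product big_cons /normalized_trace; field.
  rewrite mulr_sumr mulr_suml mulr_sumr; apply: eq_bigr => a _.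
  by rewrite /trace_product !big_cons /normalized_trace; ring.
under eq_bigr => i _ do under eq_bigr => j _ do rewrite mulrDr.
under eq_bigr => i _ do rewrite big_split/=.
rewrite big_split/= E1; congr (_ + _).
transitivity (\sum_(p < size l) \sum_i \sum_j
    N^-1 * (N ^- 2 * (2 * nth 0 l p)%:R *
      trace_product (take p l ++ drop p.+1 l) x) *
      (Q x m j i * Q x (nth 0 l p).-1 j i)).
  rewrite [RHS]exchange_big/=; apply: eq_bigr => i _.
  rewrite [RHS]exchange_big/=; apply: eq_bigr => j _.
  rewrite !mulr_sumr; apply: eq_bigr => p _.
  by rewrite (compressed_power_sym PmT (BT x) (PmB x) _ i j); ring.
apply: eq_bigr => p _.
under eq_bigr => i _ do rewrite -mulr_sumr.
rewrite -mulr_sumr sum_compressed_entries//.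
case: (nth 0 l p) => [|c]; first by rewrite muln0 !(mulr0, mul0r).
by rewrite addnS/= /trace_product big_cons /normalized_trace; ring.
Qed.

(** Write the first trace as a sum over the entries of one factor [B], and
    integrate each of them by parts. *)
Lemma matrix_loop_equations :
  loop_equations n.+1 (fun l => \int[P]_x trace_product l x).
Proof.
have itp := integrable_trace_product.
split=> [|l|m l].
- under eq_Rintegral do rewrite /trace_product big_nil.
  by rewrite Rintegral_cst// mul1r [X in fine X](probability_setT P).
- rewrite -RintegralZl//; apply: eq_Rintegral => x _.
  rewrite /trace_product big_cons /normalized_trace compressed_power0 trPm.
  by congr (_ * _); rewrite -natr1; field; rewrite natr1.
pose E i j x := B x i j * (Q x m j i * trace_product l x).
pose E' i j x := N^-1 * (\sum_(a < m) Q x a * entry_covariance Pm i j *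
                      B x ^+ (m.-1 - a)) j i * trace_product l x +
     Q x m j i * \sum_(p < size l) N ^- 2 * (2 * nth 0 l p)%:R *
     Q x (nth 0 l p).-1 i j * trace_product (take p l ++ drop p.+1 l) x.
have EP i j : P.-integrable setT (EFin \o E i j) /\
    P.-integrable setT (EFin \o E' i j) /\ \int[P]_x E i j x = \int[P]_x E' i j x.
  have [k [ibpk dB]] := ibp i j.
  have dE := derivation_entry_trace_product dB m l.
  have [iE EE'] := ibpk _ _ dE; split => //; split => //.
  by have [] := integrable_derivation int_monomial dE.
have iE i j : P.-integrable setT (EFin \o (fun x => N^-1 * E i j x)).
  by have [iE0 _] := EP i j; exact: (integrableZl measurableT N^-1 iE0).
have iE' i j : P.-integrable setT (EFin \o (fun x => N^-1 * E' i j x)).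
  by have [_ [iE0 _]] := EP i j; exact: (integrableZl measurableT N^-1 iE0).
transitivity (\sum_i \sum_j \int[P]_x (N^-1 * E' i j x)).
  transitivity (\int[P]_x (\sum_i \sum_j N^-1 * E i j x)).
    by apply: eq_Rintegral => x _; exact: trace_entries.
  rewrite Rintegral_sum; last by move=> i; apply: integrable_Rsum => j; exact: iE.
  apply: eq_bigr => i _; rewrite Rintegral_sum; last by move=> j; exact: iE.
  apply: eq_bigr => j _.
  have [iEij [iE'ij EE']] := EP i j.
  by rewrite !RintegralZl// EE'.
transitivity (\int[P]_x (\sum_i \sum_j N^-1 * E' i j x)).
  rewrite Rintegral_sum; last by move=> i; apply: integrable_Rsum => j; exact: iE'.
  by apply: eq_bigr => i _; rewrite Rintegral_sum// => j; exact: iE'.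
under eq_Rintegral do rewrite sum_derivatives.
have iZ c l' : P.-integrable setT (EFin \o (fun x => c * trace_product l' x)).
  exact: (integrableZl measurableT c (itp l')).
have iS1 : P.-integrable setT (EFin \o
    (fun x => \sum_(a < m) trace_product (val a :: (m.-1 - a)%N :: l) x)).
  by apply: integrable_Rsum => a; exact: itp.
have iS2 := iZ (m%:R / N) (m.-1 :: l).
have iS3 : P.-integrable setT (EFin \o (fun x => \sum_(j < size l)
    (N ^- 2 * (2 * nth 0%N l j)%:R) *
    trace_product ((m + nth 0%N l j).-1 :: take j l ++ drop j.+1 l) x)).
  by apply: integrable_Rsum => a; exact: iZ.
have iS12 := integrableD measurableT iS1 iS2.
rewrite RintegralD// RintegralD// RintegralZl// !Rintegral_sum//; congr (_ + _).
rewrite mulr_sumr; apply: eq_bigr => j _.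
by rewrite RintegralZl// mulrA.
Qed.

End matrix_loop_equations.

(** * Covariance of rank-one contractions of a symmetric tensor *)

Section rearrangements.
Variables (R : numFieldType) (r n : nat).
Implicit Types (t u : r.-tuple 'I_n) (s : 'S_r).

Definition rearrange t s : r.-tuple 'I_n := [tuple tnth t (s i) | i < r].

Lemma rearrangeM t s1 s2 : rearrange (rearrange t s1) s2 = rearrange t (s2 * s1).
Proof. by apply: eq_from_tnth => i; rewrite !tnth_mktuple permM. Qed.

Lemma rearrange1 t : rearrange t 1 = t.
Proof. by apply: eq_from_tnth => i; rewrite tnth_mktuple perm1. Qed.

Lemma perm_eq_rearrange t s : perm_eq (rearrange t s) t.
Proof. by apply/tuple_permP; exists s. Qed.

Lemma rearrangementP t u : perm_eq u t -> exists s, u = rearrange t s.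
Proof. by move=> /tuple_permP[s us]; exists s; apply: val_inj. Qed.

(** Summing over the rearrangements of [t] is, up to a factor, summing over
    all permutations: the sum over the class is unchanged by composition with
    any permutation, and the sum over permutations does not depend on the
    representative of the class. *)
Lemma sum_rearrangements (f : r.-tuple 'I_n -> R) t :
  r`!%:R * \sum_(u : r.-tuple 'I_n | perm_eq u t) f u =
  #|[pred u : r.-tuple 'I_n | perm_eq u t]|%:R * \sum_s f (rearrange t s).
Proof.
have inv s : \sum_(u : r.-tuple 'I_n | perm_eq u t) f u =
    \sum_(u : r.-tuple 'I_n | perm_eq u t) f (rearrange u s).
  rewrite (reindex (rearrange^~ s))/=.
    apply: eq_bigl => u; apply/idP/idP => H.
      by apply: perm_trans H; rewrite perm_sym perm_eq_rearrange.
    exact: perm_trans (perm_eq_rearrange _ _) H.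
  exists (rearrange^~ s^-1%g) => u _.
    by rewrite rearrangeM mulVg rearrange1.
  by rewrite rearrangeM mulgV rearrange1.
have cls u : perm_eq u t -> \sum_s f (rearrange u s) = \sum_s f (rearrange t s).
  move=> /rearrangementP[s0 ->]; rewrite [RHS](reindex_inj (mulIg s0)).
  by apply: eq_bigr => s _; rewrite rearrangeM.
transitivity (\sum_(s : 'S_r) \sum_(u : r.-tuple 'I_n | perm_eq u t) f u).
  by rewrite sumr_const card_Sn mulr_natl.
under eq_bigr => s _ do rewrite (inv s).
rewrite exchange_big/= (eq_bigr _ cls) sumr_const mulr_natl.
by congr (_ *+ _); apply: eq_card.
Qed.

Lemma sum_tuple_prod (g : 'I_r -> 'I_n -> R) :
  \sum_(t : r.-tuple 'I_n) \prod_m g m (tnth t m) = \prod_m \sum_i g m i.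
Proof.
rewrite bigA_distr_bigA/=.
rewrite (reindex (fun f : {ffun 'I_r -> 'I_n} => [tuple f m | m < r]))/=.
  by apply: eq_bigr => f _; apply: eq_bigr => m _; rewrite tnth_mktuple.
exists (fun t => [ffun m => tnth t m]) => [f _|t _].
  by apply/ffunP => m; rewrite ffunE tnth_mktuple.
by apply: eq_from_tnth => m; rewrite tnth_mktuple ffunE.
Qed.

(** The covariance of two rank-one contractions of a Gaussian symmetric tensor
    is the permanent of the matrix of scalar products of their factors. *)
Lemma contraction_covariance (a b : 'I_r -> 'I_n -> R) :
  \sum_(t : r.-tuple 'I_n) \sum_(u : r.-tuple 'I_n)
    (\prod_m a m (tnth t m)) * (\prod_m b m (tnth u m)) *
    (if perm_eq u t then
       r%:R / #|[pred u : r.-tuple 'I_n | perm_eq u t]|%:R else 0) =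
  r%:R / r`!%:R * \sum_(s : 'S_r) \prod_m \sum_i a m i * b (s m) i.
Proof.
have f0 : r`!%:R != 0 :> R by rewrite pnatr_eq0 -lt0n fact_gt0.
transitivity (\sum_(t : r.-tuple 'I_n) \sum_(s : 'S_r)
    r%:R / r`!%:R * \prod_m (a m (tnth t m) * b (s m) (tnth t m))).
  apply: eq_bigr => t _.
  set c := #|_|; have c0 : c%:R != 0 :> R.
    by rewrite pnatr_eq0 -lt0n; apply/card_gt0P; exists t; rewrite inE.
  transitivity ((\prod_m a m (tnth t m)) * (r%:R / c%:R) *
      \sum_(u : r.-tuple 'I_n | perm_eq u t) \prod_m b m (tnth u m)).
    rewrite mulr_sumr [RHS]big_mkcond; apply: eq_bigr => u _.
    by case: ifP => _; rewrite ?mulr0// mulrAC.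
  have := sum_rearrangements (fun u => \prod_m b m (tnth u m)) t.
  rewrite -/c => /(canRL (mulKf f0)) ->.
  rewrite (reindex_inj invg_inj)/= !mulr_sumr; apply: eq_bigr => s _.
  rewrite big_split/=.
  have -> : \prod_m b m (tnth (rearrange t s^-1) m) = \prod_m b (s m) (tnth t m).
    rewrite (reindex_inj (@perm_inj _ s))/=; apply: eq_bigr => m _.
    by rewrite tnth_mktuple permK.
  by field; rewrite f0 c0.
rewrite exchange_big/= mulr_sumr; apply: eq_bigr => s _.
by rewrite -mulr_sumr; congr (_ * _); exact: (sum_tuple_prod (fun m i => _)).
Qed.

End rearrangements.

Section block_permanent.
Variables (R : comNzRingType) (q : nat).
Local Notation i0 := (ord0 : 'I_q.+2).
Local Notation i1 := (lift ord0 ord0 : 'I_q.+2).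

Let card_fix2 : #|[pred s : 'S_q.+2 | (s i0 == i0) && (s i1 == i1)]| = q`!.
Proof.
have cA : #|~: [set i0; i1]| = q by rewrite cardsCs finset.setCK cards2 card_ord /= subn2.
transitivity #|perm_on (~: [set i0; i1])|; last by rewrite card_perm cA.
apply: eq_card => s; rewrite !inE.
apply/andP/fintype.subsetP => [[/eqP s0 /eqP s1] i|H].
  by rewrite !inE negb_or => ne; apply/andP; split; apply: contraNneq ne => ->;
     rewrite ?s0 ?s1.
by split; apply/negPn/negP => /H; rewrite !inE eqxx ?orbT.
Qed.

(** Only the permutations that preserve the set of the first two indices
    contribute, and each of the two ways of permuting these has [q`!]
    extensions. *)
Lemma permanent_block (h : 'I_q.+2 -> 'I_q.+2 -> R) :
  (forall i j : 'I_q.+2, ((i < 2) != (j < 2))%N -> h i j = 0) ->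
  (forall i j : 'I_q.+2, (2 <= i)%N -> (2 <= j)%N -> h i j = 1) ->
  \sum_(s : 'S_q.+2) \prod_m h m (s m) =
  q`!%:R * (h i0 i0 * h i1 i1 + h i0 i1 * h i1 i0).
Proof.
move=> h0 h1.
have lt2 (i : 'I_q.+2) : (i < 2)%N = (i == i0) || (i == i1).
  by case: i => [[|[|i]] Hi].
have prod2 (s : 'S_q.+2) : (forall m : 'I_q.+2, (2 <= m)%N -> (2 <= s m)%N) ->
    \prod_m h m (s m) = h i0 (s i0) * h i1 (s i1).
  move=> s2; rewrite !big_ord_recl/= mulrA big1 ?mulr1// => i _.
  by rewrite h1// s2.
have keep2 (s : 'S_q.+2) : (s i0 < 2)%N -> (s i1 < 2)%N ->
    forall m : 'I_q.+2, (2 <= m)%N -> (2 <= s m)%N.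
  move=> s0 s1 m m2; rewrite leqNgt; apply/negP => sm2.
  have sne i j : i != j -> s i != s j by apply: contra_neq => /perm_inj.
  have m0 : m != i0 by apply: contraTneq m2 => ->.
  have m1 : m != i1 by apply: contraTneq m2 => ->.
  have := sne _ _ m0; have := sne _ _ m1; have := sne i0 i1 isT.
  move: s0 s1 sm2; rewrite !lt2.
  by do 3![case/orP => /eqP ->].
rewrite (bigID (fun s : 'S_q.+2 => (s i0 == i0) && (s i1 == i1)))/=.
rewrite [X in _ + X](bigID (fun s : 'S_q.+2 => (s i0 == i1) && (s i1 == i0)))/=.
rewrite [X in _ + (_ + X)]big1 ?addr0; last first.
  move=> s /andP[H1 H2]; case: (boolP (s i0 < 2)%N) => s0; last first.
    by rewrite (bigD1 i0)//= h0 ?mul0r// (negbTE s0).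
  case: (boolP (s i1 < 2)%N) => s1; last first.
    by rewrite (bigD1 i1)//= h0 ?mul0r// (negbTE s1).
  have ne : s i0 != s i1 by apply/negP => /eqP/perm_inj.
  move: s0 s1 H1 H2 ne; rewrite !lt2.
  by case/orP => /eqP -> /orP[] /eqP ->; rewrite ?eqxx.
rewrite mulrDr; congr (_ + _).
  rewrite (eq_bigr (fun _ => h i0 i0 * h i1 i1)).
    by rewrite sumr_const card_fix2 mulr_natl.
  by move=> s /andP[/eqP s0 /eqP s1]; rewrite prod2 ?s0 ?s1//; apply: keep2;
     rewrite ?s0 ?s1.
rewrite (eq_bigr (fun _ => h i0 i1 * h i1 i0)).
  rewrite (reindex_inj (mulgI (tperm i0 i1)))/= -card_fix2 mulr_natl -sumr_const.
  apply: eq_bigl => s; rewrite !inE !permM tpermL tpermR.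
  by case: (eqVneq (s i0) i0) => [->|_]; rewrite !(andbF, andbT).
by move=> s /andP[_ /andP[/eqP s0 /eqP s1]]; rewrite prod2 ?s0 ?s1//; apply: keep2;
   rewrite ?s0 ?s1.
Qed.

End block_permanent.

(** * Integration by parts for the entries of the compressed contraction *)

Section gote_wick.
Context d (T : measurableType d) (R : realType) (P : probability T R).
Variables (r n : nat) (G : r.-tuple 'I_n -> {RV P >-> R}).
Hypotheses (r0 : (0 < r)%N) (hG : GOTE G).
Implicit Types t u : r.-tuple 'I_n.

Let X t : T -> R := G t.
Let sd t : R := Num.sqrt (r%:R / (nperm t)%:R).
Let D := [pred t : r.-tuple 'I_n | sorted leq (map val t)].
Let leI := [rel i j : 'I_n | (i <= j)%N].
(** The entries are independent only when indexed by sorted multi-indices, so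
    every entry is first rewritten as the one with sorted index. *)
Let arrange t : r.-tuple 'I_n := [tuple of sort leI t].

Let leI_total : total leI. Proof. by move=> i j; exact: leq_total. Qed.

Let arrangeD t : arrange t \in D.
Proof. by rewrite inE sorted_map; apply: (sort_sorted leI_total). Qed.

Let perm_arrange t : perm_eq (arrange t) t.
Proof. by rewrite perm_sort. Qed.

Let arrange_eq t u : (arrange u == arrange t) = perm_eq u t.
Proof.
rewrite -val_eqE /=; apply/eqP/idP => [H|/perm_sortP]; last first.
  apply=> // [i j k|i j]; first exact: leq_trans.
  by move=> H; apply/val_inj/eqP; rewrite eqn_leq.
by rewrite -(perm_sort leI) H perm_sort.
Qed.

Let nperm_gt0 t : (0 < nperm t)%N.
Proof. by apply/card_gt0P; exists t; rewrite inE. Qed.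

Let sd0 t : t \in D -> sd t != 0.
Proof. by move=> _; rewrite gt_eqF// sqrtr_gt0 divr_gt0 ?ltr0n. Qed.

Let gauss t : t \in D -> forall B : set R, measurable B ->
  distribution P (G t) B = normal_prob 0 (sd t) B.
Proof. by move=> _; have [_ + _] := hG; exact. Qed.

Let indep : mutually_independent D G. Proof. by have [] := hG. Qed.

Let X_arrange t : X t = X (arrange t).
Proof.
by apply/funext => x; have [+ _ _] := hG; apply; rewrite perm_sym.
Qed.

Let monomial_arrange l : monomial X l = monomial X (map arrange l).
Proof.
apply/funext => x; rewrite /monomial big_map; apply: eq_bigr => t _.
by rewrite -X_arrange.
Qed.

Definition tensor_covariance t u : R :=
  if perm_eq u t then r%:R / (nperm t)%:R else 0.

Lemma gote_integrable_monomial l : P.-integrable setT (EFin \o monomial X l).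
Proof.
rewrite monomial_arrange; apply: (integrable_gaussian_monomial indep sd0 gauss).
by apply/allP => _ /mapP[t _ ->]; exact: arrangeD.
Qed.

Lemma gote_wick t l : \int[P]_x (X t x * monomial X l x) =
  \int[P]_x monomial_deriv X (tensor_covariance t) l x.
Proof.
rewrite X_arrange monomial_arrange (gaussian_wick indep sd0 gauss)//; last first.
  by apply/allP => _ /mapP[u _ ->]; exact: arrangeD.
apply: eq_Rintegral => x _; elim: l => //= u l ->.
rewrite -[G (arrange u) x]/(X (arrange u) x) -X_arrange -monomial_arrange arrange_eq.
rewrite /tensor_covariance.
congr (_ * _ + _); case: ifP => // _; rewrite sqr_sqrtr; last by rewrite divr_ge0.
congr (_ / _%:R); apply: eq_card => v; rewrite !inE.
by have /permPr -> := perm_arrange t.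
Qed.

Variable c : r.-tuple 'I_n -> R.
Let L x := \sum_t c t * X t x.
Let k u := \sum_t c t * tensor_covariance t u.

Lemma gote_integration_by_parts F F' : derivation X k F F' ->
  P.-integrable setT (EFin \o (fun x => L x * F x)) /\
  \int[P]_x (L x * F x) = \int[P]_x F' x.
Proof.
have iX t l : P.-integrable setT (EFin \o (fun x => c t * (X t x * monomial X l x))).
  have E : monomial X (t :: l) = fun x => X t x * monomial X l x.
    by apply/funext => x; rewrite /monomial big_cons.
  have := gote_integrable_monomial (t :: l); rewrite E => iE.
  exact: (integrableZl measurableT (c t) iE).
have LE l x : L x * monomial X l x = \sum_t c t * (X t x * monomial X l x).
  by rewrite mulr_suml; apply: eq_bigr => t _; rewrite mulrA.
have im := integrable_monomial_deriv gote_integrable_monomial.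
apply: integration_by_parts_derivation => //; first exact: gote_integrable_monomial.
  by move=> l; rewrite (funext (LE l)); exact: integrable_Rsum.
move=> l; under eq_Rintegral do rewrite LE.
rewrite Rintegral_sum//.
transitivity (\sum_t \int[P]_x (c t * monomial_deriv X (tensor_covariance t) l x)).
  apply: eq_bigr => t _; rewrite !RintegralZl ?gote_wick//.
  rewrite (_ : EFin \o _ = EFin \o monomial X (t :: l)).
    exact: gote_integrable_monomial.
  by apply/funext => x /=; rewrite /monomial big_cons.
rewrite -Rintegral_sum; last first.
  by move=> t; exact: (integrableZl measurableT (c t) (im _ _)).
apply: eq_Rintegral => x _; elim: l => [|u l IH] /=.
  by rewrite big1// => t _; rewrite mulr0.
rewrite -IH /k mulr_suml mulr_sumr -big_split/=.
by apply: eq_bigr => t _; ring.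
Qed.

End gote_wick.

Section compressed_contraction.
Variables (R : realType) (q m : nat) (w : 'rV[R]_m.+1).
Hypothesis hw : \sum_(i < m.+1) w 0 i ^+ 2 = 1.
Local Notation n := m.+1.
Local Notation r := q.+2.

Definition hyperplane_proj : 'M[R]_n := 1 - w^T *m w.
Local Notation Pm := hyperplane_proj.

Let wwT : w *m w^T = 1%:M.
Proof.
apply/matrixP => i j; rewrite !ord1 !mxE eqxx mulr1n -hw.
by apply: eq_bigr => k _; rewrite !mxE expr2.
Qed.

Lemma trmx_hyperplane_proj : Pm^T = Pm.
Proof. by rewrite /Pm linearB/= trmx_mul trmxK trmx1. Qed.

Lemma mulmx_hyperplane_proj : w *m Pm = 0.
Proof. by rewrite /Pm mulmxBr mulmx1 mulmxA wwT mul1mx subrr. Qed.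

Lemma hyperplane_proj_idem : Pm * Pm = Pm.
Proof.
rewrite {1}/Pm mulrBl mul1r -[X in _ - X]mulmxA mulmx_hyperplane_proj.
by rewrite mulmx0 subr0.
Qed.

Lemma trace_hyperplane_proj : \tr Pm = m%:R.
Proof.
rewrite /Pm linearB/= mxtrace1 mxtrace_mulC wwT mxtrace1.
by rewrite -natr1 addrK.
Qed.

Let proj_sym a b : Pm a b = Pm b a.
Proof. by rewrite -[in LHS]trmx_hyperplane_proj mxE. Qed.

Let dotPw i : \sum_a Pm i a * w 0 a = 0.
Proof.
transitivity ((w *m Pm) 0 i); last by rewrite mulmx_hyperplane_proj mxE.
by rewrite mxE; apply: eq_bigr => a _; rewrite mulrC proj_sym.
Qed.

Let dotPP i p : \sum_a Pm i a * Pm p a = Pm i p.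
Proof.
rewrite -[in RHS]hyperplane_proj_idem mxE; apply: eq_bigr => a _.
by rewrite (proj_sym p a).
Qed.

(** The factors of the rank-one tensor with which the tensor is contracted to
    give the entry [(i, j)] of the compressed matrix. *)
Definition contraction_factor (i j : 'I_n) (l : 'I_r) (a : 'I_n) : R :=
  match val l with 0%N => Pm i a | 1%N => Pm j a | _ => w 0 a end.

Lemma sum_take2_tuple (i j : 'I_n) (F : r.-tuple 'I_n -> R) :
  \sum_(t : r.-tuple 'I_n | take 2 t == [:: i; j]) F t =
  \sum_(t : r.-tuple 'I_n)
    (tnth t ord0 == i)%:R * (tnth t (lift ord0 ord0) == j)%:R * F t.
Proof.
rewrite big_mkcond; apply: eq_bigr => t _.
case: t => -[|a [|b s]] Hs //=; rewrite take0 !(tnth_nth i)/= !eqseq_cons andbT.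
by case: eqP => _; case: eqP => _; rewrite ?mul1r ?mul0r.
Qed.

Lemma drop2_tuple_prod (t : r.-tuple 'I_n) (f : 'I_n -> R) :
  \prod_(k <- drop 2 t) f k =
  \prod_(l < q) f (tnth t (lift ord0 (lift ord0 l))).
Proof.
case: t => -[|a [|b s]] //= Hs; rewrite drop0.
rewrite (big_nth a) (eqP (_ : size s == q))//  big_mkord.
by apply: eq_bigr => l _; rewrite (tnth_nth a).
Qed.

Lemma compressed_contractionE (c : R) (g : r.-tuple 'I_n -> R) i j :
  (Pm * (c *: tensor_contraction g w) * Pm) i j =
  \sum_(t : r.-tuple 'I_n)
    (c * \prod_l contraction_factor i j l (tnth t l)) * g t.
Proof.
transitivity (\sum_a \sum_b Pm i a * Pm j b * c * tensor_contraction g w a b).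
  rewrite mxE [RHS]exchange_big/=; apply: eq_bigr => b _.
  rewrite mxE mulr_suml; apply: eq_bigr => a _.
  by rewrite [X in _ * X * _ = _]mxE (proj_sym b j); ring.
transitivity (\sum_(t : r.-tuple 'I_n) \sum_a \sum_b
   (tnth t ord0 == a)%:R * (tnth t (lift ord0 ord0) == b)%:R *
   (Pm i a * Pm j b * c * (g t * \prod_(k <- drop 2 t) w 0 k))).
  rewrite [RHS]exchange_big; apply: eq_bigr => a _; rewrite [RHS]exchange_big/=.
  apply: eq_bigr => b _; rewrite [tensor_contraction g w a b]mxE sum_take2_tuple.
  rewrite mulr_sumr.
  by apply: eq_bigr => t _; ring.
apply: eq_bigr => t _.
rewrite (bigD1 (tnth t ord0))//= [X in _ + X]big1 ?addr0; last first.
  move=> a /negbTE ne; rewrite big1// => b _.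
  by rewrite eq_sym ne !mul0r.
rewrite (bigD1 (tnth t (lift ord0 ord0)))//= [X in _ + X]big1 ?addr0; last first.
  by move=> b /negbTE ne; rewrite [_ == b]eq_sym ne mulr0 mul0r.
rewrite !eqxx !mul1r !big_ord_recl/= drop2_tuple_prod /contraction_factor/=.
by ring.
Qed.

Lemma tensor_contraction_sym (g : r.-tuple 'I_n -> R) :
  (forall t u : r.-tuple 'I_n, perm_eq t u -> g t = g u) ->
  (tensor_contraction g w)^T = tensor_contraction g w.
Proof.
move=> gS; apply/matrixP => i j; rewrite !mxE.
pose sw (t : r.-tuple 'I_n) : r.-tuple 'I_n :=
  rearrange t (tperm ord0 (lift ord0 ord0)).
have swK : involutive sw.
  by move=> t; rewrite /sw rearrangeM tperm2 rearrange1.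
have sw0 t : tnth (sw t) ord0 = tnth t (lift ord0 ord0).
  by rewrite tnth_mktuple tpermL.
have sw1 t : tnth (sw t) (lift ord0 ord0) = tnth t ord0.
  by rewrite tnth_mktuple tpermR.
rewrite !sum_take2_tuple [LHS](reindex_inj (inv_inj swK)).
apply: eq_bigr => t _; rewrite sw0 sw1 !drop2_tuple_prod.
rewrite (gS (sw t) t); last exact: perm_eq_rearrange.
rewrite [X in X * _ = _]mulrC; congr (_ * (_ * _)).
by apply: eq_bigr => l _; rewrite tnth_mktuple tpermD.
Qed.

(** The first two factors are orthogonal to the others, which are all [w], so
    the permanent is that of a two-by-two block; its coefficient [q`! * r / r`!]
    is [1 / (r - 1)], which the normalization [c] turns into [1 / n]. *)
Lemma compressed_covariance (c : R) i j p s : c ^+ 2 = q.+1%:R / n%:R ->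
  \sum_(u : r.-tuple 'I_n) (c * \prod_l contraction_factor p s l (tnth u l)) *
    (\sum_(t : r.-tuple 'I_n) (c * \prod_l contraction_factor i j l (tnth t l)) *
       tensor_covariance R t u) =
  n%:R^-1 * entry_covariance Pm i j p s.
Proof.
move=> c2.
transitivity (c ^+ 2 * \sum_(t : r.-tuple 'I_n) \sum_(u : r.-tuple 'I_n)
    (\prod_l contraction_factor i j l (tnth t l)) *
    (\prod_l contraction_factor p s l (tnth u l)) * tensor_covariance R t u).
  rewrite [in RHS]exchange_big/= [RHS]mulr_sumr; apply: eq_bigr => u _.
  by rewrite !mulr_sumr; apply: eq_bigr => t _; ring.
rewrite contraction_covariance.
rewrite (permanent_block (h := fun l l' =>
  \sum_a contraction_factor i j l a * contraction_factor p s l' a)); last 2 first.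
- move=> [[|[|l]] Hl] [[|[|l']] Hl'] //= _;
    rewrite /contraction_factor/= ?dotPw//;
    by under eq_bigr do rewrite mulrC; rewrite dotPw.
- move=> [[|[|l]] Hl] [[|[|l']] Hl'] //= _ _.
rewrite /contraction_factor/= !dotPP entry_covarianceE ?trmx_hyperplane_proj//.
rewrite c2 !factS !natrM; field.
by rewrite !nat1r -natrD !pnatr_eq0 (gtn_eqF (fact_gt0 q)).
Qed.

End compressed_contraction.


Section contraction_loop_equations.
Context d (T : measurableType d) (R : realType) (P : probability T R).
Variables (q m : nat) (w : 'rV[R]_m.+1).
Hypothesis hw : \sum_(i < m.+1) w 0 i ^+ 2 = 1.
Variable G : q.+2.-tuple 'I_m.+1 -> {RV P >-> R}.
Hypothesis hG : GOTE G.
Variable c : R.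
Hypothesis c2 : c ^+ 2 = q.+1%:R / m.+1%:R.
Let A x : 'M[R]_m.+1 := c *: tensor_contraction (fun t => G t x) w.
Local Notation Pm := (hyperplane_proj w).

Definition compressed_contraction x : 'M[R]_m.+1 := Pm * A x * Pm.

Lemma scaled_contraction_sym x : (A x)^T = A x.
Proof.
rewrite /A linearZ/= tensor_contraction_sym// => t u tu.
by have [+ _ _] := hG; apply.
Qed.

Lemma compressed_contraction_sym x :
  (compressed_contraction x)^T = compressed_contraction x.
Proof.
rewrite /compressed_contraction -[_ * _ * _]/(_ *m _ *m _) !trmx_mul.
by rewrite trmx_hyperplane_proj scaled_contraction_sym mulmxA.
Qed.

Lemma proj_compressed_contraction x :
  Pm * compressed_contraction x = compressed_contraction x.
Proof. by rewrite /compressed_contraction !mulrA hyperplane_proj_idem. Qed.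

(** [A - Pm A Pm = V A + Pm A V] where [V = 1 - Pm] has rank one. *)
Lemma compression_rank x : (\rank (A x - compressed_contraction x)%R <= 2)%N.
Proof.
pose V := w^T *m w.
have -> : A x - compressed_contraction x = V *m A x + Pm *m A x *m V.
  rewrite /compressed_contraction -[_ * _ * _]/(_ *m _ *m _).
  have -> : V = 1 - Pm by rewrite /hyperplane_proj opprB addrC subrK.
  move: Pm (A x) => Q A1; rewrite mulmxBl mulmxBr [1 *m _]mul1mx.
  by rewrite [_ *m 1]mulmx1 addrA subrK.
have rV : (\rank V <= 1)%N.
  by apply: leq_trans (mxrankM_maxl _ _) _; rewrite mxrank_tr rank_leq_row.
apply: leq_trans (mxrank_add _ _) _; rewrite -(addn1 1); apply: leq_add.
  exact: leq_trans (mxrankM_maxl _ _) rV.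
exact: leq_trans (mxrankM_maxr _ _) rV.
Qed.

Let X t : T -> R := G t.

Let ibp i j : exists k : q.+2.-tuple 'I_m.+1 -> R,
  (forall F F', derivation X k F F' ->
     P.-integrable setT (EFin \o (fun x => compressed_contraction x i j * F x)) /\
     \int[P]_x (compressed_contraction x i j * F x) = \int[P]_x F' x) /\
  (forall p s, derivation X k (fun x => compressed_contraction x p s)
     (fun _ => m.+1%:R^-1 * entry_covariance Pm i j p s)).
Proof.
pose cf i j (t : q.+2.-tuple 'I_m.+1) : R :=
  c * \prod_l contraction_factor w i j l (tnth t l).
have BE p s x : compressed_contraction x p s = \sum_t cf p s t * X t x.
  exact: compressed_contractionE.
exists (fun u => \sum_t cf i j t * tensor_covariance R t u); split => [F F' dF|p s].
  have [H1 H2] := gote_integration_by_parts (r := q.+2) isT hG (c := cf i j) dF.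
  split; first by under eq_fun do rewrite BE.
  by rewrite -H2; apply: eq_Rintegral => x _; rewrite BE.
apply: derivation_eq (derivation_sum (index_enum _) (fun t (_ : xpredT t) =>
  derivation_scale (cf p s t) (derivation_var X _ t))) => x.
  by rewrite BE.
exact: compressed_covariance.
Qed.

Lemma integrable_compressed_contraction l :
  P.-integrable setT (EFin \o trace_product Pm compressed_contraction l).
Proof.
have iG := gote_integrable_monomial (r := q.+2) isT hG.
apply: (integrable_trace_product iG _ _ _ _ ibp).
- exact: trmx_hyperplane_proj.
- exact: hyperplane_proj_idem.
- exact: compressed_contraction_sym.
- exact: proj_compressed_contraction.
Qed.

Lemma compressed_contraction_loop_equations :
  loop_equations m.+1
    (fun l => \int[P]_x trace_product Pm compressed_contraction l x).
Proof.
have iG := gote_integrable_monomial (r := q.+2) isT hG.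
apply: (matrix_loop_equations iG _ _ _ _ _ ibp).
- exact: trmx_hyperplane_proj.
- exact: hyperplane_proj_idem.
- exact: trace_hyperplane_proj.
- exact: compressed_contraction_sym.
- exact: proj_compressed_contraction.
Qed.

End contraction_loop_equations.

(** * Spectra of real symmetric matrices *)

(** A real symmetric matrix is diagonalized over the complex numbers, as a
    Hermitian matrix; its real eigenvalues are all that is used later. *)
Section complex_spectrum.
Local Open Scope complex_scope.
Variables (R : rcfType) (n : nat).
Local Notation C := R[i].
Local Notation toC := (real_complex R).
Implicit Types (A B : 'M[R]_n) (U : 'M[C]_n) (s : n.-tuple R).

Let adj m1 m2 (M : 'M[C]_(m1, m2)) : 'M[C]_(m2, m1) := map_mx Num.conj M^T.

(** The rows of [U] are orthonormal eigenvectors of [A] for the eigenvalues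
    [s]. *)
Definition diagonalizes A s U : Prop :=
  U *m adj U = 1%:M /\
  map_mx toC A = adj U *m diag_mx (\row_i toC (tnth s i)) *m U.

Lemma symmetric_diagonalizes A : A^T = A ->
  exists s U, sorted >=%R s /\ diagonalizes A s U.
Proof.
move=> AT; pose AC := map_mx toC A.
have ACr : AC \is a mxOver Num.real.
  by apply/mxOverP => i j; rewrite mxE; apply/complex_realP; exists (A i j).
have ACs : AC \is hermsymmx.
  apply: realsym_hermsym => //; apply/is_hermitianmxP.
  by rewrite expr0 scale1r map_mx_id// /AC map_trmx AT.
have Vu := spectral_unitarymx AC.
have /orthomx_spectralP AE := hermitian_normalmx ACs.
have dr := hermitian_spectral_diag_real ACs.
move: AE dr Vu; move: (spectralmx AC) (spectral_diag AC) => V D AE dr Vu.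
pose e := [tuple complex.Re (D 0 i) | i < n].
have eD i : toC (tnth e i) = D 0 i.
  by rewrite tnth_mktuple RRe_real//; exact: (mxOverP dr).
have [p pE] : exists p : 'S_n, sort >=%R e = [tuple tnth e (p i) | i < n].
  by apply/tuple_permP; rewrite perm_sort.
pose s := [tuple tnth e (p i) | i < n].
exists s, (row_perm p V); split.
  by rewrite -pE; apply: sort_sorted => x y /=; exact: le_total.
have VV : V *m adj V = 1%:M by apply/unitarymxP.
split.
  apply/matrixP => i j; have /matrixP/(_ (p i) (p j)) := VV; rewrite !mxE.
  rewrite (inj_eq perm_inj) => <-.
  by apply: eq_bigr => k _; rewrite !mxE.
rewrite -/AC AE invmx_unitary//.
apply/matrixP => i j; rewrite !mxE (reindex_inj (@perm_inj _ p))/=.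
apply: eq_bigr => k _.
rewrite !mul_mx_diag !mxE; congr (_ * _ * _).
by rewrite [tnth s k]tnth_mktuple eD.
Qed.

Lemma adj_diagonalizing A s U : diagonalizes A s U -> adj U *m U = 1%:M.
Proof. by move=> [/mulmx1C]. Qed.

Lemma char_poly_diagonalizes A s U : diagonalizes A s U ->
  char_poly A = \prod_(x <- s) ('X - x%:P).
Proof.
move=> dA; have UU := adj_diagonalizing dA; have [_ AE] := dA.
apply: (map_poly_inj toC); rewrite map_char_poly AE map_prod_XsubC.
set D := diag_mx _.
transitivity (char_poly D); last first.
  rewrite char_poly_trig; last exact/diag_mx_is_trig.
  by rewrite big_tuple; apply: eq_bigr => i _; rewrite !mxE eqxx.
rewrite /char_poly /char_poly_mx !map_mxM.
have UU' : map_mx polyC (adj U) *m map_mx polyC U = 1%:M.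
  by rewrite -map_mxM UU map_mx1.
have XE : 'X%:M = map_mx polyC (adj U) *m 'X%:M *m map_mx polyC U.
  by rewrite scalar_mxC -mulmxA UU' mulmx1.
rewrite [in LHS]XE -mulmxBl -mulmxBr !det_mulmx mulrAC -det_mulmx UU' det1 mul1r.
by [].
Qed.

Let sqnorm (v : 'rV[C]_n) : C := (v *m adj v) 0 0.

Let sqnormE v : sqnorm v = \sum_j `|v 0 j| ^+ 2.
Proof.
rewrite /sqnorm mxE; apply: eq_bigr => j _.
by rewrite !mxE normCK.
Qed.

Let sqnorm_gt0 v : v != 0 -> 0 < sqnorm v.
Proof.
move=> v0; rewrite lt_neqAle sqnormE sumr_ge0 ?andbT; last first.
  by move=> j _; rewrite exprn_ge0.
rewrite eq_sym; apply: contra v0; rewrite psumr_eq0; last first.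
  by move=> j _; rewrite exprn_ge0.
move=> /allP v0; apply/eqP/rowP => j; rewrite mxE.
by have := v0 j (mem_index_enum _); rewrite /= expf_eq0/= normr_eq0 => /eqP.
Qed.

Let adjM m1 m2 m3 (M : 'M[C]_(m1, m2)) (N : 'M[C]_(m2, m3)) :
  adj (M *m N) = adj N *m adj M.
Proof. by rewrite /adj trmx_mul map_mxM. Qed.

Let quadratic A s U x : diagonalizes A s U ->
  ((x *m U) *m map_mx toC A *m adj (x *m U)) 0 0 =
    \sum_j toC (tnth s j) * `|x 0 j| ^+ 2 /\ sqnorm (x *m U) = sqnorm x.
Proof.
move=> [UU AE]; rewrite adjM; split.
  have -> : x *m U *m map_mx toC A *m (adj U *m adj x) =
      x *m diag_mx (\row_i toC (tnth s i)) *m adj x.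
    rewrite AE !mulmxA -(mulmxA x U) UU mulmx1.
    by rewrite -(mulmxA _ U) UU mulmx1.
  rewrite mxE; apply: eq_bigr => j _; rewrite mul_mx_diag !mxE normCK.
  by rewrite mulrCA mulrA.
by rewrite /sqnorm adjM mulmxA -(mulmxA x U) UU mulmx1.
Qed.

(** Interlacing under a perturbation of rank [k]: the span of the first
    eigenvectors of [A], the span of the last ones of [B] and the kernel of
    [A - B] have dimensions with sum [2 n + 1], hence a common vector, on which
    the two quadratic forms agree. *)
Lemma rank_interlacing A B s (t : n.-tuple R) U V k (i j : 'I_n) :
  sorted >=%R s -> sorted >=%R t -> diagonalizes A s U -> diagonalizes B t V ->
  (\rank (A - B)%R <= k)%N -> (i + k = j)%N -> tnth s j <= tnth t i.
Proof.
move=> ss st dA dB rAB ijk.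
pose AC := map_mx toC A; pose BC := map_mx toC B.
pose X : 'M[C]_n := pid_mx j.+1 *m U.
pose Y : 'M[C]_n := copid_mx i *m V.
have freeU (W : 'M[C]_n) : W *m adj W = 1%:M -> row_free W.
  by move=> WW; apply/row_freeP; exists (adj W).
have rX : \rank X = j.+1.
  by rewrite mxrankMfree ?rank_pid_mx ?ltn_ord//; apply: freeU; have [] := dA.
have rY : \rank Y = (n - i)%N.
  by rewrite mxrankMfree ?rank_copid_mx 1?ltnW ?ltn_ord//; apply: freeU; have [] := dB.
pose K := kermx (AC - BC).
have rK : (n - k <= \rank K)%N.
  by rewrite mxrank_ker -map_mxB mxrank_map leq_sub2l.
have : (X :&: (Y :&: K) != 0)%MS.
  rewrite -mxrank_eq0 -lt0n.
  have := mxrank_sum_cap X (Y :&: K)%MS; have := mxrank_sum_cap Y K.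
  have := rank_leq_row (X + (Y :&: K))%MS; have := rank_leq_row (Y + K)%MS.
  have := ltn_ord i; have := ltn_ord j.
  by move: (\rank (X :&: (Y :&: K))%MS) (\rank (Y :&: K)%MS) (\rank (Y + K)%MS)
    (\rank (X + (Y :&: K))%MS) (\rank K) rK rX rY => *; lia.
move=> /rowV0Pn[v]; rewrite !sub_capmx => /and3P[/submxP[x vx] /submxP[y vy] vK] v0.
have quad : (v *m AC *m adj v) 0 0 = (v *m BC *m adj v) 0 0.
  move: vK => /sub_kermxP; rewrite mulmxBr => /eqP; rewrite subr_eq0.
  by move=> /eqP ->.
have vx' : x *m pid_mx j.+1 *m U = v by rewrite -mulmxA.
have vy' : y *m copid_mx i *m V = v by rewrite -mulmxA.
have := quadratic (x *m pid_mx j.+1) dA; rewrite vx' => -[qA nA].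
have := quadratic (y *m copid_mx i) dB; rewrite vy' => -[qB nB].
have srt (u : n.-tuple R) : sorted >=%R u ->
    forall a b : 'I_n, (a <= b)%N -> tnth u b <= tnth u a.
  move=> su a b ab; rewrite !(tnth_nth 0).
  by apply: (sorted_leq_nth (@ge_trans _ R) (@ge_refl _ R) 0 su);
    rewrite ?inE ?size_tuple.
have lo : toC (tnth s j) * sqnorm v <= (v *m AC *m adj v) 0 0.
  rewrite qA nA sqnormE mulr_sumr; apply: ler_sum => l _.
  case: (leqP l j) => lj.
    by rewrite ler_wpM2r ?exprn_ge0// lecR srt.
  rewrite (_ : (x *m pid_mx j.+1) 0 l = 0) ?normr0 ?expr0n ?mulr0//.
  rewrite mxE big1// => a _; rewrite mxE ltnS; case: eqP => [->|]; rewrite ?mulr0//.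
  by rewrite leqNgt lj mulr0.
have up : (v *m BC *m adj v) 0 0 <= toC (tnth t i) * sqnorm v.
  rewrite qB nB sqnormE mulr_sumr; apply: ler_sum => l _.
  case: (leqP i l) => il.
    by rewrite ler_wpM2r ?exprn_ge0// lecR srt.
  rewrite (_ : (y *m copid_mx i) 0 l = 0) ?normr0 ?expr0n ?mulr0//.
  rewrite mxE big1// => a _; rewrite !mxE -val_eqE /=.
  by case: eqP => [->|_]; rewrite ?il subrr mulr0.
rewrite -lecR -(ler_pM2r (sqnorm_gt0 v0)).
by apply: le_trans lo _; rewrite quad.
Qed.

End complex_spectrum.

Lemma trace_exp_conj_diag (K : comNzRingType) (n : nat) (M V U : 'M[K]_n.+1) D k :
  U *m V = 1%:M -> M = V *m diag_mx D *m U -> \tr (M ^+ k) = \sum_i D 0 i ^+ k.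
Proof.
move=> UV ME; have VU := mulmx1C UV.
have -> : M ^+ k = V *m diag_mx (\row_i D 0 i ^+ k) *m U.
  elim: k => [|k IH].
    rewrite expr0 -[LHS]VU (_ : \row_i _ = const_mx 1) ?diag_const_mx ?mulmx1//.
    by apply/rowP => i; rewrite !mxE expr0.
  rewrite exprS -[M * _]/(M *m _) IH ME !mulmxA.
  rewrite -(mulmxA _ U) UV mulmx1 -(mulmxA _ (diag_mx _) (diag_mx _)) mulmx_diag.
  by congr (_ *m diag_mx _ *m _); apply/rowP => i; rewrite !mxE exprS.
rewrite mxtrace_mulC mulmxA UV mul1mx mxtrace_diag.
by apply: eq_bigr => i _; rewrite mxE.
Qed.

Lemma trace_exp_diagonalizes (R : rcfType) (n : nat) (A : 'M[R]_n.+1) s U k :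
  diagonalizes A s U -> \tr (A ^+ k) = \sum_i tnth s i ^+ k.
Proof.
move=> [UU AE]; apply: (@complexI R).
transitivity (\tr (map_mx (real_complex R) A ^+ k)).
  rewrite -trace_map_mx; congr mxtrace; elim: k => [|k IH].
    by rewrite !expr0 map_mx1.
  by rewrite !exprS -IH; exact: map_mxM.
rewrite (trace_exp_conj_diag k UU AE) raddf_sum.
by apply: eq_bigr => i _; rewrite mxE; apply/esym; exact: (rmorphXn (real_complex R)).
Qed.


Section empirical_spectrum.
Variable R : realType.

(** Both the order and the roots of the characteristic polynomial are
    prescribed, so the list of eigenvalues is the one of a diagonalization. *)
Lemma eigenvalues_diagonalizes n (A : 'M[R]_n) : A^T = A ->
  sorted >=%R (eigenvalues A) /\ exists U, diagonalizes A (eigenvalues A) U.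
Proof.
move=> AT; have [s [U [ss dA]]] := symmetric_diagonalizes AT.
have cA := char_poly_diagonalizes dA.
have [sA cE] : sorted >=%R (eigenvalues A) /\
    char_poly A = \prod_(x <- eigenvalues A) ('X - x%:P).
  by rewrite /eigenvalues; case: xgetP => [? _ //|] /(_ s)[].
suff E : eigenvalues A = s by rewrite E; split=> //; exists U.
apply: val_inj; apply: (sorted_eq (@ge_trans _ R) (@ge_anti _ R) sA ss).
by apply: prod_XsubC_eq; rewrite -cE.
Qed.

Lemma trace_exp_eigenvalues n (A : 'M[R]_n.+1) k : A^T = A ->
  \tr (A ^+ k) = \sum_i tnth (eigenvalues A) i ^+ k.
Proof.
by move=> /eigenvalues_diagonalizes[_ [U dA]]; exact: trace_exp_diagonalizes dA.
Qed.

Lemma eigenvalues_interlacing n (A B : 'M[R]_n) k (i j : 'I_n) :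
  A^T = A -> B^T = B -> (\rank (A - B)%R <= k)%N -> (i + k = j)%N ->
  tnth (eigenvalues A) j <= tnth (eigenvalues B) i.
Proof.
move=> /eigenvalues_diagonalizes[sA [U dA]] /eigenvalues_diagonalizes[sB [V dB]].
exact: (rank_interlacing sA sB dA dB).
Qed.

Let ge0_integral_esd n (A : 'M[R]_n) (g : R -> R) : measurable_fun setT g ->
  (forall x, 0 <= g x) ->
  (\int[esd A]_x (g x)%:E = (n%:R^-1 * \sum_i g (tnth (eigenvalues A) i))%:E)%E.
Proof.
move=> mg g0; have mg' : measurable_fun setT (EFin \o g) by exact/measurable_EFinP.
rewrite /esd ge0_integral_mscale//; last by move=> x _; rewrite lee_fin.
rewrite ge0_integral_measure_sum//; last by move=> x _; rewrite lee_fin.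
rewrite EFinM; congr (_ * _)%E.
rewrite -sumEFin; apply: eq_bigr => i _.
by rewrite integral_dirac// diracT mul1e (tnth_nth 0).
Qed.

Lemma Rintegral_esd n (A : 'M[R]_n) (f : R -> R) : measurable_fun setT f ->
  \int[esd A]_x f x = n%:R^-1 * \sum_i f (tnth (eigenvalues A) i).
Proof.
move=> mf.
have mp : measurable_fun setT (fun y => Num.max (f y) 0) by exact: measurable_maxr.
have mn : measurable_fun setT (fun y => Num.max (- f y) 0).
  by apply: measurable_maxr => //; exact: measurable_funN.
rewrite /Rintegral integralE.
under eq_integral do rewrite funeposE -EFin_max.
under [X in (_ - X)%E]eq_integral do rewrite funenegE -EFinN -EFin_max.
rewrite !ge0_integral_esd//; try by move=> x; rewrite le_max lexx orbT.
rewrite -EFinB /= -mulrBr -sumrB; congr (_ * _); apply: eq_bigr => i _.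
by case: (leP 0 (f _)) => H1; case: (leP 0 (- f _)) => H2; lra.
Qed.

End empirical_spectrum.

(** * Moments of the semicircle law *)

Section segner.
Variables (R : comNzRingType) (s : nat -> nat -> R).
Hypotheses (s00 : forall k, s k 0%N = 0) (s0 : forall j, s 0%N j = (j == 1%N)%:R).
Hypothesis sS : forall k j, s k.+1 j.+1 = s k j.+2 + s k j.

(** [s k j] counts the walks of [k] steps from height [j - 1] to [0] that stay
    nonnegative; a walk from height [j] is cut at its first visit to [j - 1]. *)
Lemma first_passage k j : s k j.+2 = \sum_(a < k) s a 1%N * s (k.-1 - a)%N j.+1.
Proof.
elim: k j => [|k IH] j; first by rewrite s0 big_ord0.
rewrite sS big_ord_recr/= subnn s0 eqSS.
have E : \sum_(a < k) s a 1%N * s (k - a)%N j.+1 =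
    s k j.+3 + \sum_(a < k) s a 1%N * s (k.-1 - a)%N j.
  rewrite IH -big_split/=; apply: eq_bigr => a _.
  have -> : (k - a = (k.-1 - a).+1)%N by have := ltn_ord a; lia.
  by rewrite sS mulrDr.
rewrite E -addrA; congr (_ + _); case: j {E} => [|j].
  by rewrite mulr1 big1 ?add0r// => a _; rewrite s00 mulr0.
by rewrite mulr0 addr0 IH.
Qed.

Lemma segner_recursion k : s k.+1 1%N = \sum_(a < k) s a 1%N * s (k.-1 - a)%N 1%N.
Proof. by rewrite sS s00 addr0 first_passage. Qed.

End segner.

Section semicircle_integrals.
Variable R : realType.
Notation mu := (@lebesgue_measure R).
Implicit Types f g : R -> R.

Let mid : measurable_fun setT (idfun : measurableTypeR R -> R).
Proof. by move=> _ B mB; rewrite setTI. Qed.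

Let mpdf : measurable_fun setT (semicircle_pdf 1 : measurableTypeR R -> R).
Proof. exact: measurable_semicircle_pdf. Qed.

Let scE B : measurable B -> semicircle 1 B =
  (\int[mu]_(x in idfun @^-1` B) (semicircle_pdf 1 x)%:E)%E.
Proof. by []. Qed.

Let arc (x : R) := (2 * pi)^-1 * Num.sqrt (4 - x ^+ 2).

Let continuous_arc : continuous arc.
Proof.
move=> x; apply: cvgM; first exact: cvg_cst.
apply: (cvg_comp (fun x : R => 4 - x ^+ 2) Num.sqrt); last exact: sqrt_continuous.
by apply: cvgB; [exact: cvg_cst | exact: exprn_continuous].
Qed.

Let semicircle_pdfE x :
  semicircle_pdf 1 x = (arc \_ `[(-2), 2]) x.
Proof.
rewrite /semicircle_pdf patchE indicE /arc !expr1n !mulr1.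
by case: ifP => _; rewrite ?mulr1 ?mulr0.
Qed.

Let integrable_arc f : continuous f ->
  mu.-integrable `[(-2), 2] (EFin \o (fun x => f x * arc x)).
Proof.
move=> cf; apply: continuous_compact_integrable; first exact: segment_compact.
apply: continuous_subspaceT => x.
by apply: cvgM; [exact: cf | exact: continuous_arc].
Qed.

Let mul_pdf f : (fun x => (f x * semicircle_pdf 1 x)%:E) =
  (EFin \o (fun x => f x * arc x)) \_ `[(-2), 2].
Proof.
apply/funext => x; rewrite semicircle_pdfE !patchE.
by case: ifP => // _; rewrite mulr0.
Qed.

Lemma integrable_semicircle f : continuous f ->
  (semicircle 1).-integrable setT (EFin \o f).
Proof.
move=> cf; have mf := continuous_measurable_fun cf.
have [+ _] := integrable_density mid mpdf (semicircle_pdf_ge0 1) scE mf.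
apply; rewrite mul_pdf.
have mD : measurable (`[(-2), 2]%classic : set (measurableTypeR R)).
  exact: measurable_itv.
exact: ((integrable_mkcond _ mD).1 (integrable_arc cf)).
Qed.

Local Notation I h := (\int[mu]_(x in `[0%R, pi]) h x).

Lemma integrable_0pi h : continuous h -> mu.-integrable `[0, pi] (EFin \o h).
Proof.
move=> ch; apply: continuous_compact_integrable; first exact: segment_compact.
exact: continuous_subspaceT.
Qed.

Let continuous_2cos : continuous (fun t : R => 2 * cos t).
Proof. by move=> x; apply: cvgM; [exact: cvg_cst | exact: continuous_cos]. Qed.

(** The substitution [x = 2 cos t]. *)
Lemma Rintegral_semicircle f : continuous f ->
  \int[semicircle 1]_x f x =
  I (fun t => 2 / pi * (f (2 * cos t) * (sin t * sin t))).
Proof.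
move=> cf; have mf := continuous_measurable_fun cf.
rewrite (Rintegral_density mid mpdf (semicircle_pdf_ge0 1) scE mf
  (integrable_semicircle cf)).
transitivity (\int[mu]_(x in `[(-2)%R, 2]) (f x * arc x)).
  rewrite [RHS]Rintegral_mkcond; apply: eq_Rintegral => x _.
  by rewrite semicircle_pdfE !patchE; case: ifP; rewrite ?mulr0.
pose F (t : R) := 2 * cos t.
have dF t : is_derive t (1 : R) F (- (2 * sin t)).
  by apply: is_derive_eq; rewrite /GRing.scale/=; ring.
have F'E : derive1 F = fun t => - (2 * sin t).
  by apply/funext => t; rewrite derive1E; have [_ ->] := dF t.
have c2sin : continuous (fun t : R => - (2 * sin t)).
  by move=> t; apply: cvgN; apply: cvgM; [exact: cvg_cst | exact: continuous_sin].
rewrite /Rintegral; congr fine.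
have F0 : F 0 = 2 by rewrite /F cos0 mulr1.
have Fpi : F pi = -2 by rewrite /F cospi mulrN1.
transitivity (\int[mu]_(x in `[F pi, (F 0)%R]) (f x * arc x)%:E)%E.
  by rewrite F0 Fpi.
rewrite (@integration_by_substitution_decreasing _ F (fun x => f x * arc x) 0 pi)//.
- apply: eq_integral => t; rewrite inE/= in_itv/= => /andP[t0 tpi].
  rewrite F'E !fctE opprK /arc /F exprMn.
  have -> : 4 - 2 ^+ 2 * cos t ^+ 2 = (2 * sin t) ^+ 2 :> R.
    by rewrite exprMn sin2cos2; ring.
  rewrite sqrtr_sqr ger0_norm ?mulr_ge0// ?sin_ge0_pi ?t0//.
  by congr EFin; move: (pi : R) (lt0r_neq0 (pi_gt0 R)) => p p0; field.
- exact: pi_ge0.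
- move=> x y xi yi xy; rewrite /F ltr_pM2l// ltr_cos//.
- by rewrite F'E => x _; exact: c2sin.
- by rewrite F'E; apply: cvgP; apply: cvg_at_right_filter; exact: c2sin.
- by rewrite F'E; apply: cvgP; apply: cvg_at_left_filter; exact: c2sin.
- split => [x _||]; first by have [] := dF x.
    by apply: cvg_at_right_filter; exact: continuous_2cos.
  by apply: cvg_at_left_filter; exact: continuous_2cos.
- apply: continuous_subspaceT => x.
  by apply: cvgM; [exact: cf | exact: continuous_arc].
Qed.

Let sin_natpi m : sin (m%:R * pi) = 0 :> R.
Proof.
by elim: m => [|m IH]; rewrite ?mul0r ?sin0// -natr1 mulrDl mul1r sinDpi IH oppr0.
Qed.

Let integral_cos m : I (fun t => cos (m%:R * t)) = (m == 0%N)%:R * pi.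
Proof.
have ccos a : continuous (fun t : R => cos (a * t)).
  move=> t; apply: (cvg_comp ( *%R a) cos); last exact: continuous_cos.
  by apply: cvgM; [exact: cvg_cst | exact: cvg_id].
case: m => [|m].
  under eq_Rintegral do rewrite mul0r cos0.
  by rewrite Rintegral_cst//= lebesgue_measure_itv/= lte_fin pi_gt0/= subr0.
pose F (t : R) := m.+1%:R^-1 * sin (m.+1%:R * t).
have dF t : is_derive t (1 : R) F (cos (m.+1%:R * t)).
  have dg : is_derive t (1 : R) (fun t => m.+1%:R * t) m.+1%:R.
    by apply: is_derive_eq; rewrite /GRing.scale/=; ring.
  have := is_derive1_comp (is_derive_sin (m.+1%:R * t)) dg => dsg.
  apply: (is_derive_eq (is_deriveZ m.+1%:R^-1 dsg)); rewrite /GRing.scale/=.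
  by rewrite mulrCA mulVf ?mulr1// pnatr_eq0.
have cF : continuous F.
  by move=> t; apply/differentiable_continuous/derivable1_diffP; have [] := dF t.
rewrite mul0r /Rintegral (@continuous_FTC2 _ _ F)//=.
- by rewrite /F mulr0 sin0 sin_natpi mulr0 subrr.
- exact: pi_gt0.
- exact: continuous_subspaceT.
- split => [x _||]; first by have [] := dF x.
    by apply: cvg_at_right_filter; exact: cF.
  by apply: cvg_at_left_filter; exact: cF.
- by move=> t _; rewrite derive1E; have [_ ->] := dF t.
Qed.

(** Coefficients of [(2 cos t) ^ k sin t] on the sines. *)
Let sine_coef k j := 2 / pi * I (fun t => (2 * cos t) ^+ k * (sin (j%:R * t) * sin t)).

Let continuous_sinM a : continuous (fun t : R => sin (a * t)).
Proof.
move=> t; apply: (cvg_comp ( *%R a) sin); last exact: continuous_sin.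
by apply: cvgM; [exact: cvg_cst | exact: cvg_id].
Qed.

Let integrable_sine_coef k j : mu.-integrable `[0, pi]
  (EFin \o (fun t => (2 * cos t) ^+ k * (sin (j%:R * t) * sin t))).
Proof.
apply: integrable_0pi => t; apply: cvgM.
  apply: (cvg_comp (fun t : R => 2 * cos t) (fun x => x ^+ k)).
    exact: continuous_2cos.
  exact: exprn_continuous.
by apply: cvgM; [exact: continuous_sinM | exact: continuous_sin].
Qed.

Let sine_coef_0l k : sine_coef k 0 = 0.
Proof.
rewrite /sine_coef; under eq_Rintegral do rewrite mul0r sin0 mul0r mulr0.
by rewrite Rintegral_cst// mul0r mulr0.
Qed.

Let sine_coef_0r j : sine_coef 0 j = (j == 1%N)%:R.
Proof.
case: j => [|j]; first exact: sine_coef_0l.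
have ci m : mu.-integrable `[0, pi] (EFin \o (fun t => 2^-1 * cos (m%:R * t))).
  apply: integrable_0pi => t; apply: cvgM; first exact: cvg_cst.
  apply: (cvg_comp ( *%R m%:R) cos); last exact: continuous_cos.
  by apply: cvgM; [exact: cvg_cst | exact: cvg_id].
have ci' m : mu.-integrable `[0, pi] (EFin \o (fun t => cos (m%:R * t))).
  apply: integrable_0pi => t.
  apply: (cvg_comp ( *%R m%:R) cos); last exact: continuous_cos.
  by apply: cvgM; [exact: cvg_cst | exact: cvg_id].
rewrite /sine_coef.
transitivity (2 / pi * I (fun t => 2^-1 * cos (j%:R * t) - 2^-1 * cos (j.+2%:R * t))).
  congr (_ * _); apply: eq_Rintegral => t _; rewrite expr0 mul1r.
  have -> : j%:R * t = j.+1%:R * t - t by rewrite -natr1; ring.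
  have -> : j.+2%:R * t = j.+1%:R * t + t by rewrite -[in LHS]natr1; ring.
  by rewrite cosB cosD; field.
rewrite RintegralB// !RintegralZl// !integral_cos mul0r mulr0 subr0 eqSS.
by move: (pi : R) (lt0r_neq0 (pi_gt0 R)) => p p0; field.
Qed.

Let sine_coef_S k j : sine_coef k.+1 j.+1 = sine_coef k j.+2 + sine_coef k j.
Proof.
rewrite /sine_coef -mulrDr -RintegralD//; congr (_ * _).
apply: eq_Rintegral => t _; rewrite exprSr -mulrDr -mulrA -mulrDl; congr (_ * _).
rewrite mulrA; congr (_ * _).
have -> : j.+2%:R * t = j.+1%:R * t + t by rewrite -[in LHS]natr1; ring.
have -> : j%:R * t = j.+1%:R * t - t by rewrite -natr1; ring.
by rewrite sinD sinB; ring.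
Qed.

Definition semicircle_moment k : R := \int[semicircle 1]_x x ^+ k.

Let semicircle_momentE k : semicircle_moment k = sine_coef k 1.
Proof.
rewrite /semicircle_moment Rintegral_semicircle; last exact: exprn_continuous.
have := integrable_sine_coef k 1.
rewrite /sine_coef -RintegralZl// => _.
by apply: eq_Rintegral => t _; rewrite mul1r.
Qed.

Lemma semicircle_moment0 : semicircle_moment 0 = 1.
Proof. by rewrite semicircle_momentE sine_coef_0r. Qed.

Lemma semicircle_moment_rec k : semicircle_moment k.+1 =
  \sum_(a < k) semicircle_moment a * semicircle_moment (k.-1 - a)%N.
Proof.
rewrite semicircle_momentE (segner_recursion sine_coef_0l sine_coef_0r sine_coef_S).
by apply: eq_bigr => a _; rewrite !semicircle_momentE.
Qed.

(** The semicircle law lives on [-2, 2]. *)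
Lemma eq_Rintegral_semicircle f g : continuous f -> continuous g ->
  (forall x, -2 <= x <= 2 -> f x = g x) ->
  \int[semicircle 1]_x f x = \int[semicircle 1]_x g x.
Proof.
move=> cf cg fg; rewrite !Rintegral_semicircle//; apply: eq_Rintegral => t _.
rewrite fg// -ler_norml normrM ger0_norm// -[leRHS]mulr1 ler_wpM2l//.
exact: cos_max.
Qed.

End semicircle_integrals.

(** * Weierstrass approximation *)

Section weierstrass.
Variable R : realType.

(** The Bernstein operators, evaluated at a point [t]: [bernstein n g t] is the
    expectation of [g] at a binomial variable of parameters [n] and [t]; the
    recursion conditions on the first trial. *)
Fixpoint bernstein (n : nat) (g : nat -> R) : {poly R} :=
  if n is m.+1 then
    'X * bernstein m (fun k => g k.+1) + (1 - 'X) * bernstein m g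
  else (g 0%N)%:P.

Lemma bernstein_cst n c : bernstein n (fun _ => c) = c%:P.
Proof. by elim: n => //= n ->; ring. Qed.

Lemma bernsteinD n g h :
  bernstein n (fun k => g k + h k) = bernstein n g + bernstein n h.
Proof.
elim: n g h => [|n IH] g h /=; first by rewrite polyCD.
by rewrite (IH g h) (IH (fun k => g k.+1)); ring.
Qed.

Lemma bernsteinZ n c g : bernstein n (fun k => c * g k) = c%:P * bernstein n g.
Proof.
elim: n g => [|n IH] g /=; first by rewrite polyCM.
by rewrite (IH g) (IH (fun k => g k.+1)); ring.
Qed.

Lemma bernstein_le n g h t : 0 <= t <= 1 -> (forall k, (k <= n)%N -> g k <= h k) ->
  (bernstein n g).[t] <= (bernstein n h).[t].
Proof.
move=> /andP[t0 t1]; elim: n g h => [|n IH] g h gh /=; first by rewrite !hornerC gh.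
rewrite !hornerE lerD// ler_wpM2l ?subr_ge0// IH// => k kn; apply: gh => //.
exact: leqW.
Qed.

Lemma bernstein_variance n a t :
  (bernstein n (fun k => (k%:R - a) ^+ 2)).[t] =
  n%:R * (t * (1 - t)) + (n%:R * t - a) ^+ 2.
Proof.
elim: n a => [|n IH] a /=; first by rewrite hornerC; ring.
have E : (fun k : nat => (k.+1%:R - a) ^+ 2) = (fun k => (k%:R - (a - 1)) ^+ 2).
  by apply/funext => k; rewrite -natr1; congr (_ ^+ 2); ring.
rewrite E -polyC1 !(hornerD, hornerN, hornerM, hornerX, hornerC) !IH -natr1; ring.
Qed.

(** A form of uniform continuity on a segment that Bernstein operators can be
    applied to: the quadratic term becomes the variance of a binomial law.
    Otherwise some pairs [(x, y)] would satisfy [|x - y| -> 0] and accumulate at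
    a point where [f] is not continuous. *)
Lemma quadratic_modulus (f : R -> R) (K e : R) : continuous f -> 0 < K -> 0 < e ->
  exists2 A : R, 0 <= A & forall x y, -K <= x <= K -> -K <= y <= K ->
    `|f x - f y| <= e + A * (x - y) ^+ 2.
Proof.
move=> cf K0 e0; apply: contrapT => /forall2NP H.
have /choice[xy xyP] (n : nat) : exists xy : R * R,
    [/\ -K <= xy.1 <= K, -K <= xy.2 <= K &
        e + n%:R * (xy.1 - xy.2) ^+ 2 < `|f xy.1 - f xy.2| ].
  have [|/existsNP[x /existsNP[y /not_implyP[xK /not_implyP[yK]]]]] := H n%:R.
    by rewrite ler0n.
  by move=> /negP; rewrite -ltNge => lt; exists (x, y).
have KK : -K <= K by rewrite ge0_cp// ltW.
have [c _ cmax] := EVT_max KK (continuous_subspaceT cf).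
have [c' _ cmin] := EVT_min KK (continuous_subspaceT cf).
pose M := f c - f c'.
have fM x y : -K <= x <= K -> -K <= y <= K -> `|f x - f y| <= M.
  move=> xK yK; rewrite ler_norml /M.
  by have := cmax x xK; have := cmin x xK; have := cmax y yK; have := cmin y yK; lra.
have [|h hincr hcvg] := @bolzano_weierstrass R (fun n => (xy n).1).
  exists K; split; first exact: num_real.
  move=> z Kz n _ /=; have [/andP[a b] _ _] := xyP n.
  by rewrite (le_trans _ (ltW Kz))// ler_norml a b.
pose u n := (xy (h n)).1; pose v n := (xy (h n)).2.
have hn n : (n <= h n)%N.
  elim: n => // n IH; rewrite (leq_ltn_trans IH)//.
  by rewrite ltnNge -leEnat hincr -ltnNge.
have [l ul] : exists l : R, u n @[n --> \oo] --> l.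
  by move/cvg_ex: hcvg => [l hl]; exists l; exact: hl.
have duv : (u n - v n) ^+ 2 @[n --> \oo] --> 0.
  apply/cvgr0Pnorm_le => d d0; near=> n.
  have [xK yK lt] := xyP (h n).
  have n0 : 0 < (h n)%:R :> R.
    by rewrite ltr0n (leq_trans _ (hn n))//; near: n; exists 1%N.
  have le1 : (h n)%:R * (u n - v n) ^+ 2 <= M.
    apply: le_trans (fM _ _ xK yK); apply: le_trans (ltW lt).
    by rewrite lerDr ltW.
  have le2 : M <= d * (h n)%:R.
    rewrite -ler_pdivrMl// (le_trans (ltW (Num.Theory.truncnS_gt _)))// ler_nat.
    by rewrite (leq_trans _ (hn n))//; near: n; exists (Num.truncn (d^-1 * M)).+1.
  rewrite ger0_norm ?sqr_ge0// -(ler_pM2l n0) (le_trans le1)//.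
  by rewrite mulrC.
have vl : v n @[n --> \oo] --> l.
  have d0 : u n - v n @[n --> \oo] --> 0.
    apply/cvgr0Pnorm_le => d d0.
    have /cvgr0Pnorm_le/(_ (d ^+ 2)) := duv; rewrite exprn_gt0// => /(_ isT).
    apply: filterS => n; rewrite normrX ler_pXn2r// nnegrE//; exact: ltW.
  rewrite (_ : v = fun n => u n - (u n - v n)); last first.
    by apply/funext => n; rewrite opprB addrC subrK.
  by rewrite -[l]subr0; exact: cvgB.
have fuv : `|f (u n) - f (v n)| @[n --> \oo] --> `|f l - f l|.
  apply: cvg_norm; apply: cvgB; apply: continuous_cvg => //; exact: cf.
rewrite subrr normr0 in fuv.
have : \forall n \near \oo, `|f (u n) - f (v n)| < e.
  by move/cvgr0Pnorm_lt/(_ e e0): fuv; apply: filterS => n; rewrite normr_id.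
move=> [N _ /(_ N (leqnn N))] /=; apply/negP; rewrite -leNgt.
have [_ _ lt] := xyP (h N); apply: le_trans (ltW lt).
by rewrite lerDl mulr_ge0// sqr_ge0.
Unshelve. all: by end_near. Qed.

(** The Bernstein operator is monotone and fixes constants, so it moves [f] by at
    most the modulus of continuity [e / 2] plus the variance term, which tends
    to 0. *)
Lemma weierstrass_approximation (f : R -> R) (K e : R) : continuous f -> 0 < e ->
  exists p : {poly R}, forall x, -K <= x <= K -> `|f x - p.[x]| <= e.
Proof.
move=> cf e0; wlog K0 : K / 0 < K => [H|].
  have [p pP] := H _ (ltr_pwDl ltr01 (normr_ge0 K)).
  exists p => x xK; apply: pP; rewrite -ler_norml (le_trans (y := `|K|))//.
    by rewrite (le_trans _ (ler_norm K))// ler_norml.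
  by rewrite lerDr.
have e20 : 0 < e / 2 by rewrite divr_gt0.
have [A A0 AP] := quadratic_modulus cf K0 e20.
have K20 : 2 * K != 0 by rewrite mulf_neq0 ?gt_eqF.
have [n n0 nP] : exists2 n, (0 < n)%N & A * (2 * K) ^+ 2 / n%:R <= e / 2.
  pose m := (Num.truncn (A * (2 * K) ^+ 2 / (e / 2))).+1.
  exists m => //; rewrite ler_pdivrMr ?ltr0n// -ler_pdivrMl// mulrC.
  exact: ltW (Num.Theory.truncnS_gt _).
have nR0 : n%:R != 0 :> R by rewrite pnatr_eq0 -lt0n.
pose y k := 2 * K * (k%:R / n%:R) - K.
pose g k := f (y k).
pose tau : {poly R} := ((2 * K)^-1)%:P * ('X + K%:P).
exists (bernstein n g \Po tau) => x xK; rewrite horner_comp.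
have tauE : tau.[x] = (x + K) / (2 * K) by rewrite /tau !hornerE mulrC.
move: tauE; set t := tau.[x] => tE.
have t01 : 0 <= t <= 1.
  have /andP[x1 x2] := xK; rewrite tE; apply/andP; split.
    by rewrite divr_ge0; lra.
  by rewrite ler_pdivrMr; lra.
have xE : x = 2 * K * t - K by rewrite tE mulrC divfK//; ring.
have yK k : (k <= n)%N -> -K <= y k <= K.
  move=> kn; have k1 : 0 <= (k%:R / n%:R : R) <= 1.
    by rewrite divr_ge0//= ler_pdivrMr ?ltr0n// mul1r ler_nat.
  have /andP[a b] := k1; rewrite /y; apply/andP; split.
    by rewrite lerBrDr addNr mulr_ge0// ltW// mulr_gt0.
  rewrite lerBlDr (le_trans (ler_wpM2l _ b))//; first by rewrite ltW// mulr_gt0.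
  by rewrite mulr1 mulr2n mulrDl mul1r.
pose c := A * (2 * K / n%:R) ^+ 2.
pose err k := c * (k%:R - n%:R * t) ^+ 2.
have errE k : A * (x - y k) ^+ 2 = err k.
  by rewrite /err /c xE /y; field.
have dist k : (k <= n)%N -> `|f x - g k| <= e / 2 + err k.
  by move=> kn; rewrite -errE; apply: AP => //; exact: yK.
pose Bt h := (bernstein n h).[t].
have Berr : Bt err <= e / 2.
  rewrite /Bt /err bernsteinZ hornerM hornerC bernstein_variance subrr expr0n addr0.
  apply: le_trans nP; rewrite /c.
  have -> : A * (2 * K / n%:R) ^+ 2 * (n%:R * (t * (1 - t))) =
      A * (2 * K) ^+ 2 / n%:R * (t * (1 - t)) by field.
  rewrite ler_piMr//.
    by apply: divr_ge0 => //; apply: mulr_ge0 => //; exact: sqr_ge0.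
  by have /andP[a b] := t01; rewrite mulr_ile1; lra.
have Bc a : Bt (fun _ => a) = a by rewrite /Bt bernstein_cst hornerC.
have BD h1 h2 : Bt (fun k => h1 k + h2 k) = Bt h1 + Bt h2.
  by rewrite /Bt bernsteinD hornerD.
have up : Bt g <= f x + e.
  have : Bt g <= Bt (fun k => (f x + e / 2) + err k).
    apply: bernstein_le => // k kn; have := dist k kn.
    by rewrite ler_norml; lra.
  by rewrite BD Bc; lra.
have lo : f x <= Bt g + e.
  have : Bt (fun _ => f x) <= Bt (fun k => (g k + e / 2) + err k).
    apply: bernstein_le => // k kn; have := dist k kn.
    by rewrite ler_norml; lra.
  by rewrite BD BD !Bc; lra.
by rewrite ler_norml -/(Bt g); lra.
Qed.

End weierstrass.

(** * From moments to weak convergence, up to interlacing *)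

Section clamp.
Variable R : realType.
Implicit Types (f g : R -> R) (K x y : R).

Definition clamp K x := Num.max (- K) (Num.min x K).

Lemma clamp_itv K x : 0 <= K -> - K <= clamp K x <= K.
Proof.
move=> K0; rewrite /clamp le_max lexx ge_max ge_min lexx orbT andbT/=.
by rewrite (le_trans _ K0)// oppr_le0.
Qed.

Lemma clampE K x : - K <= x <= K -> clamp K x = x.
Proof. by move=> /andP[a b]; rewrite /clamp min_l// max_r. Qed.

Lemma clamp_le K x y : x <= y -> clamp K x <= clamp K y.
Proof.
move=> xy; rewrite /clamp ge_max le_max lexx/= le_max; apply/orP; right.
by rewrite le_min !ge_min xy lexx !orbT.
Qed.

Lemma clamp_dist K x y : `|clamp K x - clamp K y| <= `|x - y|.
Proof.
have := ler_norm (x - y); have := ler_norm (y - x); rewrite [`|y - x|]distrC.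
move: `|x - y| => e xy yx; rewrite ler_norml /clamp.
by case: (leP x K) => ?; case: (leP y K) => ?;
  case: (leP (- K) x) => ?; case: (leP (- K) y) => ?; case: (leP (- K) K) => ?;
  apply/andP; split; lra.
Qed.

Lemma continuous_clamp K : continuous (clamp K).
Proof.
move=> x; apply/cvgrPdist_le => e e0; near=> y.
by apply: le_trans (clamp_dist K x y) _; near: y; exact: cvgr_dist_le.
Unshelve. all: by end_near.
Qed.

Lemma continuous_comp_clamp f K : continuous f -> continuous (f \o clamp K).
Proof.
by move=> cf x; apply: continuous_comp; [exact: continuous_clamp | exact: cf].
Qed.

Lemma Rintegral_semicircle_le f g : continuous f -> continuous g ->
  (forall x, -2 <= x <= 2 -> f x <= g x) ->
  \int[semicircle 1]_x f x <= \int[semicircle 1]_x g x.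
Proof.
move=> cf cg fg.
have E h : continuous h ->
    \int[semicircle 1]_x h x = \int[semicircle 1]_x (h \o clamp 2) x.
  move=> ch; apply: eq_Rintegral_semicircle => //; first exact: continuous_comp_clamp.
  by move=> x x2; rewrite /= clampE.
rewrite (E f)// (E g)//; apply: le_Rintegral => //.
- by apply: integrable_semicircle; exact: continuous_comp_clamp.
- by apply: integrable_semicircle; exact: continuous_comp_clamp.
- by move=> x _; apply: fg; exact: clamp_itv.
Qed.

Lemma Rintegral_semicircle_cst c : \int[semicircle 1]_x c = c :> R.
Proof.
have := @semicircle_moment0 R; rewrite /semicircle_moment => E.
transitivity (\int[semicircle 1]_x (c * x ^+ 0) : R).
  by apply: eq_Rintegral => x _; rewrite expr0 mulr1.
rewrite RintegralZl// ?E ?mulr1//.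
by apply: integrable_semicircle; exact: exprn_continuous.
Qed.

Lemma Rintegral_semicircle_dist f g e : continuous f -> continuous g ->
  (forall x, -2 <= x <= 2 -> `|f x - g x| <= e) ->
  `|\int[semicircle 1]_x f x - \int[semicircle 1]_x g x| <= e.
Proof.
move=> cf cg fg.
have ce : continuous (cst e : R -> R) by exact: cst_continuous.
have le f1 g1 : continuous f1 -> continuous g1 ->
    (forall x, -2 <= x <= 2 -> f1 x <= g1 x + e) ->
    \int[semicircle 1]_x f1 x <= \int[semicircle 1]_x g1 x + e.
  move=> cf1 cg1 H; rewrite -[X in _ + X]Rintegral_semicircle_cst -RintegralD//;
    try exact: integrable_semicircle.
  apply: Rintegral_semicircle_le => // x.
  by apply: cvgD; [exact: cg1 | exact: ce].
have := le f g cf cg; have := le g f cg cf.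
rewrite ler_norml => H1 H2; apply/andP; split.
  rewrite lerBrDr addrC lerBlDr; apply: H1 => x /fg; rewrite ler_norml; lra.
rewrite lerBlDl; apply: H2 => x /fg; rewrite ler_norml; lra.
Qed.

End clamp.

Section averages.
Variable R : realType.
Implicit Types (f g : R -> R) (p : {poly R}).

Definition average n (t : n.-tuple R) f : R := n%:R^-1 * \sum_i f (tnth t i).

Lemma averageD n (t : n.-tuple R) f g :
  average t (fun x => f x + g x) = average t f + average t g.
Proof. by rewrite /average -mulrDr -big_split. Qed.

Lemma averageZ n (t : n.-tuple R) c f :
  average t (fun x => c * f x) = c * average t f.
Proof. by rewrite /average -mulr_sumr mulrCA. Qed.

Lemma average_le n (t : n.-tuple R) f g : (forall x, f x <= g x) ->
  average t f <= average t g.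
Proof.
by move=> fg; rewrite /average ler_wpM2l ?invr_ge0// ler_sum.
Qed.

Lemma average_cst n (t : n.-tuple R) c : (0 < n)%N -> average t (fun _ => c) = c.
Proof.
move=> n0; rewrite /average sumr_const card_ord -[c *+ n]mulr_natl mulKf//.
by rewrite pnatr_eq0 -lt0n.
Qed.

Lemma average_dist n (t : n.-tuple R) f g h e : (0 < n)%N ->
  (forall x, `|f x - g x| <= e + h x) ->
  `|average t f - average t g| <= e + average t h.
Proof.
move=> n0 fg; rewrite -[X in _ <= X + _](average_cst t e n0) -averageD.
have -> : average t f - average t g = average t (fun x => f x - g x).
  by rewrite averageD -[X in _ - X]mul1r -mulNr -averageZ; congr (_ + average t _);
     apply/funext => x; rewrite mulN1r.
rewrite ler_norml; apply/andP; split.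
  rewrite lerNl -mulN1r -averageZ; apply: average_le => x.
  by have := fg x; rewrite ler_norml; lra.
by apply: average_le => x; have := fg x; rewrite ler_norml; lra.
Qed.

Lemma average_norm_le n (t : n.-tuple R) f M : (0 < n)%N ->
  (forall x, `|f x| <= M) -> `|average t f| <= M.
Proof.
move=> n0 fM; rewrite ler_norml; apply/andP; split.
  rewrite -(average_cst t (- M) n0); apply: average_le => x.
  by have := fM x; rewrite ler_norml; lra.
rewrite -[leRHS](average_cst t M n0); apply: average_le => x.
by have := fM x; rewrite ler_norml; lra.
Qed.

(** The shift by two places is the one that a perturbation of rank two causes. *)
Definition interlaced n (s t : n.-tuple R) : Prop := forall i j : 'I_n,
  (i + 2 = j)%N -> tnth s j <= tnth t i /\ tnth t j <= tnth s i.

Let shifted_sum n (g : nat -> R) M : (forall i, `|g i| <= M) ->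
  \sum_(i < n) (if (i < 2)%N then M else g (i - 2)%N) <= \sum_(i < n) g i + 4 * M.
Proof.
move=> gM; have M0 : 0 <= M := le_trans (normr_ge0 _) (gM 0%N).
have gM' i : - M <= g i by have := gM i; rewrite ler_norml => /andP[].
case: n => [|[|n]].
- by rewrite !big_ord0 add0r mulr_ge0.
- by rewrite !big_ord_recl !big_ord0 /=; have := gM' 0%N; lra.
rewrite big_ord_recl [in X in X <= _]big_ord_recl/= [X in _ <= X + _]big_ord_recr/=.
rewrite [X in _ <= X + _ + _]big_ord_recr/=.
have -> : \sum_(i < n) (if (bump 0 (bump 0 i) < 2)%N then M
    else g (bump 0 (bump 0 i) - 2)%N) = \sum_(i < n) g i.
  by apply: eq_bigr => i _; rewrite /bump !leq0n !add1n/= !subSS subn0.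
by have := gM' n; have := gM' n.+1; lra.
Qed.

(** Interlacing shifts the list by two places: for a monotone function it
    changes the sum by boundary terms only. *)
Lemma interlaced_monotone n (s t : n.-tuple R) f M : interlaced s t ->
  (forall x, `|f x| <= M) -> (forall x y, x <= y -> f x <= f y) ->
  `|average s f - average t f| <= 4 * M / n%:R.
Proof.
move=> st fM fmon.
have le (s1 t1 : n.-tuple R) : (forall i j : 'I_n, (i + 2 = j)%N ->
    tnth s1 j <= tnth t1 i) ->
    \sum_i f (tnth s1 i) <= \sum_i f (tnth t1 i) + 4 * M.
  move=> H; pose g i := f (nth 0 t1 i).
  have -> : \sum_i f (tnth t1 i) = \sum_(i < n) g i.
    by apply: eq_bigr => i _; rewrite (tnth_nth 0).
  apply: le_trans (shifted_sum n (g := g) (fun i => fM _)).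
  apply: ler_sum => i _; case: ltnP => i2.
    by have := fM (tnth s1 i); rewrite ler_norml => /andP[].
  have lt : (i - 2 < n)%N by rewrite (leq_ltn_trans (leq_subr _ _)).
  have := H (Ordinal lt) i; rewrite /= subnK// => /(_ erefl) le.
  by rewrite /g -[nth _ _ _](tnth_nth 0 t1 (Ordinal lt)) fmon.
rewrite /average -mulrBr normrM ger0_norm ?invr_ge0// mulrC.
rewrite ler_wpM2r ?invr_ge0//.
have := le s t (fun i j ij => (st i j ij).1).
have := le t s (fun i j ij => (st i j ij).2).
by rewrite ler_norml; lra.
Qed.

(** A function of Lipschitz constant [L] is the difference of the monotone
    functions [phi x + L x] and [L x]. *)
Lemma interlaced_lipschitz (phi : R -> R) K L : 0 <= K -> 0 <= L ->
  (forall x y, -K <= x -> x <= y -> y <= K -> `|phi y - phi x| <= L * (y - x)) ->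
  exists C, forall n (s t : n.-tuple R), interlaced s t ->
    `|average s (phi \o clamp K) - average t (phi \o clamp K)| <= C / n%:R.
Proof.
move=> K0 L0 lip; pose M := `|phi 0| + 2 * L * K.
have KK := clamp_itv _ K0.
pose g x := phi (clamp K x) + L * clamp K x.
have phiM x : `|phi (clamp K x)| <= `|phi 0| + L * K.
  have /andP[a b] := KK x.
  rewrite -[phi (clamp K x)](subrK (phi 0)) addrC.
  rewrite (le_trans (ler_normD _ _))// lerD2l.
  case: (leP 0 (clamp K x)) => c0.
    apply: le_trans (lip _ _ _ _ _) _ => //; first by rewrite oppr_le0.
    by rewrite subr0 ler_wpM2l.
  rewrite distrC; apply: le_trans (lip _ _ _ _ _) _ => //; first exact: ltW.
  by rewrite sub0r ler_wpM2l// lerNl.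
have LM x : `|L * clamp K x| <= L * K.
  by rewrite normrM ger0_norm// ler_wpM2l// ler_norml; exact: KK.
exists (4 * M + 4 * (L * K)) => n s t st.
have gM x : `|g x| <= M.
  rewrite (le_trans (ler_normD _ _))// (le_trans (lerD (phiM x) (LM x)))//.
  by rewrite /M; lra.
have gmon x y : x <= y -> g x <= g y.
  move=> xy; have cxy := clamp_le K xy; rewrite /g -subr_ge0.
  have /andP[a _] := KK x; have /andP[_ b] := KK y.
  by have := lip _ _ a cxy b; rewrite ler_norml; lra.
have lmon x y : x <= y -> L * clamp K x <= L * clamp K y.
  by move=> xy; rewrite ler_wpM2l// clamp_le.
have E (u : n.-tuple R) : average u (phi \o clamp K) =
    average u g - average u (fun x => L * clamp K x).
  by rewrite /g averageD addrK.
have := interlaced_monotone st gM gmon.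
have := interlaced_monotone st LM lmon.
rewrite !E !ler_norml mulrDl; lra.
Qed.

Lemma polynomial_lipschitz p K : 0 <= K -> exists2 L, 0 <= L &
  forall x y, -K <= x -> x <= y -> y <= K -> `|p.[y] - p.[x]| <= L * (y - x).
Proof.
move=> K0; elim/poly_ind: p => [|p c [L L0 lip]].
  by exists 0 => // x y _ _ _; rewrite !horner0 subrr normr0 mul0r.
exists (`|p.[0]| + 2 * (L * K)) => [|x y Kx xy yK].
  by rewrite addr_ge0// !mulr_ge0.
rewrite !hornerMXaddC.
have -> : p.[y] * y + c - (p.[x] * x + c) = p.[y] * (y - x) + (p.[y] - p.[x]) * x.
  by ring.
have Ky : -K <= y := le_trans Kx xy.
have xK : `|x| <= K by rewrite ler_norml Kx (le_trans xy).
have py : `|p.[y]| <= `|p.[0]| + L * K.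
  rewrite -[p.[y]](subrK p.[0]) addrC (le_trans (ler_normD _ _))// lerD2l.
  case: (leP 0 y) => y0.
    apply: le_trans (lip _ _ _ y0 yK) _; first by rewrite oppr_le0.
    by rewrite subr0 ler_wpM2l.
  rewrite distrC; apply: le_trans (lip _ _ Ky (ltW y0) K0) _.
  by rewrite sub0r ler_wpM2l// lerNl.
have yx : 0 <= y - x by rewrite subr_ge0.
rewrite (le_trans (ler_normD _ _))// !normrM (ger0_norm yx).
have := ler_wpM2r yx py.
have := ler_pM (normr_ge0 _) (normr_ge0 _) (lip x y Kx xy yK) xK.
rewrite !mulrDl; nra.
Qed.

End averages.


Section moment_method.
Variable R : realType.
Implicit Types (f g : R -> R) (p h : {poly R}).
Local Notation sc f := (\int[semicircle 1]_x f x).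

Lemma continuous_horner p : continuous (fun x => p.[x]).
Proof.
elim/poly_ind: p => [|p c IH] x.
  by under [fun x => _]eq_fun do rewrite horner0; exact: cvg_cst.
under [fun x => _]eq_fun do rewrite hornerMXaddC.
by apply: cvgD; [apply: cvgM; [exact: IH | exact: cvg_id] | exact: cvg_cst].
Qed.

Lemma polynomial_growth p : exists2 C, 0 <= C & exists d, forall x, 1 <= `|x| ->
  `|p.[x]| <= C * x ^+ (2 * d).
Proof.
suff [C C0 [d H]] : exists2 C, 0 <= C & exists d, forall x, 1 <= `|x| ->
    `|p.[x]| <= C * `|x| ^+ d.
  exists C => //; exists d => x x1; rewrite (le_trans (H x x1))// ler_wpM2l//.
  by rewrite exprM -real_normK ?num_real// -exprM ler_weXn2l// leq_pmull.
elim/poly_ind: p => [|p c [C C0 [d H]]].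
  by exists 0 => //; exists 0%N => x _; rewrite horner0 normr0 mul0r.
exists (C + `|c|); first by rewrite addr_ge0.
exists d.+1 => x x1; rewrite hornerMXaddC (le_trans (ler_normD _ _))// mulrDl.
rewrite lerD//; last by rewrite ler_peMr// exprn_ege1.
by rewrite normrM exprSr mulrA ler_wpM2r// H.
Qed.

Lemma semicircle_moment_le k : semicircle_moment R (2 * k) <= 4 ^+ k.
Proof.
rewrite -[leRHS]Rintegral_semicircle_cst; apply: Rintegral_semicircle_le.
- exact: exprn_continuous.
- exact: cst_continuous.
move=> x x2; rewrite exprM; apply: lerXn2r; rewrite ?nnegrE ?sqr_ge0//.
rewrite -real_normK ?num_real//; have : `|x| <= 2 by rewrite ler_norml.
by have := normr_ge0 x; nra.
Qed.

(** High even powers are negligible against the semicircle law but dominate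
    any bounded function and any polynomial away from its support. *)
Lemma polynomial_approximation g M e : continuous g -> (forall x, `|g x| <= M) ->
  0 < e -> exists p C m, [/\ 0 <= C, C * 4 ^+ m <= e &
    forall x, `|g x - p.[x]| <= e + C * x ^+ (2 * m)].
Proof.
move=> cg gM e0; have [p pg] := weierstrass_approximation 3 cg e0.
have [C C0 [d pC]] := polynomial_growth p.
have M0 : 0 <= M := le_trans (normr_ge0 _) (gM 0).
have CM : 0 <= (C + M) * 4 ^+ d by rewrite mulr_ge0 ?addr_ge0// exprn_ge0.
have [m mP] : exists m : nat, (C + M) * 4 ^+ d * (4 / 9) ^+ m <= e.
  have q1 : `|4 / 9 : R| < 1 by rewrite ger0_norm//; lra.
  have : ((C + M) * 4 ^+ d) * (4 / 9) ^+ m @[m --> \oo] --> (0 : R).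
    by rewrite -[0](mulr0 ((C + M) * 4 ^+ d)); apply: cvgMr; exact: cvg_expr.
  move=> /cvgrPdist_le/(_ _ e0)[m _ /(_ m (leqnn m))] /= H.
  by exists m; move: H; rewrite sub0r normrN ger0_norm// mulr_ge0// exprn_ge0.
(* For [|x| >= 3], [(x ^+ 2 / 9) ^+ m >= 1]. *)
exists p, ((C + M) / 9 ^+ m), (d + m)%N.
have CM9 : 0 <= (C + M) / 9 ^+ m by rewrite divr_ge0 ?addr_ge0// exprn_ge0.
split=> // [|x].
  apply: le_trans mP; rewrite exprD expr_div_n.
  by rewrite [leLHS](_ : _ = (C + M) * 4 ^+ d * (4 ^+ m / 9 ^+ m))//; ring.
have x0 k : 0 <= x ^+ (2 * k) by rewrite exprM exprn_ge0// sqr_ge0.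
have [x3|x3] := leP `|x| 3.
  by apply: ler_wpDr; [rewrite mulr_ge0 | apply: pg; rewrite -ler_norml].
apply: ler_wpDl; first exact: ltW.
have x1 : 1 <= `|x| by apply: le_trans (ltW x3); lra.
rewrite (le_trans (ler_normB _ _))// (le_trans (lerD (gM x) (pC x x1)))//.
have d1 : 1 <= x ^+ (2 * d).
  by rewrite exprM -real_normK ?num_real// -exprM exprn_ege1.
apply: (@le_trans _ _ ((C + M) * x ^+ (2 * d))).
  by rewrite mulrDl addrC lerD2l ler_peMr.
rewrite -mulrA ler_wpM2l ?addr_ge0// mulnDr exprD mulrCA ler_peMr//.
rewrite ler_pdivlMl ?exprn_gt0// mulr1 exprM; apply: lerXn2r; rewrite ?nnegrE ?sqr_ge0//.
by rewrite -real_normK ?num_real//; nra.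
Qed.

Section interlaced_sequences.
Variables a b : forall n, n.-tuple R.
Hypothesis ab : forall n, interlaced (a n) (b n).
Hypothesis moments_b : forall k,
  average (b n) (fun x => x ^+ k) @[n --> \oo] --> semicircle_moment R k.

Let moment_cvg C k : average (b n) (fun x => C * x ^+ k) @[n --> \oo] -->
  C * semicircle_moment R k.
Proof.
under [fun n => _]eq_fun do rewrite averageZ.
by apply: cvgMr; exact: moments_b.
Qed.

Let polynomial_cvg p : average (b n) (fun x => p.[x]) @[n --> \oo] -->
  sc (fun x => p.[x]).
Proof.
have -> : sc (fun x => p.[x]) = \sum_(i < size p) p`_i * semicircle_moment R i.
  under eq_Rintegral do rewrite horner_coef.
  have ic i : (semicircle 1).-integrable setT (EFin \o (fun x => p`_i * x ^+ i)).
    apply: integrable_semicircle => x.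
    by apply: cvgM; [exact: cvg_cst | exact: exprn_continuous].
  rewrite Rintegral_sum//; apply: eq_bigr => i _; rewrite RintegralZl//.
  by apply: integrable_semicircle; exact: exprn_continuous.
have -> : (fun n => average (b n) (fun x => p.[x])) =
    (fun n => \sum_(i < size p) average (b n) (fun x => p`_i * x ^+ i)).
  apply/funext => n; rewrite /average -mulr_sumr exchange_big; congr (_ * _).
  by apply: eq_bigr => i _; rewrite horner_coef.
by apply: cvg_big => [|i _]; [exact: add_continuous | exact: moment_cvg].
Qed.

Let bounded_cvg g M : continuous g -> (forall x, `|g x| <= M) ->
  average (b n) g @[n --> \oo] --> sc g.
Proof.
move=> cg gM; apply/cvgrPdist_le => e e0.
have e6 : 0 < e / 6 by lra.
have [p [C [m [C0 Cm gp]]]] := polynomial_approximation cg gM e6.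
have scgp : `|sc g - sc (fun x => p.[x])| <= e / 6 + e / 6.
  apply: Rintegral_semicircle_dist => // [|x x2]; first exact: continuous_horner.
  rewrite (le_trans (gp x))// lerD2l (le_trans _ Cm)// ler_wpM2l//.
  rewrite exprM; apply: lerXn2r; rewrite ?nnegrE ?sqr_ge0//.
  have : `|x| <= 2 by rewrite ler_norml.
  by rewrite -real_normK ?num_real//; have := normr_ge0 x; nra.
have scC : C * semicircle_moment R (2 * m) <= e / 6.
  by apply: le_trans Cm; rewrite ler_wpM2l// semicircle_moment_le.
near=> n.
have n0 : (0 < n)%N by near: n; exact: nbhs_infty_gt.
have := average_dist (b n) n0 gp.
have : `|sc (fun x => p.[x]) - average (b n) (fun x => p.[x])| <= e / 6.
  by near: n; move/cvgrPdist_le: (@polynomial_cvg p) => /(_ _ e6).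
have : `|C * semicircle_moment R (2 * m) - average (b n) (fun x => C * x ^+ (2 * m))|
    <= e / 6.
  by near: n; move/cvgrPdist_le: (@moment_cvg C (2 * m)) => /(_ _ e6).
by move: scgp; rewrite !ler_norml; lra.
Unshelve. all: by end_near.
Qed.

Let cvg_divn C : C / n%:R @[n --> \oo] --> (0 : R).
Proof.
rewrite -(mulr0 C); apply: cvgMr; apply/gtr0_cvgV0; last exact: cvgr_idn.
by exists 1%N => // n /= n0; rewrite ltr0n.
Qed.

(** Clamping makes [phi] bounded, and Lipschitz functions do not distinguish
    interlaced sequences. *)
Let lipschitz_cvg (phi : R -> R) L : continuous phi -> 0 <= L ->
  (forall x y, -3 <= x -> x <= y -> y <= 3 -> `|phi y - phi x| <= L * (y - x)) ->
  average (a n) (phi \o clamp 3) @[n --> \oo] --> sc (phi \o clamp 3).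
Proof.
move=> cphi L0 lip; have K0 : 0 <= 3 :> R by [].
have [C HC] := interlaced_lipschitz K0 L0 lip.
have bd x : `|(phi \o clamp 3) x| <= `|phi 0| + L * 3.
  have /andP[c1 c2] := clamp_itv x K0; rewrite /=.
  rewrite -[phi (clamp 3 x)](subrK (phi 0)) addrC.
  rewrite (le_trans (ler_normD _ _))// lerD2l.
  case: (leP 0 (clamp 3 x)) => c0.
    rewrite (le_trans (lip _ _ _ c0 c2)) ?oppr_le0//.
    by rewrite subr0 ler_wpM2l.
  rewrite distrC (le_trans (lip _ _ c1 (ltW c0) _))//.
  by rewrite sub0r ler_wpM2l// lerNl.
have cb := bounded_cvg (continuous_comp_clamp cphi) bd.
apply/cvgrPdist_le => e e0; have e2 : 0 < e / 2 by lra.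
near=> n; have := HC n _ _ (@ab n).
have : `|0 - C / n%:R| <= e / 2.
  by near: n; move/cvgrPdist_le: (@cvg_divn C) => /(_ _ e2).
have : `|sc (phi \o clamp 3) - average (b n) (phi \o clamp 3)| <= e / 2.
  by near: n; move/cvgrPdist_le: cb => /(_ _ e2).
by rewrite !ler_norml; lra.
Unshelve. all: by end_near.
Qed.

(** Outside [-3, 3] a bounded function is dominated by a multiple of the bounded
    Lipschitz function [`|clamp 3 x - clamp 2 x|], which the semicircle law does
    not see; inside, it is approximated by polynomials, which are Lipschitz
    there. *)
Theorem interlaced_moments_cvg f M : continuous f -> (forall x, `|f x| <= M) ->
  average (a n) f @[n --> \oo] --> sc f.
Proof.
move=> cf fM; apply/cvgrPdist_le => e e0.
have M0 : 0 <= M := le_trans (normr_ge0 _) (fM 0).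
have e4 : 0 < e / 4 by lra.
have K0 : 0 <= 3 :> R by [].
have [p fp] := weierstrass_approximation 3 cf e4.
have [L L0 lip] := polynomial_lipschitz p K0.
have cp := lipschitz_cvg (@continuous_horner p) L0 lip.
pose h (x : R) := `|x - clamp 2 x|.
have ch : continuous h.
  move=> x; apply: cvg_norm; apply: cvgB; first exact: cvg_id.
  exact: continuous_clamp.
have lih (x y : R) : -3 <= x -> x <= y -> y <= 3 -> `|h y - h x| <= 2 * (y - x).
  move=> _ xy _; rewrite (le_trans (ler_dist_dist _ _))//.
  have -> : y - clamp 2 y - (x - clamp 2 x) = (y - x) + (clamp 2 x - clamp 2 y) by ring.
  rewrite (le_trans (ler_normD _ _))//; have := clamp_dist 2 x y.
  by rewrite distrC [`|x - y|]distrC (ger0_norm (_ : 0 <= y - x)) ?subr_ge0//; lra.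
have chl := lipschitz_cvg ch (ltW (ltr0n _ 2)) lih.
have sch : sc (h \o clamp 3) = 0.
  rewrite -[RHS](Rintegral_semicircle_cst 0); apply: eq_Rintegral_semicircle.
  - exact: continuous_comp_clamp.
  - exact: cst_continuous.
  move=> x /andP[x1 x2]; rewrite /h /= !clampE ?subrr ?normr0//; lra.
have fph x : `|f x - p.[clamp 3 x]| <= e / 4 + 2 * M * h (clamp 3 x).
  have [x3|x3] := leP `|x| 3.
    move: x3; rewrite ler_norml => x3; rewrite clampE//.
    rewrite (le_trans (fp x x3))// lerDl; apply: mulr_ge0; last exact: normr_ge0.
    exact: mulr_ge0.
  have := fp (clamp 3 x) (@clamp_itv R 3 x K0).
  have -> : h (clamp 3 x) = 1.
    move: x3; rewrite ltr_normr /h /clamp => /orP[] x3.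
      have -> : Num.min x 3 = 3 by rewrite min_r// ltW.
      rewrite max_r; last lra.
      by rewrite min_r ?max_r; [rewrite (_ : 3 - 2 = 1) ?normr1//; ring|lra|lra].
    have -> : Num.min x 3 = x by rewrite min_l//; lra.
    rewrite max_l; last lra.
    rewrite min_l; last lra.
    rewrite max_l; last lra.
    by rewrite (_ : -3 - -2 = - 1) ?normrN1//; ring.
  have := fM x; have := fM (clamp 3 x).
  by rewrite !ler_norml; lra.
have scfp : `|sc f - sc (fun x => p.[clamp 3 x])| <= e / 4.
  apply: Rintegral_semicircle_dist => //.
    by have := continuous_comp_clamp (K := 3) (@continuous_horner p).
  move=> x /andP[x1 x2]; rewrite clampE; last lra.
  by apply: fp; lra.
have chM : average (a n) (fun x => 2 * M * h (clamp 3 x)) @[n --> \oo] --> 0.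
  under [fun n => _]eq_fun do rewrite averageZ.
  by rewrite -(mulr0 (2 * M)) -sch; apply: cvgMr; exact: chl.
near=> n.
have n0 : (0 < n)%N by near: n; exact: nbhs_infty_gt.
have := average_dist (a n) n0 fph.
have : `|0 - average (a n) (fun x => 2 * M * h (clamp 3 x))| <= e / 4.
  by near: n; move/cvgrPdist_le: chM => /(_ _ e4).
have : `|sc (fun x => p.[clamp 3 x]) - average (a n) (fun x => p.[clamp 3 x])| <= e / 4.
  by near: n; move/cvgrPdist_le: cp => /(_ _ e4).
by move: scfp; rewrite !ler_norml; lra.
Unshelve. all: by end_near.
Qed.

End interlaced_sequences.
End moment_method.

(** * Almost sure convergence of the moments *)

Section almost_sure_moments.
Context d (Omega : measurableType d) (R : realType) (P : probability Omega R).

(** A telescoping bound, which sums to 2. *)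
Let inverse_square_le m : (m.+1%:R ^+ 2)^-1 <= 2 * (m.+1%:R^-1 - m.+2%:R^-1) :> R.
Proof.
have m1 : 0 < m.+1%:R :> R by rewrite ltr0n.
have m2 : 0 < m.+2%:R :> R by rewrite ltr0n.
have E : m.+2%:R = m.+1%:R + 1 :> R by rewrite natr1.
have m11 : 1 <= m.+1%:R :> R by rewrite ler1n.
rewrite -subr_ge0; move: m2 E; move: m.+1%:R m.+2%:R m1 m11 => x y x0 x1 y0 ->.
rewrite (_ : _ - _ = (x - 1) / (x ^+ 2 * (x + 1))); last first.
  by field; apply/andP; split; apply: lt0r_neq0; lra.
by rewrite divr_ge0// ?mulr_ge0 ?sqr_ge0//; lra.
Qed.

(** Variances of order [1 / n ^ 2] are summable, so the series of the squared
    deviations has finite expectation and converges almost surely. *)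
Lemma ae_cvg_of_variance (X : nat -> Omega -> R) (mu : nat -> R) (C c : R) :
  (forall m, measurable_fun setT (X m)) ->
  (forall m, (\int[P]_x ((X m x - mu m) ^+ 2)%:E <= (C / m.+1%:R ^+ 2)%:E)%E) ->
  mu m @[m --> \oo] --> c ->
  {ae P, forall x, X m x @[m --> \oo] --> c}.
Proof.
move=> mX var muc.
pose Y m x := ((X m x - mu m) ^+ 2)%:E.
have mY m : measurable_fun setT (Y m).
  by apply/measurable_EFinP; apply: measurable_funX; exact: measurable_funB.
have Y0 m x : (0 <= Y m x)%E by rewrite lee_fin sqr_ge0.
have C0 : 0 <= C.
  have : (0 <= \int[P]_x Y 0%N x)%E by exact: integral_ge0.
  by move=> /le_trans/(_ (var 0%N)); rewrite lee_fin expr1n divr1.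
pose F x := (\sum_(0 <= m <oo) Y m x)%E.
have F0 x : (0 <= F x)%E by apply: nneseries_ge0.
have mF : measurable_fun setT F.
  by apply: ge0_emeasurable_sum => // m x _ _; exact: Y0.
have intF : (\int[P]_x F x < +oo)%E.
  rewrite integral_nneseries//.
  apply: (@le_lt_trans _ _ (2 * C)%:E); last by rewrite ltry.
  apply: lime_le.
    by apply: is_cvg_nneseries => m _ _; exact: integral_ge0.
  apply: nearW => n.
  apply: (@le_trans _ _ (2 * C * (1 - n.+1%:R^-1))%:E); last first.
    by rewrite lee_fin ler_piMr ?mulr_ge0// gerBl invr_ge0.
  elim: n => [|n IH]; first by rewrite big_geq// invr1 subrr mulr0.
  rewrite big_nat_recr//=; apply: le_trans (leeD IH (var n)) _.
  rewrite -EFinD lee_fin; have := ler_wpM2l C0 (inverse_square_le n).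
  by move: (n.+1%:R ^- 2) (n.+1%:R^-1) (n.+2%:R^-1) => u v z; lra.
have iF : P.-integrable setT F.
  apply/integrableP; split=> //.
  by under eq_integral do rewrite gee0_abs//.
have := integrable_ae measurableT iF; apply: filterS => x /(_ I) Fx.
have Fx' : (F x < +oo)%E by rewrite ltey; move: Fx; case: (F x).
have tail := nneseries_tail_cvg Fx' (fun m _ => Y0 m x).
have Y_0 : Y m x @[m --> \oo] --> (0 : R)%:E.
  apply: (squeeze_cvge _ (cvg_cst 0%E) tail); apply: nearW => m.
  rewrite Y0/= (nneseries_split _ 1) => [|k _]; last exact: Y0.
  rewrite addn1 big_nat1 leeDl//; apply: nneseries_ge0 => k _ _; exact: Y0.
have XX : (X m x - mu m) ^+ 2 @[m --> \oo] --> (0 : R).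
  by have /fine_cvgP[_] := Y_0.
have : X m x - mu m @[m --> \oo] --> (0 : R).
  apply/cvgrPdist_le => e e0; move/cvgrPdist_le : XX => /(_ _ (exprn_gt0 2 e0)).
  apply: filterS => m; rewrite !sub0r !normrN ger0_norm ?sqr_ge0// => H.
  by rewrite -(ler_pXn2r (n := 2)) ?nnegrE ?(ltW e0)// real_normK ?num_real.
move=> /cvgD/(_ muc); rewrite add0r; apply: cvg_trans.
by apply: near_eq_cvg; apply: nearW => m; rewrite subrK.
Qed.

(** Solutions of the loop equations have converging expectations and, by
    factorization, variances of order [1 / n ^ 2]. *)
Lemma ae_cvg_loop_equations (T : nat -> nat -> Omega -> R) :
  (forall m l, P.-integrable setT (EFin \o (fun x => \prod_(k <- l) T m k x))) ->
  (forall m, loop_equations m.+1 (fun l => \int[P]_x \prod_(k <- l) T m k x)) ->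
  {ae P, forall x k, T m k x @[m --> \oo] --> semicircle_moment R k}.
Proof.
move=> iT hT; apply: ae_foralln => k.
pose e m l := \int[P]_x \prod_(k <- l) T m k x.
have e1 m : e m [:: k] = \int[P]_x T m k x.
  by apply: eq_Rintegral => x _; rewrite big_seq1.
have i1 m : P.-integrable setT (EFin \o T m k).
  have := iT m [:: k]; congr (_.-integrable _ _).
  by apply/funext => x /=; rewrite big_seq1.
have i2 m : P.-integrable setT (EFin \o (fun x => T m k x ^+ 2)).
  have := iT m [:: k; k]; congr (_.-integrable _ _).
  by apply/funext => x /=; rewrite big_cons big_seq1.
have [C HC] := loop_factorization R [:: k] [:: k].
have [C1 HC1] := loop_leading_order (@semicircle_moment0 R)
  (@semicircle_moment_rec R) [:: k].
apply: (@ae_cvg_of_variance (fun m => T m k) (fun m => e m [:: k]) C).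
- by move=> m; have /integrableP[/measurable_EFinP] := i1 m.
- move=> m; have i0 : P.-integrable setT (EFin \o (fun x : Omega => e m [:: k] ^+ 2)).
    exact: finite_measure_integrable_cst.
  have iZ : P.-integrable setT (EFin \o (fun x => 2 * e m [:: k] * T m k x)).
    exact: (integrableZl measurableT _ (i1 m)).
  have iB : P.-integrable setT
      (EFin \o (fun x => T m k x ^+ 2 - 2 * e m [:: k] * T m k x)).
    exact: (integrableB measurableT (i2 m) iZ).
  have E : (fun x => ((T m k x - e m [:: k]) ^+ 2)%:E) = EFin \o (fun x =>
      T m k x ^+ 2 - 2 * e m [:: k] * T m k x + e m [:: k] ^+ 2).
    by apply/funext => x /=; congr EFin; ring.
  rewrite E -[leLHS]fineK; last first.
    by apply: integrable_fin_num => //; exact: (integrableD measurableT iB i0).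
  rewrite lee_fin -/(Rintegral _ _ _) RintegralD// RintegralB// RintegralZl//.
  rewrite Rintegral_cst// [fine _](_ : _ = 1) ?mulr1; last first.
    by rewrite [X in fine X](probability_setT P).
  rewrite -e1 (_ : _ + _ = e m [:: k; k] - e m [:: k] * e m [:: k]); last first.
    have -> : \int[P]_x (T m k x ^+ 2) = e m [:: k; k].
      by apply: eq_Rintegral => x _; rewrite big_cons big_seq1.
    by ring.
  exact: le_trans (ler_norm _) (HC _ _ (ltn0Sn m) (hT m)).
- apply/cvgrPdist_le => r r0; near=> m.
  rewrite distrC; have := HC1 _ _ (ltn0Sn m) (hT m); rewrite big_seq1 expr1.
  move=> /le_trans; apply.
  near: m; have : C1 * m.+1%:R^-1 @[m --> \oo] --> (0 : R).
    by rewrite -(mulr0 C1); apply: cvgMr; exact: cvg_harmonic.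
  move=> /cvgrPdist_le/(_ _ r0); apply: filterS => m.
  by rewrite sub0r normrN; apply: le_trans; exact: ler_norm.
Unshelve. all: by end_near.
Qed.

End almost_sure_moments.

(** * Random eigenvalues *)

Section step_approximation.
Variable R : realType.

(** Indicators of half-lines are pointwise limits of polynomials: compare with
    continuous steps of slope [j] on [[-j, j]]. *)
Lemma polynomial_step (a : R) : exists p : nat -> {poly R}, forall x,
  (p j).[x] @[j --> \oo] --> ((x <= a)%R%:R : R).
Proof.
pose g (j : nat) (x : R) : R := Num.max 0 (1 - j%:R * Num.max 0 (x - a)).
have cmax (f : R -> R) : continuous f -> continuous (fun x => Num.max 0 (f x)).
  move=> cf; rewrite (_ : (fun _ => _) = fun x => (f x + `|f x|) / 2).
    move=> x; apply: cvgM; last exact: cvg_cst.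
    by apply: cvgD; [exact: cf | apply: cvg_norm; exact: cf].
  by apply/funext => x; rewrite maxr_absE add0r sub0r normrN.
have cg j : continuous (g j).
  apply: (cmax) => x; apply: cvgB; first exact: cvg_cst.
  apply: cvgM; first exact: cvg_cst.
  by apply: (cmax (fun y => y - a)) => y; apply: cvgB; [exact: cvg_id | exact: cvg_cst].
have /choice[p pP] : forall j, exists p : {poly R}, forall x, - j%:R <= x <= j%:R ->
    `|g j x - p.[x]| <= j.+1%:R^-1.
  by move=> j; apply: weierstrass_approximation; rewrite ?invr_gt0.
exists p => x; apply/cvgrPdist_le => e e0; near=> j.
have jx : `|x| <= j%:R by near: j; exact: nbhs_infty_ger.
have je : j.+1%:R^-1 <= e :> R.
  near: j; have := @cvg_harmonic R => /cvgrPdist_le/(_ _ e0).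
  by apply: filterS => j; rewrite sub0r normrN ger0_norm ?invr_ge0.
have -> : (x <= a)%R%:R = g j x.
  rewrite /g; case: leP => xa.
    by rewrite (max_l (_ : x - a <= 0)) ?subr_le0// mulr0 subr0 max_r.
  rewrite (max_r (_ : 0 <= x - a)) ?subr_ge0 ?(ltW xa)// max_l//.
  rewrite subr_le0 -ler_pdivrMr ?subr_gt0// div1r.
  by near: j; exact: nbhs_infty_ger.
by apply: le_trans (pP j x _) je; rewrite -ler_norml.
Unshelve. all: by end_near.
Qed.

End step_approximation.

Section random_eigenvalues.
Context d (Omega : measurableType d) (R : realType) (n : nat).
Variable A : Omega -> 'M[R]_n.+1.
Hypothesis AT : forall x, (A x)^T = A x.
Hypothesis mA : forall i j, measurable_fun setT (fun x => A x i j).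

Let measurable_exp k i j : measurable_fun setT (fun x => (A x ^+ k) i j).
Proof.
elim: k i j => [|k IH] i j.
  by under eq_fun do rewrite expr0; exact: measurable_cst.
under eq_fun do rewrite exprS mxE.
by apply: measurable_sum => l; apply: measurable_funM.
Qed.

Lemma measurable_sum_horner p : measurable_fun setT
  (fun x => \sum_i p.[tnth (eigenvalues (A x)) i]).
Proof.
have -> : (fun x => \sum_i p.[tnth (eigenvalues (A x)) i]) =
    (fun x => \sum_(k < size p) p`_k * \sum_i (A x ^+ k) i i).
  apply/funext => x.
  transitivity (\sum_(k < size p) p`_k * \tr (A x ^+ k)); last by [].
  under eq_bigr do rewrite horner_coef.
  rewrite exchange_big; apply: eq_bigr => k _.
  by rewrite trace_exp_eigenvalues// mulr_sumr.
apply: measurable_sum => k; apply: measurable_funM => //.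
by apply: measurable_sum => i; exact: measurable_exp.
Qed.

(** The counting function of the spectrum, a limit of traces of polynomials,
    determines the ordered eigenvalues. *)
Lemma measurable_eigenvalue i :
  measurable_fun setT (fun x => tnth (eigenvalues (A x)) i).
Proof.
pose N a x : R := \sum_j (tnth (eigenvalues (A x)) j <= a)%R%:R.
have mN a : measurable_fun setT (N a).
  have [p pa] := polynomial_step a.
  apply: (measurable_fun_cvg (h := fun m x => \sum_j (p m).[tnth (eigenvalues (A x)) j])).
    by move=> m; exact: measurable_sum_horner.
  move=> x _; apply: cvg_big => [|j _]; first exact: add_continuous.
  exact: pa.
have NE a x : (tnth (eigenvalues (A x)) i <= a) = ((n.+1 - i)%:R <= N a x).
  have [sA _] := eigenvalues_diagonalizes (AT x).
  have anti (j l : 'I_n.+1) : (j <= l)%N ->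
      tnth (eigenvalues (A x)) l <= tnth (eigenvalues (A x)) j.
    move=> jl; rewrite !(tnth_nth 0).
    apply: (sorted_leq_nth (@ge_trans _ R) (@ge_refl _ R)) => //; rewrite inE size_tuple//.
  have -> : N a x = (#|[pred j | (tnth (eigenvalues (A x)) j <= a)%R]|)%:R.
    by rewrite /N -natr_sum -sum1_card [in RHS]big_mkcond/=; congr (_%:R).
  have card_ge (k : nat) : #|[pred j : 'I_n.+1 | (k <= j)%N]| = (n.+1 - k)%N.
    rewrite -sum1_card; transitivity (\sum_(k <= j < n.+1) 1)%N.
      by rewrite big_geq_mkord; apply: eq_bigl => j; rewrite inE.
    by rewrite sum_nat_const_nat muln1.
  rewrite ler_nat; case: leP => ia; apply/esym.
    apply/idP; rewrite -card_ge.
    apply: subset_leq_card; apply/fintype.subsetP => j; rewrite !inE => ij.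
    by apply: le_trans ia; exact: anti.
  apply/negbTE; rewrite -ltnNge.
  apply: (@leq_ltn_trans #|[pred j : 'I_n.+1 | (i.+1 <= j)%N]|).
    apply: subset_leq_card; apply/fintype.subsetP => j; rewrite !inE ltnNge.
    by move=> ja; apply/negP => /anti; rewrite leNgt (le_lt_trans ja ia).
  by rewrite card_ge; have := ltn_ord i; lia.
apply: (measurability (@RGenOInfty.G R)).
  exact: RGenOInfty.measurableE.
move=> /= _ [_] [a] -> <-.
rewrite (_ : _ @^-1` _ = ~` [set x | (n.+1 - i)%:R <= N a x]).
  apply: measurableI => //; apply: measurableC.
  rewrite -[X in measurable X]setTI.
  by apply: measurable_fun_le => //; exact: measurable_cst.
by apply/seteqP; split => x; rewrite /= in_itv/= andbT ltNge NE => /negP.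
Qed.

End random_eigenvalues.

Lemma bounded_fun_bound (R : realType) (f : R -> R) : bounded_fun f ->
  exists M : R, forall x, `|f x| <= M.
Proof.
move=> [M [_ fM]]; exists (M + 1) => x; apply: fM => //; lra.
Qed.

Section mean_spectral_distribution.
Context d (Omega : measurableType d) (R : realType) (P : probability Omega R).
Context (n : nat) (A : Omega -> 'M[R]_n.+1).
Hypothesis mA : forall i,
  measurable_fun setT (fun x => tnth (eigenvalues (A x)) i).

Lemma measurable_average (f : R -> R) : measurable_fun setT f ->
  measurable_fun setT (fun x => average (eigenvalues (A x)) f).
Proof.
move=> mf; apply: measurable_funM => //; apply: measurable_sum => i.
by apply: measurableT_comp => //; exact: mA.
Qed.

Let lam i x : R := tnth (eigenvalues (A x)) i.

HB.instance Definition _ i := isMeasurableFun.Build _ _ _ _ (lam i) (mA i).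

(** The law of an eigenvalue chosen uniformly at random. *)
Let mean : set R -> \bar R :=
  mscale (n.+1%:R^-1)%:nng (msum (fun i => distribution P (lam (inord i))) n.+1).

HB.instance Definition _ := Measure.on mean.

Let meanT : mean setT = 1%E.
Proof.
rewrite /mean /mscale/= /msum/=.
under eq_bigr do rewrite probability_setT.
by rewrite sumEFin -EFinM big_const_ord iter_addr addr0 mulVf ?pnatr_eq0.
Qed.

HB.instance Definition _ := Measure_isProbability.Build _ _ _ mean meanT.

Let ge0_integral_mean (f : R -> R) : measurable_fun setT f -> (forall x, 0 <= f x) ->
  (\int[mean]_x (f x)%:E = \int[P]_x (average (eigenvalues (A x)) f)%:E)%E.
Proof.
move=> mf f0; have mf' : measurable_fun setT (EFin \o f) by exact/measurable_EFinP.
rewrite ge0_integral_mscale//; last by move=> x _; rewrite lee_fin.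
rewrite ge0_integral_measure_sum//; last by move=> x _; rewrite lee_fin.
have ml i : measurable_fun setT (fun x => (f (lam i x))%:E).
  by apply/measurable_EFinP; apply: measurableT_comp => //; exact: mA.
under eq_bigr => i _ do rewrite ge0_integral_distribution//=.
rewrite -(big_mkord xpredT (fun i => \int[P]_x (f (lam (inord i) x))%:E)%E).
transitivity (n.+1%:R^-1%:E * \sum_(i < n.+1) \int[P]_x (f (lam i x))%:E)%E.
  by rewrite big_mkord; congr (_ * _)%E; apply: eq_bigr => i _; rewrite inord_val.
rewrite -ge0_integral_sum//; last by move=> i x _; rewrite lee_fin.
rewrite -ge0_integralZl_EFin//.
- by apply: eq_integral => x _; rewrite sumEFin -EFinM.
- by move=> x _; apply: sume_ge0 => i _; rewrite lee_fin.
- exact: emeasurable_sum.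
Qed.

Let mean_spectrum : probability R R := mean.

(** [mean] has the property that characterizes [expected_esd P A], which is
    therefore satisfied by the latter. *)
Lemma expected_esdE (f : R -> R) : measurable_fun setT f -> bounded_fun f ->
  \int[expected_esd P A]_x f x = \int[P]_x average (eigenvalues (A x)) f.
Proof.
move=> mf bf; rewrite /Rintegral; congr fine; rewrite /expected_esd.
suff ex : exists mu : probability R R, forall f : R -> R, measurable_fun setT f ->
    bounded_fun f ->
    (\int[mu]_x (f x)%:E = 'E_P[fun t => (\int[esd (A t)]_x f x)%R])%E.
  rewrite (getPex ex f mf bf) unlock; apply: eq_integral => x _.
  by rewrite Rintegral_esd.
exists mean_spectrum => g mg bg; rewrite unlock.
have [M gM] := bounded_fun_bound bg.
pose gp y := Num.max (g y) 0; pose gn y := Num.max (- g y) 0.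
have mp : measurable_fun setT gp by exact: measurable_maxr.
have mn : measurable_fun setT gn.
  by apply: measurable_maxr => //; exact: measurable_funN.
have gpM y : `|gp y| <= M.
  have gy := gM y; rewrite /gp.
  by case: (leP (g y) 0) => _ //; rewrite normr0 (le_trans _ gy).
have gnM y : `|gn y| <= M.
  have gy := gM y; rewrite /gn.
  by case: (leP (- g y) 0) => _; rewrite ?normrN// normr0 (le_trans _ gy).
have iavg (h : R -> R) : measurable_fun setT h -> (forall y, `|h y| <= M) ->
    P.-integrable setT (EFin \o (fun x => average (eigenvalues (A x)) h)).
  move=> mh hM; apply: measurable_bounded_integrable => //.
  - by rewrite [ltLHS](probability_setT P) ltry.
  - exact: measurable_average.
  exists M; split; first exact: num_real.
  by move=> N /ltW MN x _; apply: le_trans MN; exact: average_norm_le.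
rewrite integralE.
under eq_integral do rewrite funeposE -EFin_max.
under [X in (_ - X)%E]eq_integral do rewrite funenegE -EFinN -EFin_max.
rewrite !ge0_integral_mean//; try by move=> x; rewrite le_max lexx orbT.
rewrite -integralB_EFin//; try exact: iavg.
apply: eq_integral => x _; rewrite Rintegral_esd// -EFinB; congr EFin.
rewrite /average -mulrBr -sumrB; congr (_ * _); apply: eq_bigr => i _.
by rewrite /gp /gn; case: (leP 0 (g _)) => H1; case: (leP 0 (- g _)) => H2; lra.
Qed.

End mean_spectral_distribution.

(** * The rescaled contraction *)

Section rescaled_contraction.
Context d (Omega : measurableType d) (R : realType) (P : probability Omega R).

(** What the limit theorem retains of the tensor: a second list of eigenvalues,
    that of the compression, interlaced with the spectrum, whose moments satisfy
    the loop equations in expectation. *)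
Lemma contraction_spectrum (r n : nat) (w : 'rV[R]_n)
    (G : r.-tuple 'I_n -> {RV P >-> R}) (c : R) :
  (2 <= r)%N -> (0 < n)%N -> \sum_(i < n) w 0 i ^+ 2 = 1 -> GOTE G ->
  c ^+ 2 = (r%:R - 1) / n%:R ->
  let A x := c *: tensor_contraction (fun t => G t x) w in
  exists (T : nat -> Omega -> R) (b : Omega -> n.-tuple R),
  [/\ forall l, P.-integrable setT (EFin \o (fun x => \prod_(k <- l) T k x)),
      loop_equations n (fun l => \int[P]_x \prod_(k <- l) T k x),
      forall x k, average (b x) (fun y => y ^+ k.+1) = T k.+1 x &
      forall x, interlaced (eigenvalues (A x)) (b x)].
Proof.
case: r G => [|[|q]] // G _; case: n w G => // m w G _ hw hG c2 A.
have c2' : c ^+ 2 = q.+1%:R / m.+1%:R.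
  by rewrite c2 -natr1 addrK.
pose B := compressed_contraction w G c.
exists (normalized_trace (hyperplane_proj w) B), (fun x => eigenvalues (B x)).
have AT x : (A x)^T = A x := scaled_contraction_sym w hG c x.
have BT x : (B x)^T = B x := compressed_contraction_sym w hG c x.
split.
- exact: integrable_compressed_contraction.
- exact: compressed_contraction_loop_equations.
- move=> x k; rewrite /average -trace_exp_eigenvalues// /normalized_trace.
  congr (_ * \tr _); rewrite /compressed_power exprS mulrA.
  by rewrite proj_compressed_contraction.
move=> x i j ij; have rk := compression_rank w G c x; split.
  exact: eigenvalues_interlacing (AT x) (BT x) rk ij.
rewrite -opprB mxrank_opp in rk.
exact: eigenvalues_interlacing (BT x) (AT x) rk ij.
Qed.

Lemma measurable_contraction (r n : nat) (w : 'rV[R]_n)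
    (G : r.-tuple 'I_n -> {RV P >-> R}) (c : R) i j :
  measurable_fun setT
    (fun x => (c *: tensor_contraction (fun t => G t x) w) i j).
Proof.
have -> : (fun x => (c *: tensor_contraction (fun t => G t x) w) i j) =
    (fun x => c * \sum_(t : r.-tuple 'I_n)
       if take 2 t == [:: i; j] then G t x * \prod_(k <- drop 2 t) w 0 k else 0).
  by apply/funext => x; rewrite !mxE big_mkcond.
apply: measurable_funM => //; apply: measurable_sum => t.
by case: (take 2 t == _) => //; exact: measurable_funM.
Qed.

Lemma contraction_sym (r n : nat) (w : 'rV[R]_n)
    (G : r.-tuple 'I_n -> {RV P >-> R}) (c : R) x : (2 <= r)%N -> GOTE G ->
  (c *: tensor_contraction (fun t => G t x) w)^T =
  c *: tensor_contraction (fun t => G t x) w.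
Proof.
case: r G => [|[|q]] // G _ hG; case: n w G hG => [|m] w G hG.
  by apply/matrixP => -[].
exact: scaled_contraction_sym.
Qed.

End rescaled_contraction.

(** * Consequences of almost sure convergence *)

Section almost_sure_convergence.
Context d (Omega : measurableType d) (R : realType) (P : probability Omega R).
Variables (Z : nat -> Omega -> R) (s : R).
Hypothesis mZ : forall m, measurable_fun setT (Z m).
Hypothesis Zs : {ae P, forall x, Z m x @[m --> \oo] --> s}.

Let integrable_cst (M : R) : P.-integrable setT (EFin \o (fun _ : Omega => M)).
Proof. exact: finite_measure_integrable_cst. Qed.

Lemma ae_cvg_Rintegral (M : R) : (forall m x, `|Z m x| <= M) ->
  \int[P]_x Z m x @[m --> \oo] --> s.
Proof.
move=> ZM.
have mZ' m : measurable_fun setT (fun x => (Z m x)%:E) by exact/measurable_EFinP.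
have Zs' : {ae P, forall x, setT x -> (Z m x)%:E @[m --> \oo] --> s%:E}.
  by apply: filterS Zs => x Zx _; apply: cvg_EFin => //; exact: nearW.
have ZM' : {ae P, forall x m, setT x -> (`|(Z m x)%:E| <= M%:E)%E}.
  by apply: aeW => x m _; rewrite lee_fin.
have [_ _] := dominated_convergence measurableT mZ' (measurable_cst _) Zs'
  (integrable_cst M) ZM'.
rewrite integral_cst//= [P _](probability_setT P) mule1 => H.
exact: (fine_cvg H).
Qed.

Lemma ae_cvg_in_prob (e : R) : 0 < e ->
  P [set x | e <= `|Z m x - s|] @[m --> \oo] --> 0%E.
Proof.
move=> e0; pose S m := [set x | e <= `|Z m x - s|].
have mS m : measurable (S m).
  rewrite -[S m]setTI; apply: measurable_fun_le => //.
  by apply: measurableT_comp => //; exact: measurable_funB.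
have mI m : measurable_fun setT (fun x => (\1_(S m) x : R)%:E).
  by apply/measurable_EFinP; exact: measurable_indic.
have I_0 : {ae P, forall x, setT x -> (\1_(S m) x : R)%:E @[m --> \oo] --> 0%E}.
  apply: filterS Zs => x /cvgrPdist_lt/(_ _ e0) Zx _.
  apply: cvg_near_cst; apply: filterS Zx => m; rewrite distrC indicE => Ze.
  by rewrite memNset//= /S/= leNgt Ze.
have I_1 : {ae P, forall x m, setT x -> (`|(\1_(S m) x : R)%:E| <= 1%:E)%E}.
  by apply: aeW => x m _; rewrite indicE abse_EFin normr_nat lee_fin; case: (_ \in _).
have [_ _] := dominated_convergence measurableT mI (measurable_cst _) I_0
  (integrable_cst 1) I_1.
rewrite integral0 => H.
rewrite (_ : (fun m => P _) = (fun m => \int[P]_x (\1_(S m) x)%:E)%E)//.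
by apply/funext => m; rewrite integral_indic// setIT.
Qed.

End almost_sure_convergence.

(** * Almost sure weak convergence *)

Section tensor_sequence.
Context (R : realType) (d : measure_display) (Omega : measurableType d)
  (P : probability Omega R).
Variables (r : nat -> nat) (w : forall n, 'rV[R]_n)
  (G : forall n, (r n).-tuple 'I_n -> {RV P >-> R}) (c : nat -> R).
Hypothesis hr : forall n, (0 < n)%N -> (3 <= r n)%N.
Hypothesis hw : forall n, (0 < n)%N -> \sum_(i < n) w n 0 i ^+ 2 = 1.
Hypothesis hG : forall n, (0 < n)%N -> GOTE (@G n).
Hypothesis c2 : forall n, (0 < n)%N -> c n ^+ 2 = ((r n)%:R - 1) / n%:R.
Let A n x : 'M[R]_n := c n *: tensor_contraction (fun t => @G n t x) (w n).

(** Quantifying over the test function inside the almost sure event costs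
    nothing: on that event all the moments converge, which suffices for every
    test function. *)
Lemma ae_cvg_contraction : {ae P, forall x f, continuous f -> bounded_fun f ->
  average (eigenvalues (A n x)) f @[n --> \oo] --> \int[semicircle 1]_x f x}.
Proof.
have H n : {Tb : (nat -> Omega -> R) * (Omega -> n.-tuple R) | (0 < n)%N ->
  [/\ forall l, P.-integrable setT (EFin \o (fun x => \prod_(k <- l) Tb.1 k x)),
      loop_equations n (fun l => \int[P]_x \prod_(k <- l) Tb.1 k x),
      forall x k, average (Tb.2 x) (fun y => y ^+ k.+1) = Tb.1 k.+1 x &
      forall x, interlaced (eigenvalues (A n x)) (Tb.2 x)]}.
  apply: cid; have [n0|] := boolP (0 < n)%N; last first.
    by exists (fun _ _ => 0, fun _ => [tuple 0 | i < n]).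
  have r2 : (2 <= r n)%N by exact: ltnW (@hr n n0).
  have [T [b Tb]] := contraction_spectrum r2 n0 (@hw n n0) (@hG n n0) (@c2 n n0).
  by exists (T, b).
pose T n := (projT1 (H n)).1; pose b n := (projT1 (H n)).2.
have TbP n := projT2 (H n).
have iT m : forall l, P.-integrable setT (EFin \o (fun x => \prod_(k <- l) T m.+1 k x)).
  by have [] := TbP m.+1 isT.
have lT m : loop_equations m.+1 (fun l => \int[P]_x \prod_(k <- l) T m.+1 k x).
  by have [] := TbP m.+1 isT.
apply: filterS (ae_cvg_loop_equations iT lT) => x Tx f cf /bounded_fun_bound[M fM].
apply: (@interlaced_moments_cvg R (fun n => eigenvalues (A n x)) (fun n => b n x)
  _ _ f M cf fM) => [n|k].
  have [n0|n0] := boolP (0 < n)%N; first by have [_ _ _] := TbP n n0; exact.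
  by move=> i; rewrite (leq_ltn_trans (leq0n _) (ltn_ord i)) in n0.
rewrite -cvg_shiftS; case: k => [|k].
  rewrite semicircle_moment0; apply: cvg_near_cst; apply: nearW => m.
  have E : (fun y : R => y ^+ 0) = (fun _ => 1) by apply/funext => y; rewrite expr0.
  by rewrite E /= average_cst.
have E m : average (b m.+1 x) (fun y => y ^+ k.+1) = T m.+1 k.+1 x.
  by have [_ _ + _] := TbP m.+1 isT; exact.
by under eq_fun do rewrite E; exact: Tx.
Qed.

Lemma measurable_contraction_eigenvalue m i :
  measurable_fun setT (fun x => tnth (eigenvalues (A m.+1 x)) i).
Proof.
apply: measurable_eigenvalue => [x|*]; last exact: measurable_contraction.
by apply: contraction_sym; [exact: ltnW (hr _) | exact: hG].
Qed.

End tensor_sequence.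

Theorem proposition2p1 (R : realType) (d : measure_display)
  (Omega : measurableType d) (P : probability Omega R)
  (r : nat -> nat) (hr : forall n, (0 < n)%N -> (3 <= r n)%N)
  (w : forall n, 'rV[R]_n)
  (hw : forall n, (0 < n)%N -> \sum_(i < n) w n 0 i ^+ 2 = 1)
  (G : forall n, (r n).-tuple 'I_n -> {RV P >-> R})
  (hG : forall n, (0 < n)%N -> GOTE (G n)) :
  let M := fun (n : nat) (omega : Omega) =>
    tensor_contraction (fun t => G n t omega) (w n) in
  let theta := fun n : nat => 1 / Num.sqrt ((r n)%:R - 1) in
  let A := fun (n : nat) (omega : Omega) =>
    (1 / (theta n * Num.sqrt n%:R)) *: M n omega in
  [/\ weak_cvg (fun n => expected_esd P (A n)) (semicircle 1),
      much_less (fun n => (r n)%:R) (fun n => n%:R ^+ 2 : R) ->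
        weak_cvg_in_prob P (fun n omega => esd (A n omega)) (semicircle 1) &
      much_less (fun n => (r n)%:R) (fun n => n%:R ^+ 2 / ln n%:R : R) ->
        {ae P, forall omega,
          weak_cvg (fun n => esd (A n omega)) (semicircle 1)}].
Proof.
move=> M theta A.
pose c n : R := 1 / (theta n * Num.sqrt n%:R).
have c2 n : (0 < n)%N -> c n ^+ 2 = ((r n)%:R - 1) / n%:R.
  move=> n0; have r1 : 0 < (r n)%:R - 1 :> R.
    by rewrite subr_gt0 ltr1n; exact: ltnW (hr n n0).
  rewrite /c /theta expr_div_n exprMn expr_div_n !expr1n !sqr_sqrtr ?ler0n ?ltW//.
  by rewrite !div1r invfM invrK.
have Asc := ae_cvg_contraction hr hw hG c2.
have mlam := measurable_contraction_eigenvalue w c hr hG.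
have esdE n x f : continuous f ->
    \int[esd (A n x)]_y f y = average (eigenvalues (A n x)) f.
  by move=> cf; rewrite Rintegral_esd//; exact: continuous_measurable_fun.
have mavg m f : continuous f ->
    measurable_fun setT (fun x => average (eigenvalues (A m.+1 x)) f).
  move=> cf; apply: measurable_average; first exact: mlam.
  exact: continuous_measurable_fun.
have avg_cvg f : continuous f -> bounded_fun f -> {ae P, forall x,
    average (eigenvalues (A m.+1 x)) f @[m --> \oo] --> \int[semicircle 1]_x f x}.
  move=> cf bf; apply: filterS Asc => x /(_ f cf bf).
  by rewrite -(cvg_shiftS (fun n => average (eigenvalues (A n x)) f)).
split.
- move=> f cf bf; have [K fK] := bounded_fun_bound bf.
  rewrite -cvg_shiftS /=.
  have E m : \int[expected_esd P (A m.+1)]_x f x =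
      \int[P]_x average (eigenvalues (A m.+1 x)) f.
    by apply: expected_esdE => //; exact: continuous_measurable_fun.
  under eq_fun do rewrite E.
  apply: (ae_cvg_Rintegral (fun m => mavg m f cf) (avg_cvg f cf bf) (M := K)).
  by move=> m x; exact: average_norm_le.
- move=> _ f cf bf e e0; rewrite -cvg_shiftS /=.
  under eq_fun do under eq_set do rewrite esdE//.
  exact: (ae_cvg_in_prob (fun m => mavg m f cf) (avg_cvg f cf bf) e0).
move=> _; apply: filterS Asc => x H f cf bf.
by under eq_fun do rewrite esdE//; exact: H.
Qed.
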